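(* There exist positive constants $C_4,C_5$, independent of the solution, such that the following holds. If $u$ is a weak solution to problem (P) that blows up at the finite time $T_{max}$, then $$T_{max}\ge\int_{M(0)}^{\infty}\frac{ds}{C_4+C_5s^{q}},$$ where $M(0)=\|u_1\|_2^2+\|\nabla u_0\|_2^2$ and $q\in(1,2^*-1)$ is the growth exponent of $f$ in (H2).
   Context: Let $\Omega\subset\mathbb{R}^n$ ($n\ge1$) be a bounded domain with smooth boundary. Problem (P) is $$u_{tt}-\Delta u-\Delta u_t+u_t=f(u)\ \ (x\in\Omega,\ t>0),\qquad u=0\ \ (x\in\partial\Omega,\ t>0),\qquad u(x,0)=u_0(x),\ u_t(x,0)=u_1(x)\ \ (x\in\Omega),$$ with $u_0\in H_0^1(\Omega)$, $u_1\in L^2(\Omega)$. Let $2^*=+\infty$ for $n=1,2$ and $2^*=\frac{2n}{n-2}$ for $n\ge3$. The function $f\in C^1(\mathbb{R})$, with $F(s)=\int_0^s f(t)\,dt$, satisfies: (H1) there is a constant $p>2$ with $sf(s)\ge pF(s)$ for all $s\in\mathbb{R}$; (H2) there are constants $\alpha,\beta>0$ and $q\in(1,2^*-1)$ with $|f(s)|\le\alpha+\beta|s|^q$ for all $s\in\mathbb{R}$; (H3) there are constants $k_0,k_1>0$ and $l_1\in(0,2^*-2)$ with $|f'(s)|\le k_0+k_1|s|^{l_1}$ for all $s\in\mathbb{R}$. The domain $\Omega$ and the data $\alpha,\beta,q$ in (H2) are fixed; $C_4,C_5$ may depend on $\Omega,n,q,\alpha,\beta$ but not on $u$ (in particular not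 on $u_0,u_1$). Notation: $\|\cdot\|_2$ is the norm of $L^2(\Omega)$; $\|v\|^2=\|v\|_2^2+\|\nabla v\|_2^2$ for $v\in H_0^1(\Omega)$; $\langle\cdot,\cdot\rangle_*$ is the duality pairing between $H^{-1}(\Omega)$ and $H_0^1(\Omega)$. Weak solution: $u$ is a weak solution of (P) over $[0,T]$ if $u\in C([0,T];H_0^1(\Omega))\cap C^1([0,T];L^2(\Omega))\cap C^2([0,T];H^{-1}(\Omega))$ with $u_t\in L^2(0,T;H_0^1(\Omega))$, $u(0)=u_0$, $u_t(0)=u_1$, and for all $\phi\in H_0^1(\Omega)$ and a.e. $t\in[0,T]$ $$\langle u_{tt}(t),\phi\rangle_*+\int_\Omega\nabla u(t)\cdot\nabla\phi\,dx+\int_\Omega\nabla u_t(t)\cdot\nabla\phi\,dx+\int_\Omega u_t(t)\phi\,dx=\int_\Omega f(u(t))\phi\,dx.$$ Under (H2)-(H3), local existence and uniqueness of weak solutions hold. The maximal existence time is $T_{max}=\sup\{T>0: u \text{ exists on }[0,T]\}$. The solution blows up at the finite time $T_{max}$ if $T_{max}<+\infty$ and $\lim_{t\to T_{max}}\big(\int_0^t\|u(\tau)\|^2d\tau+\|u(t)\|_2^2\big)=+\infty$. *)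

(* Defs.v *)
From HB Require Import structures.
From mathcomp Require Import all_boot all_order all_algebra.
From mathcomp Require Import all_classical all_reals all_analysis.

Set Implicit Arguments.
Unset Strict Implicit.
Unset Printing Implicit Defensive.

Import Order.TTheory GRing.Theory Num.Theory.
Import numFieldNormedType.Exports.

Local Open Scope classical_set_scope.
Local Open Scope ring_scope.

(** The library only has Lebesgue measure on [R]. Here [R^n] is ['rV[R]_n] (so
    that the topology and the derivatives of the library apply) with the
    sigma-algebra generated by the coordinates, which is the Borel one. *)

Section measurable_rV.
Context {d} {T : measurableType d} (n : nat).

Let coords : 'I_n -> 'rV[T]_n -> T := fun i x => x ord0 i.

Let rV_set0 : g_sigma_preimage coords set0.
Proof. exact: sigma_algebra0. Qed.

Let rV_setC A : g_sigma_preimage coords A -> g_sigma_preimage coords (~` A).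
Proof. exact: sigma_algebraC. Qed.

Let rV_bigcup (F : (set 'rV[T]_n)^nat) :
  (forall i, g_sigma_preimage coords (F i)) ->
  g_sigma_preimage coords (\bigcup_i (F i)).
Proof. exact: sigma_algebra_bigcup. Qed.

HB.instance Definition _ := @isMeasurable.Build (measure_tuple_display d)
  'rV[T]_n (g_sigma_preimage coords) rV_set0 rV_setC rV_bigcup.

Lemma measurable_rV_coord (i : 'I_n) :
  measurable_fun [set: 'rV[T]_n] (fun x => x ord0 i).
Proof.
move=> _ Y mY; rewrite setTI; apply: sub_sigma_algebra => /=.
rewrite -bigcup_seq/=; exists i => /=; first by rewrite mem_index_enum.
by exists Y => //; rewrite setTI.
Qed.

Lemma measurable_fun_rVP d' (U : measurableType d') (f : U -> 'rV[T]_n) :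
  (forall i, measurable_fun [set: U] (fun u => f u ord0 i)) ->
  measurable_fun [set: U] f.
Proof.
move=> mf; apply: (@measurability _ _ _ _ _ _
  (\big[setU/set0]_(i < n) preimage_set_system [set: 'rV[T]_n] (coords i)
     measurable)) => //.
move=> _ [B + <-]; rewrite -bigcup_seq/= => -[i _ [C mC <-]].
by rewrite setTI; exact: mf.
Qed.

End measurable_rV.

Section lebesgue_rV_step.
Context (R : realType) (n : nat).
Variable m : {sigma_finite_measure set 'rV[R]_n -> \bar R}.

Definition rV_cons (p : R * 'rV[R]_n) : 'rV[R]_n.+1 := row_mx p.1%:M p.2.
Definition rV_uncons (x : 'rV[R]_n.+1) : R * 'rV[R]_n :=
  (@lsubmx _ 1 1 n x ord0 ord0, @rsubmx _ 1 1 n x).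

Lemma rV_consK : cancel rV_cons rV_uncons.
Proof.
by move=> [a y]; rewrite /rV_uncons /rV_cons row_mxKl row_mxKr mxE eqxx.
Qed.

Lemma measurable_rV_cons : measurable_fun [set: R * 'rV[R]_n] rV_cons.
Proof.
apply: measurable_fun_rVP => i; rewrite /rV_cons.
rewrite (_ : (fun _ => _) = match @fintype.split 1 n i with
  | inl _ => fst | inr k => (fun y : 'rV[R]_n => y ord0 k) \o snd end).
  case: fintype.split => k; first exact: measurable_fst.
  by apply: measurableT_comp => //; exact: measurable_rV_coord.
apply/funext => p; rewrite mxE; case: fintype.split => k //.
by rewrite mxE !ord1 eqxx.
Qed.

Lemma measurable_rV_uncons : measurable_fun [set: 'rV[R]_n.+1] rV_uncons.
Proof.
apply: measurable_fun_pair.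
  by under eq_fun do rewrite mxE; exact: measurable_rV_coord.
apply: measurable_fun_rVP => i.
by under eq_fun do rewrite mxE; exact: measurable_rV_coord.
Qed.

Definition lebesgue_rV_step : set 'rV[R]_n.+1 -> \bar R :=
  pushforward (lebesgue_measure \x m)%E rV_cons.

Let step0 : lebesgue_rV_step set0 = 0%E.
Proof. by rewrite /lebesgue_rV_step /pushforward preimage_set0 measure0. Qed.

Let step_ge0 A : (0 <= lebesgue_rV_step A)%E.
Proof. by rewrite /lebesgue_rV_step /pushforward; exact: measure_ge0. Qed.

Let step_sigma_additive : semi_sigma_additive lebesgue_rV_step.
Proof.
move=> F mF tF mUF; rewrite /lebesgue_rV_step /pushforward preimage_bigcup.
apply: measure_semi_sigma_additive.
- by move=> k; rewrite -[X in measurable X]setTI; exact: measurable_rV_cons.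
- apply/trivIsetP => /= i j _ _ ij; rewrite -preimage_setI.
  by move/trivIsetP : tF => /(_ _ _ _ _ ij) ->//; rewrite preimage_set0.
- rewrite -preimage_bigcup -[X in measurable X]setTI.
  exact: measurable_rV_cons.
Qed.

HB.instance Definition _ := isMeasure.Build _ _ _ lebesgue_rV_step
  step0 step_ge0 step_sigma_additive.

Let step_sigma_finite : sigma_finite setT lebesgue_rV_step.
Proof.
have /sigma_finiteP[F [FT ndF Foo]] := sigma_finiteT (@lebesgue_measure R).
have /sigma_finiteP[G [GT ndG Goo]] := sigma_finiteT m.
exists (fun k => rV_uncons @^-1` (F k `*` G k)).
  rewrite -preimage_bigcup; apply/esym/seteqP; split => // x _ /=.
  have [i _ Fi] : (\bigcup_i F i) (rV_uncons x).1 by rewrite -FT.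
  have [j _ Gj] : (\bigcup_j G j) (rV_uncons x).2 by rewrite -GT.
  exists (maxn i j) => //; split.
    by move: Fi; exact/subsetPset/ndF/leq_maxl.
  by move: Gj; exact/subsetPset/ndG/leq_maxr.
move=> k; have [mFk Fkoo] := Foo k; have [mGk Gkoo] := Goo k; split.
  rewrite -[X in measurable X]setTI; apply: measurable_rV_uncons => //.
  exact: measurableX.
rewrite /lebesgue_rV_step /pushforward -comp_preimage.
rewrite (_ : rV_uncons \o rV_cons = id); last first.
  by apply/funext => p; exact: rV_consK.
by rewrite preimage_id product_measure1E// lte_mul_pinfty// ge0_fin_numE.
Qed.

HB.instance Definition _ := Measure_isSigmaFinite.Build _ _ _ lebesgue_rV_step
  step_sigma_finite.

End lebesgue_rV_step.

Fixpoint lebesgue_rV (R : realType) (n : nat) :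
    {sigma_finite_measure set 'rV[R]_n -> \bar R} :=
  match n with
  | 0 => \d_(0 : 'rV[R]_0)
  | k.+1 => lebesgue_rV_step (lebesgue_rV R k)
  end.
Arguments lebesgue_rV {R} n.

Lemma lebesgue_rV_box (R : realType) (n : nat) (A : 'I_n -> set R) :
  (forall i, measurable (A i)) ->
  lebesgue_rV n [set x | forall i, A i (x ord0 i)] =
    (\prod_(i < n) lebesgue_measure (A i))%E.
Proof.
elim: n A => [|n IHn] A mA.
  rewrite big_ord0 /= diracE mem_set//; by case.
have mB : measurable [set x : 'rV[R]_n | forall i, A (lift ord0 i) (x ord0 i)].
  rewrite (_ : [set _ | _] = \bigcap_(i in [set: 'I_n])
      ((fun x : 'rV[R]_n => x ord0 i) @^-1` A (lift ord0 i))).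
    apply: fin_bigcap_measurable => // i _.
    by rewrite -[X in measurable X]setTI; exact: measurable_rV_coord.
  by apply/seteqP; split => x /= Ax => [i _|i]; [exact: Ax|exact: (Ax i)].
rewrite big_ord_recl -IHn// -product_measure1E//.
rewrite /= /lebesgue_rV_step /pushforward; congr product_measure1.
have E0 (p : R * 'rV[R]_n) : rV_cons p ord0 ord0 = p.1.
  by rewrite mxE; case: fintype.splitP => // k _; rewrite mxE !ord1 eqxx.
have EL (p : R * 'rV[R]_n) i : rV_cons p ord0 (lift ord0 i) = p.2 ord0 i.
  rewrite mxE; case: fintype.splitP => k /=; rewrite /bump leq0n add1n.
    by case: k => -[].
  by move=> [ik]; congr (p.2 _ _); exact: val_inj.
apply/seteqP; split => p /=.
  move=> Ap; split; first by rewrite -E0; exact: Ap.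
  by move=> i; rewrite -EL; exact: Ap.
move=> [A0 AL] i; case: (unliftP ord0 i) => [j|] ->; first by rewrite EL.
  by rewrite E0.
exact: mA.
Qed.

Section smooth.
Context {R : realType} {n : nat}.
Implicit Types (f : 'rV[R]_n -> R) (Omega : set 'rV[R]_n).

Definition partial (i : 'I_n) f : 'rV[R]_n -> R :=
  fun x => 'D_(delta_mx ord0 i) f x.

Fixpoint Ck (k : nat) f : Prop :=
  continuous f /\
  match k with
  | 0 => True
  | j.+1 => forall i : 'I_n,
      (forall x, derivable f x (delta_mx ord0 i)) /\ Ck j (partial i f)
  end.

Definition smooth f := forall k, Ck k f.

Definition test_function Omega f :=
  [/\ smooth f, compact (closure [set x | f x != 0]) &
      closure [set x | f x != 0] `<=` Omega].

End smooth.

(** Near each boundary point, [Omega] lies on one side of the graph of a smooth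
    function of the other [n - 1] coordinates, after choosing which coordinate
    [i] is the dependent one and its orientation [b]. *)
Definition smooth_boundary (R : realType) (n : nat) (Omega : set 'rV[R]_n) :=
  forall x0, (closure Omega `\` interior Omega) x0 ->
    exists (U : set 'rV[R]_n) (i : 'I_n) (b : bool) (g : 'rV[R]_n.-1 -> R),
      [/\ nbhs x0 U, smooth g &
          Omega `&` U =
          [set x | U x /\ 0 < (-1) ^+ b * (x ord0 i - g (col' i x))]].

Definition smooth_bounded_domain (R : realType) (n : nat)
    (Omega : set 'rV[R]_n) :=
  [/\ open Omega, Omega !=set0, connected Omega, bounded_set Omega &
      smooth_boundary Omega].

(** Elements of the function spaces on [Omega] are represented by Borel
    functions on ['rV[R]_n], of which only the values on [Omega] matter; the
    norms below are therefore seminorms, and two functions represent the same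
    element when they agree almost everywhere on [Omega]. *)

Section sobolev.
Context {R : realType} {n : nat}.
Variable Omega : set 'rV[R]_n.
Implicit Types (v w g phi : 'rV[R]_n -> R).

Definition L2 : set ('rV[R]_n -> R) :=
  [set v | v \_ Omega \in Lfun (lebesgue_rV n) 2%:E].

Definition L2norm v : R :=
  fine ('N[lebesgue_rV n]_(2%:E) [EFin \o (v \_ Omega)]).

(** Weak partial derivatives are only considered within [L2]. *)
Definition is_weak_partial (i : 'I_n) v g :=
  L2 g /\ forall phi, test_function Omega phi ->
    \int[lebesgue_rV n]_(x in Omega) (v x * partial i phi x) =
    - \int[lebesgue_rV n]_(x in Omega) (g x * phi x).

(** Unique almost everywhere on [Omega] when it exists. *)
Definition weak_partial (i : 'I_n) v : 'rV[R]_n -> R :=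
  xget (fun=> 0) [set g | is_weak_partial i v g].

Definition H1 : set ('rV[R]_n -> R) :=
  [set v | L2 v /\ forall i, exists g, is_weak_partial i v g].

Definition gradnorm v : R :=
  Num.sqrt (\sum_(i < n) L2norm (weak_partial i v) ^+ 2).

Definition H1norm v : R := Num.sqrt (L2norm v ^+ 2 + gradnorm v ^+ 2).

Definition H10 : set ('rV[R]_n -> R) :=
  [set v | H1 v /\ exists phi_ : nat -> 'rV[R]_n -> R,
     (forall k, test_function Omega (phi_ k)) /\
     H1norm (phi_ k - v) @[k --> \oo] --> (0 : R)].

Definition inner v w : R := \int[lebesgue_rV n]_(x in Omega) (v x * w x).

Definition grad_inner v w : R :=
  \int[lebesgue_rV n]_(x in Omega)
    (\sum_(i < n) weak_partial i v x * weak_partial i w x).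

(** [H^-1] is the dual of [H10]: only the values of a functional on [H10]
    matter, and application is the duality pairing. *)
Definition Hm1 : set (('rV[R]_n -> R) -> R) :=
  [set l | (forall (a : R) v w, H10 v -> H10 w ->
              l (a *: v + w) = a * l v + l w) /\
           exists c : R, forall v, H10 v -> `|l v| <= c * H1norm v].

Definition Hm1norm (l : ('rV[R]_n -> R) -> R) : R :=
  sup [set `|l v| | v in [set v | H10 v /\ H1norm v <= 1]].

End sobolev.

(** In this section [X] is a subspace of [E] and [N] a seminorm on it. *)

Section time_functions.
Context {R : realType} {E : lmodType R}.
Variables (X : set E) (N : E -> R) (T : R).
Implicit Types u v w : R -> E.

Definition C0_time u :=
  forall t, t \in `[0, T] -> X (u t) /\
    N (u s - u t) @[s --> within `[0, T] (nbhs t)] --> (0 : R).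

Definition deriv_time u v :=
  forall t, t \in `[0, T] ->
    N ((s - t)^-1 *: (u s - u t) - v t) @[s --> within `[0, T] t^'] --> (0 : R).

Definition C1_time u v := [/\ C0_time u, C0_time v & deriv_time u v].

Definition C2_time u v w := C1_time u v /\ C1_time v w.

Definition simple_time u :=
  exists (m : nat) (A : 'I_m -> set R) (e : 'I_m -> E),
    (forall i, measurable (A i) /\ X (e i)) /\
    forall t, u t = \sum_(i < m) (\1_(A i) t : R) *: e i.

(** The Bochner space [L^2(0, T; X)]. *)
Definition L2_time u :=
  [/\ {ae lebesgue_measure, forall t, t \in `]0, T[ -> X (u t)},
      exists s_ : nat -> R -> E, (forall k, simple_time (s_ k)) /\
        {ae lebesgue_measure, forall t, t \in `]0, T[ ->
           N (s_ k t - u t) @[k --> \oo] --> (0 : R)} &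
      (\int[lebesgue_measure]_(t in `]0%R, T[) ((N (u t)) ^+ 2)%:E < +oo)%E].

End time_functions.

Section nonlinearity.
Context {R : realType}.
Implicit Type f : R -> R.

Definition critical_exponent (n : nat) : \bar R :=
  if (n <= 2)%N then +oo%E else (2 * n%:R / (n%:R - 2))%:E.

Definition C1_fun f := (forall s, derivable f s 1) /\ continuous f^`()%classic.

Definition primitive0 f (s : R) : R :=
  if 0 <= s then \int[lebesgue_measure]_(t in `[0, s]) f t
  else - \int[lebesgue_measure]_(t in `[s, 0]) f t.

Definition superlinear f :=
  exists p : R, 2 < p /\ forall s, p * primitive0 f s <= s * f s.

Definition growth (alpha beta q : R) f :=
  forall s, `|f s| <= alpha + beta * `|s| `^ q.

Definition derivative_growth (n : nat) f :=
  exists k0 k1 l1 : R,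
    [/\ 0 < k0, 0 < k1, 0 < l1, (l1%:E < critical_exponent n - 2%:E)%E &
        forall s, `|f^`()%classic s| <= k0 + k1 * `|s| `^ l1].

End nonlinearity.

Section weak_solution.
Context {R : realType} {n : nat}.
Variables (Omega : set 'rV[R]_n) (f : R -> R) (u0 u1 : 'rV[R]_n -> R).
Implicit Type u : R -> 'rV[R]_n -> R.

(** [ut] is the derivative of [u] in [L2] and [utt] that of [ut] in [H^-1],
    where [L2] is embedded in [H^-1] by [inner]. *)
Definition weak_solution (T : R) u :=
  exists (ut : R -> 'rV[R]_n -> R) (utt : R -> ('rV[R]_n -> R) -> R),
  [/\ [/\ C0_time (H10 Omega) (H1norm Omega) T u,
          C1_time (L2 Omega) (L2norm Omega) T u ut,
          C2_time (Hm1 Omega) (Hm1norm Omega) T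
            (fun t => inner Omega (u t)) (fun t => inner Omega (ut t)) utt &
          L2_time (H10 Omega) (H1norm Omega) T ut],
      {ae lebesgue_rV n, forall x, Omega x -> u 0 x = u0 x},
      {ae lebesgue_rV n, forall x, Omega x -> ut 0 x = u1 x} &
      forall phi, H10 Omega phi ->
        {ae lebesgue_measure, forall t, t \in `[0, T] ->
           utt t phi + grad_inner Omega (u t) phi
             + grad_inner Omega (ut t) phi + inner Omega (ut t) phi
           = inner Omega (f \o u t) phi}].

Definition max_time u : \bar R :=
  ereal_sup [set T%:E | T in [set T | 0 < T /\ weak_solution T u]].

Definition blows_up_at (T : R) u :=
  max_time u = T%:E /\
  (\int[lebesgue_measure]_(tau in `[0, t]) H1norm Omega (u tau) ^+ 2
     + L2norm Omega (u t) ^+ 2) @[t --> T^'-] --> +oo.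

End weak_solution.

(* Main.v *)
From HB Require Import structures.
Require Import Defs.
From mathcomp Require Import all_boot all_order all_algebra.
From mathcomp Require Import all_classical all_reals all_analysis.
From mathcomp Require Import measurable_realfun ring lra.

Set Implicit Arguments.
Unset Strict Implicit.
Unset Printing Implicit Defensive.

Import Order.TTheory GRing.Theory Num.Theory.
Import numFieldNormedType.Exports.

Local Open Scope classical_set_scope.
Local Open Scope ring_scope.

(** Let [M(t) = |u_t|^2 + |grad u|^2]. Testing the equation with [u_t] and
    dropping the damping [|u_t|^2] gives
    [M' <= 2 <f(u), u_t> - 2 |grad u_t|^2 <= B^2 / 2], where [B] bounds the
    functional [f(u)] in the dual of the gradient norm. The subcritical Sobolev
    inequality gives [B <= K (1 + |grad u|)^q], hence [M' < C4 + C5 M^q], so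
    [M] stays bounded as long as [t] is below the integral of
    [1 / (C4 + C5 s^q)]; by the Poincare inequality [M] is unbounded at a
    blow-up time.

    Since [u_t(t)] need not lie in [H10] for every [t], [u_t] is replaced by the
    difference quotient [(u(t + h) - u(t)) / h], and the derivative of [M] by a
    right upper Dini derivative, both obtained by letting [h] tend to [0].

    The Sobolev inequality is proved for test functions from the representation
    of [phi(x)] by the integral of its derivative along [s |-> x + s^m y], where
    [y] runs over a cube so far from [Omega] that [phi(x + y) = 0]; taking [m]
    large is possible because the exponent is subcritical. *)

(** * Borel sets and Lebesgue measure on R^n *)

(** The difficulty is that [u_t] lies in [H10] and solves the equation only for almost every time,
    with an exceptional set depending on the test function. For smooth psi the Laplacian of [u_t] is
    moved onto psi, so the whole left side is continuous in time; the right side enters only through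
    its bound B |grad psi|, so the resulting inequality holds at every interior time. The mean value
    theorem turns it into an inequality for increments over [t, t + h], which passes to H1 limits of
    psi and therefore admits w = u(t + h) - u(t). The strong damping then yields |grad w|^2, which
    absorbs h B |grad w| by completing a square: this is the origin of B^2 / 2. Freezing u on
    [t, t + h] costs its oscillation there, which is small on short intervals. In the Sobolev
    inequality the damping weight s^(2m - 2) has to beat the Jacobian s^(-mn) after both are raised
    to suitable powers; a threshold argument then replaces maximal functions. One number serves as
    C4 and C5. Its summand 1 makes the comparison strict, so that a minimum argument does the work
    of differentiating M. *)

Section boxes.
Context {R : realType} {n : nat}.
Implicit Types (a b c x : 'rV[R]_n) (A : set 'rV[R]_n).

Definition box a b : set 'rV[R]_n :=
  [set x | forall i, a ord0 i < x ord0 i < b ord0 i].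

Definition boxes : set (set 'rV[R]_n) :=
  [set A | exists a b, A = box a b].

Lemma coord_le_norm x i : `|x ord0 i| <= `|x|.
Proof.
by rewrite [leRHS]/Num.Def.normr /= mx_normrE; apply: le_trans (le_bigmax _ _ (ord0, i)).
Qed.

Lemma boxI a b a' b' : box a b `&` box a' b' =
  box (\row_i Num.max (a ord0 i) (a' ord0 i))
      (\row_i Num.min (b ord0 i) (b' ord0 i)).
Proof.
apply/seteqP; split => x /=.
  move=> [xab xab'] i; rewrite !mxE gt_max lt_min.
  by have /andP[-> ->] := xab i; have /andP[-> ->] := xab' i.
move=> xI; split=> i; have := xI i; rewrite !mxE gt_max lt_min => /andP[/andP[]].
  by move=> -> _ /andP[->].
by move=> _ -> /andP[_ ->].
Qed.

Lemma boxes_setI : setI_closed boxes.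
Proof.
by move=> _ _ [a [b ->]] [a' [b' ->]]; rewrite boxI; eexists; eexists.
Qed.

Lemma ball_box x (e : R) : 0 < e -> ball x e = box (x - const_mx e) (x + const_mx e).
Proof.
move=> e0; apply/seteqP; split => y /=.
  by move=> [_ xy] i; have := xy ord0 i; rewrite !mxE /ball/= ltr_distlC.
by move=> xy; split => // i j; rewrite (ord1 i) /ball/= ltr_distlC; have := xy j; rewrite !mxE.
Qed.

Lemma boxE a b : box a b =
  [set x | forall i, (`]a ord0 i, b ord0 i[%classic) (x ord0 i)].
Proof. by apply/seteqP; split=> x /= xab i; have := xab i; rewrite /= in_itv. Qed.

Lemma measurable_box a b : measurable (box a b).
Proof.
have -> : box a b = \bigcap_(i in [set: 'I_n])
    ((fun x : 'rV[R]_n => x ord0 i) @^-1` `]a ord0 i, b ord0 i[).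
  rewrite boxE; apply/seteqP; split => x /= Ax => [i _|i]; first exact: Ax.
  exact: (Ax i).
apply: fin_bigcap_measurable => // i _.
by rewrite -[X in measurable X]setTI; exact: measurable_rV_coord.
Qed.

Definition cbox a b : set 'rV[R]_n :=
  [set x | forall i, a ord0 i <= x ord0 i <= b ord0 i].

Lemma box_cbox a b : box a b `<=` cbox a b.
Proof. by move=> x ab i; have /andP[/ltW -> /ltW ->] := ab i. Qed.

(** The closed box, not only the open one, is required to lie in [A]: with [A] equal to [Omega], a
    bump on the box is then a test function. Rational corners keep the union countable. *)
Lemma open_bigcup_box A : open A -> A = \bigcup_(r : 'rV[rat]_n * 'rV[rat]_n)
  (if `[< cbox (map_mx ratr r.1) (map_mx ratr r.2) `<=` A >]
   then box (map_mx ratr r.1) (map_mx ratr r.2) else set0).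
Proof.
move=> oA; apply/seteqP; split => [x Ax|x [r _]]; last first.
  by case: asboolP => // + /box_cbox xr; exact.
have [e /= e0 xeA] : exists2 e : R, 0 < e & ball x e `<=` A.
  by apply/nbhs_ballP; exact: open_nbhs_nbhs.
have cl i : {p : rat | x ord0 i - e < ratr p < x ord0 i}.
  apply/cid; have /rat_in_itvoo[p] : x ord0 i - e < x ord0 i by lra.
  by rewrite in_itv; exists p.
have cr i : {p : rat | x ord0 i < ratr p < x ord0 i + e}.
  apply/cid; have /rat_in_itvoo[p] : x ord0 i < x ord0 i + e by lra.
  by rewrite in_itv; exists p.
exists (\row_i sval (cl i), \row_i sval (cr i)) => //=.
case: asboolP => [_ i|]; rewrite ?mxE.
  by case: (cl i) => /= p /andP[_ ->]; case: (cr i) => /= p' /andP[-> _].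
move=> nbA; exfalso; apply: nbA => y xy; apply: xeA; rewrite ball_box// => i.
have := xy i; rewrite !mxE.
case: (cl i) => /= p /andP[? ?]; case: (cr i) => /= p' /andP[? ?]; lra.
Qed.

Lemma closed_cbox a b : closed (cbox a b).
Proof.
have -> : cbox a b = \bigcap_(i in [set: 'I_n])
    ((fun x : 'rV[R]_n => x ord0 i) @^-1` `[a ord0 i, b ord0 i]).
  apply/seteqP; split=> x /= abx i.
    by move=> _; rewrite /= in_itv/=; exact: abx.
  by have := abx i I; rewrite /= in_itv/=.
apply: closed_bigI => i _; apply: closed_comp; last exact: itv_closed.
by move=> x _; exact: coord_continuous.
Qed.

Lemma open_boxes_sigma A : open A -> <<s boxes >> A.
Proof.
move=> oA; rewrite (open_bigcup_box oA).
apply: (@countable_bigcupT_measurable _ (g_sigma_algebraType boxes)) => [|r]; first exact: countableP.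
case: asboolP => _; last exact: sigma_algebra0.
by apply: sub_sigma_algebra; eexists; eexists.
Qed.

Lemma measurable_boxesE : measurable = <<s boxes >>.
Proof.
apply/seteqP; split; last first.
  apply: smallest_sub; first exact: sigma_algebra_measurable.
  by move=> _ [a [b ->]]; exact: measurable_box.
apply: smallest_sub; first exact: smallest_sigma_algebra.
move=> A; rewrite -bigcup_seq /= => -[i _ /= [B mB <-]]; rewrite setTI.
suff mf : measurable_fun setT ((fun x => x ord0 i) : g_sigma_algebraType boxes -> R).
  by rewrite -[_ @^-1` _]setTI; exact: mf.
apply: (measurability _ (RGenOInfty.measurableE R)).
move=> _ [_ [c ->] <-]; rewrite setTI; apply: open_boxes_sigma.
apply: (@open_comp _ _ (fun x : 'rV[R]_n => x ord0 i)); last first.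
  exact: rray_open.
by move=> x _; exact: coord_continuous.
Qed.

Lemma open_measurable_rV A : open A -> measurable A.
Proof. by rewrite measurable_boxesE; exact: open_boxes_sigma. Qed.

Lemma continuous_measurable_rV (f : 'rV[R]_n -> R) : continuous f ->
  measurable_fun setT f.
Proof.
move=> cf; apply: (measurability _ (RGenOInfty.measurableE R)).
move=> _ [_ [c ->] <-]; rewrite setTI; apply: open_measurable_rV.
by apply: (@open_comp _ _ f) => //; exact: rray_open.
Qed.

Lemma lebesgue_rV_boxE a b : (forall i, a ord0 i <= b ord0 i) ->
  lebesgue_rV n (box a b) = (\prod_(i < n) (b ord0 i - a ord0 i))%:E.
Proof.
move=> ab; rewrite boxE (@lebesgue_rV_box R n (fun i => `]a ord0 i, b ord0 i[%classic))//.
rewrite -prodEFin; apply: eq_bigr => i _.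
rewrite lebesgue_measure_itv /= lte_fin; case: ltP => // ba.
by rewrite (@le_anti _ _ (b ord0 i) (a ord0 i)) ?ba ?ab// subrr.
Qed.

Lemma box0 a b i : b ord0 i <= a ord0 i -> box a b = set0.
Proof.
by move=> ba; apply/seteqP; split=> // x /(_ i) /andP[ax xb]; lra.
Qed.

Lemma lebesgue_rV_box_fin a b : (lebesgue_rV n (box a b) < +oo)%E.
Proof.
have [ab|] := pselect (forall i, a ord0 i <= b ord0 i).
  by rewrite lebesgue_rV_boxE// ltry.
move=> /existsNP[i /negP]; rewrite -ltNge => /ltW/box0 ->.
by rewrite measure0.
Qed.

Lemma bigcup_box : \bigcup_k box (- const_mx k%:R) (const_mx k%:R) = setT.
Proof.
apply/seteqP; split => // x _; exists (Num.truncn `|x|).+1 => // i.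
rewrite !mxE -ltr_norml (le_lt_trans _ (truncnS_gt _))//.
exact: coord_le_norm.
Qed.

(** Boxes are stable under intersection, generate the Borel sets and exhaust the space through
    centred cubes, so uniqueness of measures on a pi-system applies. It serves affine changes of
    variables and, later, the positive and negative parts of a function with zero integral over
    boxes. *)
Lemma box_measure_unique (m1 m2 : {measure set 'rV[R]_n -> \bar R}) :
  (forall a b, m1 (box a b) = m2 (box a b)) ->
  (forall a b, m1 (box a b) < +oo)%E ->
  forall A, measurable A -> m1 A = m2 A.
Proof.
move=> m12 m1oo A mA.
apply: (measure_unique boxes (fun k => box (- const_mx k%:R) (const_mx k%:R))) => //.
- exact: measurable_boxesE.
- exact: boxes_setI.
- by move=> k; eexists; eexists.
- exact: bigcup_box.
- by move=> _ [a [b ->]].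
Qed.

Lemma bounded_subset_box A : bounded_set A ->
  exists2 r : R, 0 < r & A `<=` box (- const_mx r) (const_mx r).
Proof.
move=> [M [_ MA]]; have M1 : M < `|M| + 1 by have := ler_norm M; lra.
exists (`|M| + 2); first by have := normr_ge0 M; lra.
move=> x /(MA _ M1) xM i; rewrite !mxE -ltr_norml.
apply: (@le_lt_trans _ _ `|x|); last by rewrite (le_lt_trans xM)//; lra.
exact: coord_le_norm.
Qed.

End boxes.
Arguments boxes {R n}.

Section affine_change.
Context {R : realType} {n : nat}.
Variables (t : R) (c : 'rV[R]_n).
Local Notation mu := (lebesgue_rV n).

Let aff (x : 'rV[R]_n) : 'rV[R]_n := t *: x + c.

Lemma measurable_affine : measurable_fun setT aff.
Proof.
apply: measurable_fun_rVP => i.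
under eq_fun do rewrite !mxE.
apply: measurable_funD => //; apply: measurable_funM => //.
exact: measurable_rV_coord.
Qed.

Hypothesis t_gt0 : 0 < t.

Let pre_box a b : aff @^-1` box a b = box (t^-1 *: (a - c)) (t^-1 *: (b - c)).
Proof.
apply/seteqP; split => x /= xab i; have := xab i; rewrite !mxE.
  by rewrite ltr_pdivrMl// ltr_pdivlMl//; lra.
by rewrite ltr_pdivrMl// ltr_pdivlMl//; lra.
Qed.

(** Both sides are measures in [A], so the factor can be read off on boxes, where each of the [n]
    sides is divided by [t]. *)
Lemma lebesgue_rV_affine A : measurable A ->
  mu (aff @^-1` A) = ((t ^- n)%:E * mu A)%E.
Proof.
have tn0 : 0 <= t ^- n by rewrite invr_ge0 exprn_ge0// ltW.
pose m1 : {measure set _ -> \bar R} :=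
  measure_function_pushforward__canonical__measure_function_Measure mu
    measurable_affine.
pose m2 : {measure set _ -> \bar R} := mscale (NngNum tn0) mu.
apply: (@box_measure_unique R n m1 m2) => a b; rewrite /m1 /m2 /= /mscale /pushforward pre_box; last first.
  exact: lebesgue_rV_box_fin.
have [ab|] := pselect (forall i, a ord0 i <= b ord0 i); last first.
  move=> /existsNP[i /negP]; rewrite -ltNge => /ltW ba.
  rewrite (box0 ba) (@box0 _ _ _ _ i) ?measure0 ?mule0//.
  by rewrite !mxE ler_pM2l ?invr_gt0// lerD2r.
rewrite lebesgue_rV_boxE; last first.
  by move=> i; rewrite !mxE ler_pM2l ?invr_gt0// lerD2r.
have <- : ((t ^- n)%:E * (\prod_(i < n) (b ord0 i - a ord0 i))%:E)%E =
    (((NngNum tn0)%:num)%:E * mu (box a b))%E.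
  by congr (_ * _)%E; exact/esym/lebesgue_rV_boxE.
rewrite -EFinM; congr EFin.
transitivity (\prod_(i < n) (t^-1 * (b ord0 i - a ord0 i))).
  by apply: eq_bigr => i _; rewrite !mxE; ring.
by rewrite big_split /= prodr_const card_ord exprVn.
Qed.

Lemma ge0_integral_affine (f : 'rV[R]_n -> \bar R) :
  measurable_fun setT f -> (forall x, 0 <= f x)%E ->
  (\int[mu]_x f (t *: x + c)%R = (t ^- n)%:E * \int[mu]_x f x)%E.
Proof.
move=> mf f0.
have tn0 : 0 <= t ^- n by rewrite invr_ge0 exprn_ge0// ltW.
rewrite -(@ge0_integral_mscale _ _ _ mu setT measurableT (NngNum tn0))//.
rewrite -[LHS](@ge0_integral_pushforward _ _ _ _ _ aff measurable_affine mu setT)//.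
apply: eq_measure_integral; first exact: measurable_affine.
by move=> ? A mA _; exact: lebesgue_rV_affine.
Qed.

End affine_change.

(** * Derivatives along arbitrary directions *)

Section directional_derivatives.
Context {R : realType}.
Implicit Types V W : normedModType R.

Lemma cvg_is_derive V W (f : V -> W) x v (d : W) :
  h^-1 *: (f (h *: v + x) - f x) @[h --> (0:R)^'] --> d -> is_derive x v f d.
Proof.
by move=> fd; split; [apply/cvg_ex; exists d|exact: cvg_lim].
Qed.

Lemma is_derive_cvg V W (f : V -> W) x v (d : W) : is_derive x v f d ->
  h^-1 *: (f (h *: v + x) - f x) @[h --> (0:R)^'] --> d.
Proof. by move=> [df <-]; exact: df. Qed.

Lemma derivable_line V W (f : V -> W) x v : (forall z, derivable f z v) ->
  forall s : R, is_derive s 1 (fun t => f (t *: v + x)) ('D_v f (s *: v + x)).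
Proof.
move=> df s; apply: cvg_is_derive.
have /is_derive_cvg := derivableP (df (s *: v + x)).
apply: cvg_trans; apply: near_eq_cvg; near=> h.
by rewrite addrA -scalerDl [h *: 1]mulr1.
Unshelve. all: by end_near. Qed.

Lemma is_deriveZv V W (f : V -> W) x v (d : W) (c : R) : is_derive x v f d ->
  is_derive x (c *: v) f (c *: d).
Proof.
have [->|c0] := eqVneq c 0; first by rewrite !scale0r => _; exact: is_derive0.
move=> /is_derive_cvg fd; apply: cvg_is_derive.
have cd : (c * h) @[h --> (0:R)^'] --> (0:R)^'.
  rewrite -{2}(mulr0 c); apply: continuous_injective_withinNx.
    exact: mulrl_continuous.
  by move=> y /mulfI; exact.
have : c *: ((c * h)^-1 *: (f ((c * h) *: v + x) - f x)) @[h --> (0:R)^'] --> c *: d.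
  by apply: cvgZ; [exact: cvg_cst|exact: (cvg_comp _ _ cd fd)].
apply: cvg_trans; apply: near_eq_cvg.
near=> h; rewrite /= !scalerA invfM mulrA divff// mul1r.
by rewrite [h * c]mulrC.
Unshelve. all: by end_near. Qed.

(** Difference quotients need increments [h] of either sign; of the intermediate point only the size
    matters. *)
Lemma MVT0 (g dg : R -> R) (h : R) : (forall t : R, is_derive t 1 g (dg t)) ->
  exists2 c, `|c| <= `|h| & g h - g 0 = dg c * h.
Proof.
move=> gd.
have gc (a b : R) : {within `[a, b], continuous g}.
  by apply: derivable_within_continuous => x _; apply: ex_derive.
have [h0|h0] := leP 0 h.
  have [c] := @MVT_segment R g dg 0 h h0 (fun x _ => gd x) (gc _ _).
  rewrite in_itv/= subr0 => /andP[c0 ch] ->; exists c => //.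
  by rewrite !ger0_norm.
have [c] := @MVT_segment R g dg h 0 (ltW h0) (fun x _ => gd x) (gc _ _).
rewrite in_itv/= sub0r => /andP[c0 ch] E; exists c.
  by rewrite (ler0_norm ch) (ltr0_norm h0) lerN2.
by rewrite -[LHS]opprB E mulrN opprK.
Qed.

(** The increment along [v + w] is split at [h *: v + x]. The first leg yields [d]; the second is
    [h] times ['D_w f] at an intermediate point tending to [x], where that derivative is
    continuous. *)
Lemma is_deriveDv V (f : V -> R) x v w (d : R) :
  is_derive x v f d -> (forall z, derivable f z w) ->
  {for x, continuous ('D_w f)} ->
  is_derive x (v + w) f (d + 'D_w f x).
Proof.
move=> /is_derive_cvg fv fw cw; apply: cvg_is_derive.
have key (h : R) : exists2 c, `|c| <= `|h| &
    f (h *: (v + w) + x) - f (h *: v + x) = 'D_w f (c *: w + (h *: v + x)) * h.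
  have [c ch E] := MVT0 h (derivable_line (h *: v + x) fw).
  by exists c => //; rewrite -E scale0r add0r scalerDr (addrC (h *: v)) addrA.
have {key} /choice[c cP] : forall h : R, exists c : R, `|c| <= `|h| /\
    f (h *: (v + w) + x) - f (h *: v + x) = 'D_w f (c *: w + (h *: v + x)) * h.
  by move=> h; have [c ch E] := key h; exists c.
have cvx : (c h *: w + (h *: v + x)) @[h --> (0:R)^'] --> x.
  apply/cvgrPdist_le => e e0; near=> h.
  have -> : x - (c h *: w + (h *: v + x)) = - (c h *: w + h *: v).
    by rewrite addrA opprD addrCA subrr addr0.
  rewrite normrN (le_trans (ler_normD _ _))// !normrZ.
  have [ch _] := cP h.
  apply: (@le_trans _ _ (`|h| * (`|w| + `|v|))).
    by rewrite mulrDr lerD2r ler_wpM2r.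
  apply: (@le_trans _ _ (`|h| * (`|w| + `|v| + 1))).
    by rewrite ler_wpM2l// lerDl.
  rewrite -ler_pdivlMr; last by rewrite ltr_wpDl// addr_ge0.
  near: h; apply: dnbhs0_le; exact: divr_gt0.
have : h^-1 *: (f (h *: v + x) - f x) + 'D_w f (c h *: w + (h *: v + x))
    @[h --> (0:R)^'] --> d + 'D_w f x.
  by apply: cvgD; [exact: fv|exact: (cvg_comp _ _ cvx cw)].
apply: cvg_trans; apply: near_eq_cvg.
near=> h; have [_ E] := cP h.
have h0 : h != 0 by near: h; exact: nbhs_dnbhs_neq.
rewrite /= -[f (_ *: (v + w) + x)](subrK (f (h *: v + x))) E.
by rewrite /GRing.scale/=; field.
Unshelve. all: by end_near. Qed.

End directional_derivatives.

(** * Smooth functions *)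

Section Ck_theory.
Context {R : realType} {n : nat}.
Implicit Types (f g : 'rV[R]_n -> R) (k : nat) (x y : 'rV[R]_n).

Lemma Ck_continuous k f : Ck k f -> continuous f.
Proof. by case: k => [|k] []. Qed.

Lemma CkS k f : Ck k.+1 f -> Ck k f.
Proof.
elim: k f => [|k IHk] f [cf fk]; split=> // i.
by have [df dk] := fk i; split => //; exact: IHk.
Qed.

Lemma partial_cst i (c : R) : partial i (fun _ : 'rV[R]_n => c) = fun=> 0.
Proof. by apply/funext => x; exact: derive_cst. Qed.

Lemma Ck_cst k (c : R) : Ck k (fun _ : 'rV[R]_n => c).
Proof.
elim: k c => [|k IHk] c; split; try exact: cst_continuous; first by [].
by move=> i; rewrite partial_cst; split => // x; exact: derivable_cst.
Qed.

Lemma partialD i f g : (forall x, derivable f x (delta_mx ord0 i)) ->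
  (forall x, derivable g x (delta_mx ord0 i)) ->
  partial i (f \+ g) = partial i f \+ partial i g.
Proof. by move=> df dg; apply/funext => x; exact: deriveD. Qed.

Lemma partialM i f g : (forall x, derivable f x (delta_mx ord0 i)) ->
  (forall x, derivable g x (delta_mx ord0 i)) ->
  partial i (f \* g) = (f \* partial i g) \+ (g \* partial i f).
Proof. by move=> df dg; apply/funext => x; exact: deriveM. Qed.

Lemma CkD k f g : Ck k f -> Ck k g -> Ck k (f \+ g).
Proof.
elim: k f g => [|k IHk] f g [cf fk] [cg gk]; split => //.
- by move=> x; exact: (continuousD (cf x) (cg x)).
- by move=> x; exact: (continuousD (cf x) (cg x)).
- move=> i; have [df dfk] := fk i; have [dg dgk] := gk i; split.
    by move=> x; apply: derivableD.
  by rewrite partialD//; exact: IHk.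
Qed.

Lemma CkM k f g : Ck k f -> Ck k g -> Ck k (f \* g).
Proof.
elim: k f g => [|k IHk] f g fk1 gk1; have [cf fk] := fk1; have [cg gk] := gk1;
  split => //.
- by move=> x; exact: (continuousM (cf x) (cg x)).
- by move=> x; exact: (continuousM (cf x) (cg x)).
- move=> i; have [df dfk] := fk i; have [dg dgk] := gk i; split.
    by move=> x; apply: derivableM.
  by rewrite partialM//; apply: CkD; apply: IHk => //; exact: CkS.
Qed.

Lemma smooth_cst (c : R) : smooth (fun _ : 'rV[R]_n => c).
Proof. by move=> k; exact: Ck_cst. Qed.

Lemma smoothD f g : smooth f -> smooth g -> smooth (f \+ g).
Proof. by move=> sf sg k; exact: CkD. Qed.

Lemma smoothM f g : smooth f -> smooth g -> smooth (f \* g).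
Proof. by move=> sf sg k; exact: CkM. Qed.

Lemma smoothZ (c : R) f : smooth f -> smooth (c *: f).
Proof. by move=> sf; exact: (smoothM (smooth_cst c) sf). Qed.

Lemma smoothX m f : smooth f -> smooth (fun x => f x ^+ m).
Proof.
move=> sf; elim: m => [|m IHm].
  by under eq_fun do rewrite expr0; exact: smooth_cst.
by under eq_fun do rewrite exprS; exact: smoothM.
Qed.

Lemma smooth_prod (I : Type) (r : seq I) (F : I -> 'rV[R]_n -> R) :
  (forall i, smooth (F i)) -> smooth (fun x => \prod_(i <- r) F i x).
Proof.
move=> sF; elim: r => [|i r IHr].
  by under eq_fun do rewrite big_nil; exact: smooth_cst.
by under eq_fun do rewrite big_cons; exact: smoothM.
Qed.

Lemma smooth_partial i f : smooth f -> smooth (partial i f).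
Proof. by move=> sf k; have [_ /(_ i)[]] := sf k.+1. Qed.

Lemma smooth_derivable i f : smooth f -> forall x, derivable f x (delta_mx ord0 i).
Proof. by move=> sf; have [_ /(_ i)[]] := sf 1%N. Qed.

Lemma smooth_continuous f : smooth f -> continuous f.
Proof. by move=> sf; exact: Ck_continuous (sf 0%N). Qed.

(** [smooth] speaks of partial derivatives only. The direction [y] is assembled one coordinate at a
    time with [is_deriveDv], whose continuity condition is met because the partial derivatives are
    continuous. *)
Lemma is_derive_smooth f x y : smooth f ->
  is_derive x y f (\sum_i y ord0 i * partial i f x).
Proof.
move=> sf; pose s (r : seq 'I_n) : 'rV[R]_n := \sum_(i <- r) y ord0 i *: delta_mx ord0 i.
suff H (r : seq 'I_n) (z : 'rV[R]_n) : is_derive z (s r) f (\sum_(i <- r) y ord0 i * partial i f z).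
  by rewrite {1}[y]matrix_sum_delta big_ord1; exact: H.
elim: r z => [|i r IHr] z.
  by rewrite /s !big_nil; exact: is_derive0.
have df (w : 'rV[R]_n) : is_derive w (y ord0 i *: delta_mx ord0 i) f
    (y ord0 i * partial i f w).
  apply: is_deriveZv; apply: derivableP; exact: smooth_derivable.
have dE : 'D_(y ord0 i *: delta_mx ord0 i) f = fun w => y ord0 i * partial i f w.
  by apply/funext => w; exact: derive_val.
rewrite /s !big_cons [X in is_derive _ X]addrC [X in is_derive _ _ _ X]addrC.
have <- := congr1 (@^~ z) dE; rewrite /=.
refine (is_deriveDv (IHr z) _ _).
  by move=> w; exact: ex_derive.
rewrite dE.
exact: (smooth_continuous (smoothM (smooth_cst (y ord0 i)) (smooth_partial i sf))).
Qed.

Lemma is_derive_smooth_line f x y (s : R) : smooth f ->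
  is_derive s 1 (fun t : R => f (t *: y + x))
    (\sum_i y ord0 i * partial i f (s *: y + x)).
Proof.
move=> sf; have := @derivable_line _ _ _ f x y
  (fun z => @ex_derive _ _ _ _ _ _ _ (is_derive_smooth z y sf)) s.
by rewrite (derive_val (is_derive := is_derive_smooth _ y sf)).
Qed.

End Ck_theory.

(** * Smooth bump functions *)

Section bump.
Context {R : realType}.
Implicit Types (P : {poly R}) (x : R).

(** The classical flat function exp(-1/x), extended by 0, with a polynomial factor in 1/x: this
    makes the family stable under differentiation. *)
Definition flat P x : R := if 0 < x then P.[x^-1] * expR (- x^-1) else 0.

(** Each monomial is handled by the exponential series, which gives t^i <= i! exp(t) for t >= 0. *)
Lemma poly_expRN_bounded P :
  exists2 C : R, 0 <= C & forall t : R, 0 <= t -> `|P.[t] * expR (- t)| <= C.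
Proof.
exists (\sum_(i < size P) `|P`_i| * (i`!)%:R).
  by apply: sumr_ge0 => i _; rewrite mulr_ge0.
move=> t t0; rewrite horner_coef mulr_suml.
apply: le_trans (ler_norm_sum _ _ _) _; apply: ler_sum => i _.
rewrite normrM normrM -mulrA ler_wpM2l// ger0_norm ?exprn_ge0//.
rewrite ger0_norm ?expR_ge0// expRN ler_pdivrMr ?expR_gt0//.
case: (i : nat) => [|j].
  by rewrite expr0 fact0 mul1r; apply: le_trans (expR_ge1Dx t); rewrite lerDl.
have := expR_ge1Dxn j t0; have f0 : 0 < ((j.+1)`!)%:R :> R by rewrite ltr0n fact_gt0.
move=> h; rewrite mulrC -ler_pdivrMr//; apply: le_trans h.
by rewrite lerDr.
Qed.

Lemma is_derive_flat P x : is_derive x 1 (flat P) (flat ('X^2 * (P - P^`())) x).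
Proof.
have [x0|x0|<-] := ltgtP 0 x.
- have xV : is_derive x 1 (fun y : R => y^-1) (- x ^- 2).
    have := @is_deriveV R id x 1 1 (lt0r_neq0 x0) (is_derive_id x 1).
    by rewrite /GRing.scale /= mulr1.
  rewrite {2}/flat x0.
  suff : is_derive x 1 (fun y : R => P.[y^-1] * expR (- y^-1))
      (('X^2 * (P - P^`())).[x^-1] * expR (- x^-1)).
    apply: near_eq_is_derive; near=> y; rewrite /flat ifT//.
    by near: y; exact: lt_nbhsr.
  have d1 := is_derive1_comp (is_derive_poly P x^-1) xV.
  have d2 := @is_derive1_comp R expR (- (fun y : R => y^-1)) x _ _
    (is_derive_expR (- x^-1)) (is_deriveN xV).
  apply: (is_derive_eq (is_deriveM d1 d2)).
  rewrite /= !hornerE /GRing.scale /= -exprVn; ring.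
- rewrite {2}/flat ltNge ltW//=.
  have : is_derive x 1 (cst 0 : R -> R) 0 by exact: is_derive_cst.
  apply: near_eq_is_derive; near=> y.
  rewrite /flat ifF//; apply/negbTE; rewrite -leNgt ltW//.
  by near: y; exact: lt_nbhsl.
- rewrite {2}/flat ltxx; apply: cvg_is_derive.
  (* At 0 the difference quotient P(1/h) exp(-1/h) / h equals h times the value of X^2 P at 1/h
     times exp(-1/h), and the latter product is bounded. *)
  have [C C0 PC] := poly_expRN_bounded ('X^2 * P).
  apply/cvgrPdist_le => e e0; near=> h.
  rewrite sub0r normrN /GRing.scale /= mulr1 addr0 {2}/flat ltxx subr0 /flat.
  case: ifP => h0; last by rewrite mulr0 normr0 ltW.
  have := PC h^-1; rewrite invr_ge0 (ltW h0) hornerM hornerXn => /(_ isT).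
  have -> : h^-1 * (P.[h^-1] * expR (- h^-1)) =
      h * (h^-1 ^+ 2 * P.[h^-1] * expR (- h^-1)) by field; rewrite gt_eqF.
  rewrite [`|h * _|]normrM => /(ler_wpM2l (normr_ge0 h)) /le_trans; apply.
  apply: (@le_trans _ _ (`|h| * (C + 1))); first by rewrite ler_wpM2l// lerDl.
  rewrite -ler_pdivlMr; last by rewrite ltr_wpDl.
  near: h; apply: dnbhs0_le; apply: divr_gt0 => //; by rewrite ltr_wpDl.
Unshelve. all: by end_near. Qed.

End bump.

Section smooth_bumps.
Context {R : realType} {n : nat}.

(** The induction on the order of differentiability runs over all polynomials at once, since each
    derivative replaces [P] by another polynomial. *)
Lemma smooth_flat (P : {poly R}) (i : 'I_n) (c d : R) :
  smooth (fun x : 'rV[R]_n => flat P (c * x ord0 i + d)).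
Proof.
have dflat (Q : {poly R}) (j : 'I_n) (x : 'rV[R]_n) : is_derive x (delta_mx ord0 j)
    (fun x => flat Q (c * x ord0 i + d))
    ((i == j)%:R * c * flat ('X^2 * (Q - Q^`())) (c * x ord0 i + d)).
  apply: cvg_is_derive.
  have /is_derive_cvg := is_deriveZv ((i == j)%:R * c) (is_derive_flat Q (c * x ord0 i + d)).
  apply: cvg_trans; apply: near_eq_cvg; near=> h.
  rewrite !mxE eqxx /= (eq_sym i) ; congr (_ *: (flat _ _ - _)).
  by rewrite /GRing.scale /= ; ring.
move=> k; elim: k P => [|k IHk] P.
  have ci : continuous (fun y : 'rV[R]_n => c * y ord0 i + d).
    move=> y.
    have yi : (fun z : 'rV[R]_n => z ord0 i) @ y --> y ord0 i.
      exact: coord_continuous.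
    exact: (cvgD (cvgM (cvg_cst c) yi) (cvg_cst d)).
  split=> // x; apply: (@continuous_comp _ _ _ (fun y : 'rV[R]_n => c * y ord0 i + d) (flat P)).
    exact: ci.
  apply: differentiable_continuous; apply/derivable1_diffP.
  by apply: ex_derive; exact: is_derive_flat.
split; first exact: (Ck_continuous (IHk P)).
move=> j; split; first by move=> x; exact: ex_derive.
have -> : partial j (fun x : 'rV_n => flat P (c * x ord0 i + d)) =
   (fun=> (i == j)%:R * c) \* (fun x : 'rV_n => flat ('X^2 * (P - P^`())) (c * x ord0 i + d)).
  by apply/funext => x; exact: derive_val.
by apply: CkM; [exact: Ck_cst|exact: IHk].
Unshelve. all: by end_near. Qed.

End smooth_bumps.

(** * Test functions *)

Section test_functions.
Context {R : realType} {n : nat}.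
Variable Omega : set 'rV[R]_n.
Implicit Types (f g phi psi : 'rV[R]_n -> R) (x : 'rV[R]_n).
Local Notation supp f := (closure [set x | f x != 0]).

Lemma supp_out f x : ~ supp f x -> \forall y \near x, f y = 0.
Proof.
move=> nfx; have : open (~` supp f) by apply/closed_openC/closed_closure.
rewrite openE => /(_ x nfx); apply: filterS => y nfy.
apply/eqP; apply: contra_notT nfy => fy0; exact: subset_closure.
Qed.

Lemma test_function_out phi x : test_function Omega phi -> ~ Omega x -> phi x = 0.
Proof.
move=> [_ _ sO] nOx; apply/eqP; apply: contra_notT nOx => px.
by apply: sO; exact: subset_closure.
Qed.

Lemma test_function_supp phi psi : test_function Omega phi -> smooth psi ->
  [set x | psi x != 0] `<=` supp phi -> test_function Omega psi.
Proof.
move=> [_ cphi phiO] spsi sub.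
have {}sub : supp psi `<=` supp phi.
  rewrite [X in X `<=` _]closureE; apply: smallest_sub => //.
  exact: closed_closure.
split => //; last exact: subset_trans phiO.
by apply: (subclosed_compact _ cphi) => //; exact: closed_closure.
Qed.

Lemma test_function_partial i phi : test_function Omega phi ->
  test_function Omega (partial i phi).
Proof.
move=> tphi; have [sphi _ _] := tphi.
apply: (test_function_supp tphi); first exact: smooth_partial.
move=> x /= /eqP px0; apply: contrapT => /supp_out phi0; apply: px0.
have := near_eq_derive (delta_mx ord0 i) (phi0 : \forall y \near x, phi y = cst 0 y).
by rewrite derive_cst.
Qed.

Lemma test_functionM phi psi : test_function Omega phi -> smooth psi ->
  test_function Omega (phi \* psi).
Proof.
move=> tphi spsi; have [sphi _ _] := tphi.
apply: (test_function_supp tphi); first exact: smoothM.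
move=> x /= px0; apply: subset_closure => /=; apply: contra_neq px0 => ->.
by rewrite mul0r.
Qed.

Lemma test_functionZ (c : R) phi : test_function Omega phi ->
  test_function Omega (c *: phi).
Proof.
move=> tphi; have [sphi _ _] := tphi.
apply: (test_function_supp tphi); first exact: smoothZ.
move=> x /= px0; apply: subset_closure => /=; apply: contra_neq px0 => px0.
by rewrite -[LHS]/(c * phi x) px0 mulr0.
Qed.

Lemma test_functionD phi psi : test_function Omega phi ->
  test_function Omega psi -> test_function Omega (phi + psi).
Proof.
move=> [sphi cphi phiO] [spsi cpsi psiO].
have sub : supp (phi + psi) `<=` supp phi `|` supp psi.
  rewrite -closureU; apply: closureS => x /= px0.
  have [p0|] := eqVneq (phi x) 0; last by left.
  by right; move: px0; rewrite /= -[(phi + psi) x]/(phi x + psi x) p0 add0r.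
split; first exact: smoothD.
  apply: (subclosed_compact _ (compactU cphi cpsi)) => //; exact: closed_closure.
by move=> x /sub[/phiO|/psiO].
Qed.

Lemma test_function_box phi : test_function Omega phi ->
  exists2 r : R, 0 < r & forall x, phi x != 0 -> box (- const_mx r) (const_mx r) x.
Proof.
move=> [_ cphi _]; have [r r0 sr] := bounded_subset_box (compact_bounded cphi).
by exists r => // x px; apply: sr; exact: subset_closure.
Qed.

Lemma test_function_bounded phi : test_function Omega phi ->
  exists2 C : R, 0 < C & forall x, `|phi x| <= C.
Proof.
move=> tphi; have [sphi cphi _] := tphi.
have : compact (phi @` supp phi).
  apply: continuous_compact cphi; apply: continuous_subspaceT.
  exact: smooth_continuous.
move=> /compact_bounded [M [_ HM]].
exists (`|M| + 1); first by rewrite ltr_wpDl.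
move=> x; have [->|px] := eqVneq (phi x) 0; first by rewrite normr0 addr_ge0.
apply: HM; last by exists x => //; exact: subset_closure.
by have := ler_norm M; lra.
Qed.

End test_functions.

Section test_function_integral.
Context {R : realType} {n : nat}.
Implicit Types (phi psi : 'rV[R]_n -> R).
Local Notation mu := (lebesgue_rV n).

Lemma integrable_bounded_box (f : 'rV[R]_n -> R) (a b : 'rV[R]_n) (C : R) :
  measurable_fun setT f -> (forall x, f x != 0 -> box a b x) ->
  (forall x, `|f x| <= C) -> mu.-integrable setT (EFin \o f).
Proof.
move=> mf fab fC.
have -> : EFin \o f = (EFin \o f) \_ (box a b).
  apply/funext => x; rewrite patchE; case: ifPn => //; rewrite notin_setE => nx.
  by have [/= ->//|/fab] := eqVneq (f x) 0.
apply: (integrable_mkcond (EFin \o f) (measurable_box a b)).1.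
apply: measurable_bounded_integrable.
- exact: measurable_box.
- exact: lebesgue_rV_box_fin.
- exact: measurable_funTS.
- exists C; split; first exact: num_real.
  by move=> y Cy x _ /=; apply: le_trans (ltW Cy).
Qed.

Lemma test_function_integrable Omega phi : test_function Omega phi ->
  mu.-integrable setT (EFin \o phi).
Proof.
move=> tphi; have [C C0 pC] := test_function_bounded tphi.
have [r r0 pr] := test_function_box tphi.
apply: (integrable_bounded_box _ pr pC).
by apply: continuous_measurable_rV; apply: smooth_continuous; case: tphi.
Qed.

Lemma integral_translate (f : 'rV[R]_n -> R) (c : 'rV[R]_n) :
  mu.-integrable setT (EFin \o f) ->
  mu.-integrable setT (fun x => (f (x + c))%:E) /\
  (\int[mu]_x (f (x + c))%:E = \int[mu]_x (f x)%:E)%E.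
Proof.
move=> fi; have /integrableP[/measurable_EFinP mf fI] := fi.
have tE (g : 'rV[R]_n -> \bar R) : measurable_fun setT g -> (forall x, 0 <= g x)%E ->
    (\int[mu]_x g (x + c)%R = \int[mu]_x g x)%E.
  move=> mg g0; have := ge0_integral_affine c ltr01 mg g0.
  rewrite expr1n invr1 mul1e => <-; apply: eq_integral => x _.
  by rewrite scale1r.
have mc : measurable_fun setT (fun x : 'rV[R]_n => f (x + c)).
  have mt := measurable_affine 1 c.
  have -> : (fun x : 'rV[R]_n => f (x + c)) = f \o (fun x => 1 *: x + c).
    by apply/funext => x /=; rewrite scale1r.
  exact: measurableT_comp.
have ic : mu.-integrable setT (fun x => (f (x + c))%:E).
  apply/integrableP; split; first exact/measurable_EFinP.
  rewrite (tE (fun x => `|(f x)%:E|)%E)//.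
  by do 2 apply: measurableT_comp => //.
have mEf : measurable_fun setT (EFin \o f) by exact/measurable_EFinP.
split => //; rewrite [LHS]integralE [RHS]integralE; congr (_ - _)%E.
  rewrite -(tE _ (measurable_funepos mEf) (funepos_ge0 _)).
  by apply: eq_integral => x _; rewrite /= !funeposE.
rewrite -(tE _ (measurable_funeneg mEf) (funeneg_ge0 _)).
by apply: eq_integral => x _; rewrite /= !funenegE.
Qed.

(** By translation invariance every difference quotient along coordinate [i] has integral 0. The
    quotients are bounded by the supremum of the partial derivative and vanish off a fixed box, so
    dominated convergence passes to the limit. *)
Lemma Rintegral_partial Omega phi i : test_function Omega phi ->
  \int[mu]_x partial i phi x = 0.
Proof.
move=> tphi; have [sphi _ _] := tphi.
pose e : 'rV[R]_n := delta_mx ord0 i.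
pose h k : R := k.+1%:R^-1.
have h0 k : 0 < h k by rewrite invr_gt0.
pose D k (x : 'rV[R]_n) : R := (h k)^-1 * (phi (x + h k *: e) - phi x).
have [C C0 pC] := test_function_bounded (test_function_partial i tphi).
have [r r0 pr] := test_function_box tphi.
have dphi := @smooth_derivable _ _ i _ sphi.
have pi := test_function_integrable tphi.
have mphi : measurable_fun setT phi.
  by apply: continuous_measurable_rV; exact: smooth_continuous.
have DC k x : `|D k x| <= C.
  have [c _ E] := MVT0 (h k) (derivable_line x dphi).
  move: E; rewrite scale0r add0r [_ *: _ + x]addrC /D => ->.
  by rewrite mulrC mulfK ?gt_eqF//; exact: pC.
(* The steps [h k] are at most 1, so a unit margin around the support contains all shifted
   supports. *)
pose B : set 'rV[R]_n := box (- const_mx (r + 1)) (const_mx (r + 1)).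
have DB k x : D k x != 0 -> B x.
  move=> Dx; have : (phi (x + h k *: e) != 0) || (phi x != 0).
    apply: contra_neqT Dx; rewrite negb_or !negbK => /andP[/eqP p1 /eqP p2].
    by rewrite /D p1 p2 subrr mulr0.
  have hk1 : h k <= 1 by rewrite invf_le1// ler1n.
  move=> /orP[] /pr xr j; have := xr j; rewrite !mxE; last lra.
  move: (h k) (h0 k) hk1 => t t0 t1.
  by rewrite eqxx; case: (j == i) => /= /andP[p1 p2]; apply/andP; split; lra.
have tr k := integral_translate (h k *: e) pi.
have mD k : measurable_fun setT (D k).
  apply: measurable_funM => //; apply: measurable_funB => //.
  by have [/integrableP[/measurable_EFinP]] := tr k.
have ID k : (\int[mu]_x (D k x)%:E = 0)%E.
  under eq_integral do rewrite EFinM EFinB.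
  rewrite integralZl//; last by apply: integrableB => //; have [] := tr k.
  rewrite integralB//; last by have [] := tr k.
  by have [_ ->] := tr k; rewrite subee ?mule0//; exact: integrable_fin_num.
have cB : mu.-integrable setT (EFin \o (fun x => C * \1_B x)).
  apply: (@integrable_bounded_box _ (- const_mx (r + 1)) (const_mx (r + 1)) C).
  - apply: measurable_funM => //; apply: measurable_indic; exact: measurable_box.
  - move=> x; rewrite indicE; case: (boolP (x \in B)); first by rewrite inE.
    by rewrite mulr0 eqxx.
  - move=> x; rewrite indicE normrM (ger0_norm (ltW C0)) ler_piMr ?(ltW C0)//.
    by rewrite ger0_norm// lern1 leq_b1.
have [] := @dominated_convergence _ _ _ mu setT measurableT (fun k x => (D k x)%:E)
  (EFin \o partial i phi) (EFin \o (fun x => C * \1_B x)).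
- by move=> k; exact/measurable_EFinP.
- apply/measurable_EFinP; apply: continuous_measurable_rV.
  by apply: smooth_continuous; exact: smooth_partial.
- apply: aeW => x _; apply: cvg_EFin; first exact: nearW.
  have /is_derive_cvg xd := derivableP (dphi x).
  have hc : h k @[k --> \oo] --> (0:R)^'.
    have h_cvg : h k @[k --> \oo] --> (0:R) by exact: cvg_harmonic.
    move=> A; rewrite /dnbhs /within /= => H.
    have H2 : \forall k \near \oo, h k != 0 -> A (h k) by exact: (h_cvg _ H).
    have : \forall k \near \oo, A (h k).
      by apply: filterS H2 => k; apply; rewrite gt_eqF ?h0.
    exact.
  have := cvg_comp _ _ hc xd; apply: cvg_trans; apply: near_eq_cvg.
  by apply: nearW => k; rewrite /= [h k *: _ + x]addrC.
- exact: cB.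
- apply: aeW => x k _; rewrite lee_fin indicE.
  case: (boolP (x \in B)) => xB; first by rewrite mulr1.
  rewrite mulr0; have [->|/DB] := eqVneq (D k x) 0; first by rewrite normr0.
  by move: xB; rewrite notin_setE.
move=> _ _ lim.
have {}lim : (0%E : \bar R) @[k --> \oo] --> (\int[mu]_x (partial i phi x)%:E)%E.
  by apply: cvg_trans lim; apply: near_eq_cvg; apply: nearW => k; rewrite /= ID.
by rewrite /Rintegral -(cvg_unique _ (cvg_cst _) lim).
Qed.

End test_function_integral.

(** * The fundamental lemma of the calculus of variations *)

Section fundamental_lemma.
Context {R : realType} {n : nat}.
Variable Omega : set 'rV[R]_n.
Implicit Types (phi psi g : 'rV[R]_n -> R).
Local Notation mu := (lebesgue_rV n).

Lemma Rintegral_off (F : 'rV[R]_n -> R) : (forall x, ~ Omega x -> F x = 0) ->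
  \int[mu]_(x in Omega) F x = \int[mu]_x F x.
Proof.
move=> F0; rewrite Rintegral_mkcond; congr Rintegral; apply/funext => x.
by rewrite patchE; case: ifPn => //; rewrite notin_setE => /F0 ->.
Qed.

Lemma integration_by_parts_test phi psi i :
  test_function Omega phi -> test_function Omega psi ->
  \int[mu]_(x in Omega) (phi x * partial i psi x) =
  - \int[mu]_(x in Omega) (partial i phi x * psi x).
Proof.
move=> tphi tpsi; have [sphi _ _] := tphi; have [spsi _ _] := tpsi.
rewrite !Rintegral_off; last 2 first.
- by move=> x nO; rewrite (test_function_out tpsi) ?mulr0.
- by move=> x nO; rewrite (test_function_out tphi) ?mul0r.
have i1 := test_function_integrable (test_functionM tphi (smooth_partial i spsi)).
have i2 := test_function_integrable (test_functionM tpsi (smooth_partial i sphi)).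
have := Rintegral_partial i (test_functionM tphi spsi).
rewrite partialM; try exact: smooth_derivable.
rewrite RintegralD// => /eqP; rewrite addr_eq0 => /eqP ->; congr (- _).
by apply: eq_Rintegral => x _; rewrite mulrC.
Qed.

(** The bump is a product over the coordinates of flat functions of the signed distances to the two
    faces. Its being positive exactly on the open box is what lets powers of [1 - psi] recover the
    indicator of the box. *)
Lemma exists_bump (a b : 'rV[R]_n) : (forall i, a ord0 i < b ord0 i) ->
  cbox a b `<=` Omega -> exists psi, [/\ test_function Omega psi,
    forall x, 0 <= psi x <= 2^-1 & forall x, (0 < psi x) <-> box a b x].
Proof.
move=> ab abO.
have flat0 (y : R) : 0 <= flat 1 y.
  by rewrite /flat; case: ifP => // _; rewrite hornerE mul1r expR_ge0.
have flat1 (y : R) : flat 1 y <= 1.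
  rewrite /flat; case: ifP => // y0; rewrite hornerE mul1r -expR0 ler_expR.
  by rewrite oppr_le0 invr_ge0 ltW.
have flatP (y : R) : (0 < flat 1 y) = (0 < y).
  by rewrite /flat; case: ifP => //; rewrite ?ltxx// hornerE mul1r expR_gt0.
pose F i (x : 'rV[R]_n) : R :=
  flat 1 (1 * x ord0 i + - a ord0 i) * flat 1 (- 1 * x ord0 i + b ord0 i).
pose psi x := 2^-1 * \prod_(i < n) F i x.
have F0 i x : 0 <= F i x by rewrite mulr_ge0.
have spsi : smooth psi.
  apply: smoothM; first exact: smooth_cst.
  by apply: smooth_prod => i; apply: smoothM; exact: smooth_flat.
have psiP x : (0 < psi x) <-> box a b x.
  rewrite /psi pmulr_rgt0 ?invr_gt0//; split => [p0 i|bx].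
    have : 0 < F i x.
      rewrite lt_neqAle F0 andbT eq_sym; apply: contraTneq p0 => Fi0.
      by rewrite (bigD1 i)//= Fi0 mul0r ltxx.
    rewrite lt_neqAle eq_sym mulf_eq0 negb_or => /andP[/andP[f1 f2] _].
    have : 0 < flat 1 (1 * x ord0 i + - a ord0 i) by rewrite lt_neqAle eq_sym f1 flat0.
    have : 0 < flat 1 (- 1 * x ord0 i + b ord0 i) by rewrite lt_neqAle eq_sym f2 flat0.
    by rewrite !flatP => ? ?; apply/andP; split; lra.
  apply: prodr_gt0 => i _; have /andP[ax xb] := bx i.
  by rewrite /F mulr_gt0// flatP; lra.
have ps0 x : 0 <= psi x by rewrite mulr_ge0 ?invr_ge0// prodr_ge0.
exists psi; split => //; last first.
  move=> x; rewrite ps0 /= /psi ler_piMr ?invr_ge0//.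
  apply: (@le_trans _ _ (\prod_(i < n) 1)); last by rewrite big1.
  by apply: ler_prod => i _; rewrite F0 mulr_ile1.
have sub : closure [set x | psi x != 0] `<=` cbox a b.
  rewrite closureE; apply: smallest_sub; first exact: closed_cbox.
  move=> x /= px; apply: box_cbox; apply/psiP.
  by rewrite lt_neqAle eq_sym px ps0.
split => //; last exact: subset_trans abO.
apply: bounded_closed_compact; last exact: closed_closure.
exists (`|a| + `|b|); split; first exact: num_real.
move=> M abM x /sub xab.
have M0 : 0 <= M by apply: le_trans (ltW abM); rewrite addr_ge0.
rewrite /= [leLHS]/Num.Def.normr /= mx_normrE; apply/bigmax_leP; split => // -[i j] _ /=.
rewrite (ord1 i) ler_norml; have /andP[ax xb] := xab j.
have := coord_le_norm a j; have := coord_le_norm b j.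
rewrite !ler_norml => /andP[? ?] /andP[? ?].
have := normr_ge0 a; have := normr_ge0 b.
by move=> ? ?; apply/andP; split; lra.
Qed.

Hypothesis mOmega : measurable Omega.

Lemma integral_box_eq0 g (a b : 'rV[R]_n) : mu.-integrable Omega (EFin \o g) ->
  (forall phi, test_function Omega phi -> \int[mu]_(x in Omega) (g x * phi x) = 0) ->
  cbox a b `<=` Omega -> (\int[mu]_(x in box a b) (g x)%:E = 0)%E.
Proof.
move=> ig g0 abO.
have [ab|] := pselect (forall i, a ord0 i < b ord0 i); last first.
  by move=> /existsNP[i /negP]; rewrite -leNgt => /box0 ->; rewrite integral_set0.
have [psi [tpsi psi12 psiP]] := exists_bump ab abO; have [spsi _ _] := tpsi.
have boxO : box a b `<=` Omega by apply: subset_trans abO; exact: box_cbox.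
have /integrableP[/measurable_EFinP mg _] := ig.
(* Polynomials in [psi] without constant term, hence test functions again; they take values in
   [0, 1] and converge pointwise to the indicator of the open box. *)
pose th k x := 1 - (1 - psi x) ^+ k.
have sth k : smooth (th k).
  have -> : th k = (fun=> 1) \+ ((fun=> -1) \* (fun x => ((fun=> 1) \+ ((fun=> -1) \* psi)) x ^+ k)).
    by apply/funext => x /=; rewrite /th /= !mulN1r.
  apply: smoothD; first exact: smooth_cst.
  apply: smoothM; first exact: smooth_cst.
  apply: smoothX; apply: smoothD; first exact: smooth_cst.
  by apply: smoothM => //; exact: smooth_cst.
have tth k : test_function Omega (th k).
  apply: (test_function_supp tpsi) => // x /= tx; apply: subset_closure => /=.
  by apply: contra_neq tx => px; rewrite /th px subr0 expr1n subrr.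
have th01 k x : `|th k x| <= 1.
  have /andP[p0 p1] := psi12 x.
  have q0 : 0 <= 1 - psi x by lra.
  have := exprn_ge0 k q0; have : (1 - psi x) ^+ k <= 1 by rewrite exprn_ile1//; lra.
  by rewrite /th => ? ?; rewrite ler_norml; apply/andP; split; lra.
have mth k : measurable_fun Omega (th k).
  by apply: measurable_funTS; apply: continuous_measurable_rV; exact: smooth_continuous.
have thlim x : th k x @[k --> \oo] --> (\1_(box a b) x : R).
  rewrite indicE; case: (boolP (x \in box a b)); rewrite ?inE ?notin_setE => bx.
    rewrite -[X in _ --> X](subr0 (1 : R)); apply: cvgB; first exact: cvg_cst.
    have /andP[p0 p1] := psi12 x; move/psiP : bx => bx.
    by apply: cvg_expr; rewrite ger0_norm; lra.
  have px : psi x = 0.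
    have /andP[p0 _] := psi12 x; apply/eqP; rewrite eq_le p0 andbT leNgt.
    by apply/negP => /psiP.
  rewrite /th px; under eq_fun do rewrite subr0 expr1n subrr; exact: cvg_cst.
have [] := @dominated_convergence _ _ _ mu Omega mOmega
   (fun k x => (g x * th k x)%:E) (fun x => (g x * \1_(box a b) x)%:E)
   (fun x => `|(g x)%:E|%E).
- by move=> k; apply/measurable_EFinP; exact: measurable_funM.
- apply/measurable_EFinP; apply: measurable_funM => //.
  by apply: measurable_indic; exact: measurable_box.
- apply: aeW => x _; apply: cvg_EFin; first exact: nearW.
  by apply: cvgM; [exact: cvg_cst|exact: thlim].
- exact: integrable_abse.
- by apply: aeW => x k _ /=; rewrite lee_fin normrM ler_piMr.
move=> _ _ lim.
have {}lim : (0%E : \bar R) @[k --> \oo] --> (\int[mu]_(x in Omega) (g x * \1_(box a b) x)%:E)%E.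
  apply: cvg_trans lim; apply: near_eq_cvg; apply: nearW => k.
  have := g0 _ (tth k); rewrite /Rintegral /= => E.
  have fn : (\int[mu]_(x in Omega) (g x * th k x)%:E)%E \is a fin_num.
    apply: integrable_fin_num => //; apply: (le_integrable mOmega _ _ ig).
      by apply/measurable_EFinP; exact: measurable_funM.
    by move=> x _ /=; rewrite lee_fin normrM ler_piMr.
  by rewrite -[LHS]fineK// E.
transitivity (\int[mu]_(x in Omega) (g x * \1_(box a b) x)%:E)%E; last first.
  by rewrite -(cvg_unique _ (cvg_cst _) lim).
rewrite [LHS]integral_mkcond [RHS]integral_mkcond.
apply: eq_integral => x _; rewrite !patchE indicE.
have [xb|xb] := boolP (x \in box a b).
  by rewrite mulr1 ifT//; move: xb; rewrite !inE; exact: boxO.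
by rewrite mulr0; case: ifP.
Qed.

End fundamental_lemma.

Section density.
Context d (T : measurableType d) (R : realType) (mu : {measure set T -> \bar R}).
Variable f : T -> \bar R.
Hypotheses (mf : measurable_fun setT f) (f0 : forall x, (0 <= f x)%E).

(** The proofs about [f] are arguments so that the measure structure can be inferred from the term
    [density_measure mf f0] itself. *)
Definition density_measure of measurable_fun setT f & (forall x, (0 <= f x)%E) :=
  fun A : set T => (\int[mu]_(x in A) f x)%E.

Let density0 : density_measure mf f0 set0 = 0%E.
Proof. exact: integral_set0. Qed.

Let density_ge0 A : (0 <= density_measure mf f0 A)%E.
Proof. exact: integral_ge0. Qed.

Let density_sigma_additive : semi_sigma_additive (density_measure mf f0).
Proof.
move=> F mF tF mUF; rewrite /density_measure ge0_integral_bigcup//.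
  by apply: is_cvg_ereal_nneg_natsum => k _; exact: integral_ge0.
exact: measurable_funTS.
Qed.

HB.instance Definition _ := isMeasure.Build _ _ _ (density_measure mf f0)
  density0 density_ge0 density_sigma_additive.

End density.

Section fundamental_lemma_ae.
Context {R : realType} {n : nat}.
Local Notation mu := (lebesgue_rV n).

(** The positive and negative parts of [g], cut off to the box, are densities of two finite measures
    that agree on all boxes, hence on all Borel sets. So the cut-off function has zero integral over
    every Borel set. *)
Lemma ae_eq0_box (g : 'rV[R]_n -> R) (a b : 'rV[R]_n) :
  mu.-integrable (box a b) (EFin \o g) ->
  (forall a' b' : 'rV[R]_n, (forall i, a ord0 i <= a' ord0 i) ->
     (forall i, b' ord0 i <= b ord0 i) ->
     (\int[mu]_(x in box a' b') (g x)%:E = 0)%E) ->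
  {ae mu, forall x, box a b x -> g x = 0}.
Proof.
move=> ig g0; have mB := measurable_box a b.
pose G : 'rV[R]_n -> \bar R := (EFin \o g) \_ (box a b).
have iG : mu.-integrable setT G by exact: (integrable_mkcond _ mB).1.
have mG := measurable_int _ iG.
have IB A : measurable A ->
    (\int[mu]_(x in A) G x = \int[mu]_(x in A `&` box a b) (g x)%:E)%E.
  by move=> mA; rewrite [RHS]integral_mkcondr.
have IG A : measurable A -> mu.-integrable A G by move=> mA; exact: integrableS iG.
pose m1 : {measure set 'rV[R]_n -> \bar R} :=
  density_measure mu (measurable_funepos mG) (funepos_ge0 G).
pose m2 : {measure set 'rV[R]_n -> \bar R} :=
  density_measure mu (measurable_funeneg mG) (funeneg_ge0 G).
have m1oo A : measurable A -> (m1 A < +oo)%E.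
  by move=> mA; exact: integral_funepos_lt_pinfty (IG _ mA).
have m2oo A : measurable A -> (m2 A < +oo)%E.
  by move=> mA; exact: integral_funeneg_lt_pinfty (IG _ mA).
have m12E A : measurable A -> (\int[mu]_(x in A) G x = m1 A - m2 A)%E.
  by move=> mA; rewrite integralE.
have m12 A : measurable A -> m1 A = m2 A.
  apply: box_measure_unique => a' b'; last by apply: m1oo; exact: measurable_box.
  have mB' := measurable_box a' b'.
  have := m12E _ mB'; rewrite IB// boxI g0; [|by move=> i; rewrite mxE le_max lexx orbT|by move=> i; rewrite mxE ge_min lexx orbT].
  move=> /esym/eqP; rewrite sube_eq ?add0e; [by move/eqP| |].
    by rewrite ge0_fin_numE// m1oo.
  by rewrite fin_num_adde_defl// ge0_fin_numE// m2oo.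
have : ae_eq mu setT G (cst 0%E).
  apply: integral_ae_eq => // E _ mE; rewrite integral_cst// mul0e m12E// m12//.
  by rewrite subee// ge0_fin_numE// m2oo.
apply: filterS => x /(_ I) + bx; rewrite /G patchE mem_set//=.
by move=> [].
Qed.

Lemma fundamental_lemma (Omega : set 'rV[R]_n) (g : 'rV[R]_n -> R) :
  open Omega -> mu.-integrable Omega (EFin \o g) ->
  (forall phi, test_function Omega phi -> \int[mu]_(x in Omega) (g x * phi x) = 0) ->
  {ae mu, forall x, Omega x -> g x = 0}.
Proof.
move=> oO ig g0; have mO := open_measurable_rV oO.
pose F (r : 'rV[rat]_n * 'rV[rat]_n) : set 'rV[R]_n :=
  if `[< cbox (map_mx ratr r.1) (map_mx ratr r.2) `<=` Omega >]
  then box (map_mx ratr r.1) (map_mx ratr r.2) else set0.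
have aeF r : {ae mu, forall x, F r x -> g x = 0}.
  rewrite /F; case: asboolP => cO; last by apply: aeW => x [].
  apply: ae_eq0_box => [|a' b' aa bb].
    apply: integrableS ig => //; first exact: measurable_box.
    by apply: subset_trans cO; exact: box_cbox.
  apply: (integral_box_eq0 mO ig g0); apply: subset_trans cO => x xab i.
  by have /andP[? ?] := xab i; rewrite (le_trans (aa i))// (le_trans _ (bb i)).
(* The countably many null sets are merged along an enumeration by naturals; a code that decodes to
   nothing is sent to the pair (0, 0). *)
have : {ae mu, forall (x : 'rV[R]_n) (k : nat), F (odflt (0, 0) (unpickle k)) x -> g x = 0}.
  by apply: ae_foralln => k; exact: aeF.
apply: filterS => x Fx; rewrite (open_bigcup_box oO) => -[r _ rx].
by apply: (Fx (pickle r)); rewrite pickleK.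
Qed.

End fundamental_lemma_ae.

(** * L2 and Sobolev spaces *)

(** Kept at the level of scalars so that it gives the Cauchy-Schwarz inequality for [inner], for
    [grad_inner], for their sum and for finite sums. For [c] equal to 0 the polynomial is affine in
    [t], which forces [b] to vanish. *)
Lemma discriminant_le (R : realType) (a b c : R) : 0 <= a -> 0 <= c ->
  (forall t, 0 <= a + 2 * t * b + t ^+ 2 * c) -> b ^+ 2 <= a * c.
Proof.
move=> a0 c0 H; have [c_eq0|c_neq0] := eqVneq c 0.
  have [b_eq0|b_neq0] := eqVneq b 0; first by rewrite b_eq0 expr0n/= mulr_ge0.
  have := H (- (a + 1) / (2 * b)); rewrite c_eq0 mulr0 addr0.
  have -> : a + 2 * (- (a + 1) / (2 * b)) * b = - 1 by field.
  by rewrite oppr_ge0 ler10.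
have := H (- b / c).
have -> : a + 2 * (- b / c) * b + (- b / c) ^+ 2 * c = (a * c - b ^+ 2) / c by field.
by rewrite pmulr_lge0 ?subr_ge0// invr_gt0 lt_neqAle eq_sym c_neq0.
Qed.

Lemma normr_le_mul_sqr (R : realDomainType) (x y z : R) : 0 <= y -> 0 <= z ->
  x ^+ 2 <= y ^+ 2 * z ^+ 2 -> `|x| <= y * z.
Proof.
move=> y0 z0; rewrite -exprMn -(real_normK (num_real x)).
by rewrite ler_sqr ?nnegrE ?mulr_ge0.
Qed.

(** The scalar core of the triangle inequality: [b] stands for the inner product and [x], [y], [z]
    for the norms of two vectors and of their combination. It is shared by the L2, gradient and H1
    seminorms. *)
Lemma norm_lin_le (R : realFieldType) (a b x y z xx yy : R) :
  0 <= x -> 0 <= y -> 0 <= z -> x ^+ 2 = xx -> y ^+ 2 = yy -> `|b| <= x * y ->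
  z ^+ 2 = a ^+ 2 * xx + 2 * a * b + yy -> z <= `|a| * x + y.
Proof.
move=> x0 y0 z0 <- <- bxy zE.
rewrite -ler_sqr ?nnegrE ?addr_ge0 ?mulr_ge0// zE.
rewrite sqrrD exprMn real_normK ?num_real// lerD2r lerD2l.
have : `|a| * `|b| <= `|a| * (x * y) by rewrite ler_wpM2l.
have : a * b <= `|a| * `|b| by rewrite -normrM ler_norm.
rewrite -mulr_natl; lra.
Qed.

Lemma ler_dist_triangle (R : realFieldType) (x y z : R) :
  x <= z + y -> y <= z + x -> `|x - y| <= z.
Proof. by move=> h1 h2; rewrite ler_distl; apply/andP; split; lra. Qed.

Section L2_theory.
Context {R : realType} {n : nat}.
Variable Omega : set 'rV[R]_n.
Hypothesis mOmega : measurable Omega.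
Implicit Types (v w z g : 'rV[R]_n -> R) (a : R).
Local Notation mu := (lebesgue_rV n).
Local Notation L2 := (L2 Omega).
Local Notation inner := (inner Omega).
Local Notation L2norm := (L2norm Omega).

Lemma Lnorm2_sqr v :
  ('N[mu]_(2%:E) [EFin \o (v \_ Omega)] `^ 2 = \int[mu]_(x in Omega) (v x ^+ 2)%:E)%E.
Proof.
rewrite powR_Lnorm// [RHS]integral_mkcond; apply: eq_integral => x _.
rewrite /= !patchE; case: ifP => _.
  by rewrite powR_mulrn// real_normK// num_real.
by rewrite normr0 powR0.
Qed.

Lemma L2P v : L2 v <-> measurable_fun Omega v /\
  (\int[mu]_(x in Omega) (v x ^+ 2)%:E < +oo)%E.
Proof.
rewrite -Lnorm2_sqr /Defs.L2 /= inE /=; split.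
  move=> /andP[]; rewrite !inE => mv fv; split.
    exact: (measurable_restrictT _ mOmega).2.
  by rewrite poweR_lty.
move=> [mv fv]; apply/andP; split; rewrite inE.
  exact: (measurable_restrictT _ mOmega).1.
move: fv; rewrite /finite_norm; rewrite /=; case: Lnorm => [r _|/=|_].
- by rewrite ltry.
- by rewrite pnatr_eq0/= ltxx.
- by [].
Qed.

Lemma L2_integrable_sqr v : L2 v -> mu.-integrable Omega (fun x => (v x ^+ 2)%:E).
Proof.
move=> /L2P[mv fv]; apply/integrableP; split.
  by apply/measurable_EFinP; exact: measurable_funX.
by under eq_integral do rewrite gee0_abs ?lee_fin ?sqr_ge0//.
Qed.

Lemma L2_integrableM v w : L2 v -> L2 w ->
  mu.-integrable Omega (fun x => (v x * w x)%:E).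
Proof.
move=> Lv Lw; have /L2P[mv _] := Lv; have /L2P[mw _] := Lw.
have iv := L2_integrable_sqr Lv; have iw := L2_integrable_sqr Lw.
apply: (le_integrable mOmega _ _ (integrableD mOmega iv iw)).
  by apply/measurable_EFinP; exact: measurable_funM.
move=> x _; rewrite /= lee_fin [leRHS]ger0_norm ?addr_ge0 ?sqr_ge0//.
rewrite normrM; have := sqr_ge0 (`|v x| - `|w x|).
by rewrite sqrrB !real_normK ?num_real// => ?; have := sqr_ge0 (v x); have := sqr_ge0 (w x); lra.
Qed.

Lemma L2_lin a v w : L2 v -> L2 w -> L2 (a *: v + w).
Proof.
move=> Lv Lw; have /L2P[mv _] := Lv; have /L2P[mw _] := Lw; apply/L2P; split.
  by apply: measurable_funD => //; exact: measurable_funM.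
have iv := L2_integrable_sqr Lv; have iw := L2_integrable_sqr Lw.
have ivw := L2_integrableM Lv Lw.
have -> : (\int[mu]_(x in Omega) ((a *: v + w) x ^+ 2)%:E =
   \int[mu]_(x in Omega) ((a ^+ 2)%:E * (v x ^+ 2)%:E +
      ((2 * a)%:E * (v x * w x)%:E + (w x ^+ 2)%:E)))%E.
  apply: eq_integral => x _; rewrite -!EFinM -!EFinD; congr EFin.
  by rewrite -[(_ + _) x]/(a * v x + w x); ring.
apply: integrable_lty => //; apply: integrableD => //; first exact: integrableZl.
by apply: integrableD => //; exact: integrableZl.
Qed.

Lemma L2_0 : L2 0.
Proof.
apply/L2P; split; first exact: measurable_cst.
by under eq_integral do rewrite expr0n/=; rewrite integral0.
Qed.

Lemma L2D v w : L2 v -> L2 w -> L2 (v + w).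
Proof. by move=> Lv Lw; rewrite -[v]scale1r; exact: L2_lin. Qed.

Lemma L2Z a v : L2 v -> L2 (a *: v).
Proof. by move=> Lv; rewrite -[_ *: _]addr0; apply: L2_lin => //; exact: L2_0. Qed.

Lemma L2B v w : L2 v -> L2 w -> L2 (v - w).
Proof. by move=> Lv Lw; rewrite addrC -scaleN1r; exact: L2_lin. Qed.

Lemma innerC v w : inner v w = inner w v.
Proof. by apply: eq_Rintegral => x _; rewrite mulrC. Qed.

Lemma inner_lin a v w z : L2 v -> L2 w -> L2 z ->
  inner (a *: v + w) z = a * inner v z + inner w z.
Proof.
move=> Lv Lw Lz; have ivz := L2_integrableM Lv Lz; have iwz := L2_integrableM Lw Lz.
rewrite /inner /Defs.inner -RintegralZl// -RintegralD//;
  last exact: (integrableZl mOmega a ivz).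
by apply: eq_Rintegral => x _; rewrite -[(_ + _) x]/(a * v x + w x) mulrDl mulrA.
Qed.

Lemma inner0l z : L2 z -> inner 0 z = 0.
Proof.
move=> Lz; have := @inner_lin (-1) z z z Lz Lz Lz.
by rewrite scaleN1r addNr mulN1r addNr.
Qed.

Lemma innerDl v w z : L2 v -> L2 w -> L2 z -> inner (v + w) z = inner v z + inner w z.
Proof. by move=> Lv Lw Lz; have := inner_lin 1 Lv Lw Lz; rewrite scale1r mul1r. Qed.

Lemma innerZl a v z : L2 v -> L2 z -> inner (a *: v) z = a * inner v z.
Proof.
by move=> Lv Lz; have := inner_lin a Lv L2_0 Lz; rewrite inner0l// !addr0.
Qed.

Lemma innerBl v w z : L2 v -> L2 w -> L2 z -> inner (v - w) z = inner v z - inner w z.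
Proof.
move=> Lv Lw Lz; have := inner_lin (-1) Lw Lv Lz.
by rewrite scaleN1r addrC => ->; rewrite mulN1r addrC.
Qed.

Lemma inner_ge0 v : 0 <= inner v v.
Proof. by apply: Rintegral_ge0 => x _; rewrite -expr2 sqr_ge0. Qed.

Lemma L2norm_sqr v : L2 v -> L2norm v ^+ 2 = inner v v.
Proof.
move=> Lv; rewrite -powR_mulrn ?fine_ge0 ?Lnorm_ge0// -fine_poweR Lnorm2_sqr.
by congr fine; apply: eq_integral => x _; rewrite expr2.
Qed.

Lemma L2norm_ge0 v : 0 <= L2norm v.
Proof. by rewrite fine_ge0// Lnorm_ge0. Qed.

Lemma L2normE v : L2 v -> L2norm v = Num.sqrt (inner v v).
Proof. by move=> Lv; rewrite -L2norm_sqr// sqrtr_sqr ger0_norm// L2norm_ge0. Qed.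

Lemma inner_sqr a v w : L2 v -> L2 w ->
  inner (a *: v + w) (a *: v + w) =
  a ^+ 2 * inner v v + 2 * a * inner v w + inner w w.
Proof.
move=> Lv Lw; have Lvw := L2_lin a Lv Lw.
rewrite (inner_lin a Lv Lw Lvw) (innerC v (_ + _)) (innerC w (_ + _)).
rewrite (inner_lin a Lv Lw Lv) (inner_lin a Lv Lw Lw) (innerC w v).
by move: (inner v v) (inner v w) (inner w w) => x y z; ring.
Qed.

Lemma inner_CS v w : L2 v -> L2 w -> `|inner v w| <= L2norm v * L2norm w.
Proof.
move=> Lv Lw; rewrite -(@ler_sqr _ _ (_ * _)) ?nnegrE ?mulr_ge0 ?L2norm_ge0//.
rewrite real_normK ?num_real// exprMn !L2norm_sqr//.
apply: discriminant_le; rewrite ?inner_ge0// => t.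
have := inner_ge0 (t *: w + v); rewrite (inner_sqr t Lw Lv) (innerC w v).
by move: (inner v v) (inner v w) (inner w w) => x y z; congr (_ <= _); ring.
Qed.

Lemma ae_eq_inner v v' w : L2 v -> L2 v' -> L2 w ->
  {ae mu, forall x, Omega x -> v x = v' x} -> inner v w = inner v' w.
Proof.
move=> Lv Lv' Lw vv'; rewrite /inner /Defs.inner /Rintegral; congr fine.
have iv := L2_integrableM Lv Lw; have iv' := L2_integrableM Lv' Lw.
apply: ae_eq_integral => //.
- exact: (measurable_int _ iv).
- exact: (measurable_int _ iv').
- by apply: filterS vv' => x vx Ox; rewrite vx.
Qed.

End L2_theory.

Section H1_theory.
Context {R : realType} {n : nat}.
Variable Omega : set 'rV[R]_n.
Hypotheses (oOmega : open Omega) (bOmega : bounded_set Omega).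
Implicit Types (v w z g phi : 'rV[R]_n -> R) (a : R) (i : 'I_n).
Local Notation mu := (lebesgue_rV n).
Local Notation L2 := (L2 Omega).
Local Notation H1 := (H1 Omega).
Local Notation H10 := (H10 Omega).
Local Notation inner := (inner Omega).
Local Notation L2norm := (L2norm Omega).
Local Notation H1norm := (H1norm Omega).
Local Notation gradnorm := (gradnorm Omega).
Local Notation grad_inner := (grad_inner Omega).
Local Notation D i v := (weak_partial Omega i v).
Local Notation test := (test_function Omega).

Let mOmega : measurable Omega. Proof. exact: open_measurable_rV. Qed.

Lemma bounded_lebesgue_rV_fin : (mu Omega < +oo)%E.
Proof.
have [r r0 Or] := bounded_subset_box bOmega.
apply: le_lt_trans (lebesgue_rV_box_fin (- const_mx r) (const_mx r)).
by apply: le_measure => //; rewrite inE//; exact: measurable_box.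
Qed.

Lemma L2_test phi : test phi -> L2 phi.
Proof.
move=> tphi; have [sphi _ _] := tphi.
have [C C0 pC] := test_function_bounded tphi.
apply/(L2P mOmega); split.
  by apply: measurable_funTS; apply: continuous_measurable_rV; exact: smooth_continuous.
apply: (@le_lt_trans _ _ (\int[mu]_(x in Omega) (C ^+ 2)%:E)%E).
  apply: ge0_le_integral => //.
  - by move=> x _; rewrite lee_fin sqr_ge0.
  - apply/measurable_EFinP; apply: measurable_funX; apply: measurable_funTS.
    by apply: continuous_measurable_rV; exact: smooth_continuous.
  - by move=> x _; rewrite lee_fin -(real_normK (num_real (phi x))) lerXn2r// nnegrE ltW.
by rewrite integral_cst// lte_mul_pinfty ?lee_fin ?sqr_ge0// bounded_lebesgue_rV_fin.
Qed.

Lemma L2_cst1 : L2 (fun=> 1).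
Proof.
apply/(L2P mOmega); split; first exact: measurable_cst.
by rewrite expr1n integral_cst// mul1e bounded_lebesgue_rV_fin.
Qed.

Lemma L2_integrable v : L2 v -> mu.-integrable Omega (EFin \o v).
Proof.
move=> Lv; have := L2_integrableM mOmega Lv L2_cst1.
by apply: eq_integrable => // x _ /=; rewrite mulr1.
Qed.

Lemma weak_partial_unique i v g g' :
  is_weak_partial Omega i v g -> is_weak_partial Omega i v g' ->
  {ae mu, forall x, Omega x -> g x = g' x}.
Proof.
move=> [Lg gP] [Lg' gP'].
have Lgg := L2B mOmega Lg Lg'.
have : {ae mu, forall x, Omega x -> (g - g') x = 0}.
  apply: fundamental_lemma => //; first exact: L2_integrable.
  move=> phi tphi; have := innerBl mOmega Lg Lg' (L2_test tphi).
  rewrite /inner /Defs.inner => ->.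
  by apply/eqP; rewrite subr_eq0 -eqr_opp -gP// -gP'.
apply: filterS => x gx Ox; apply/eqP; rewrite -subr_eq0; apply/eqP; exact: gx.
Qed.

Lemma H1_weak_partial i v : H1 v -> is_weak_partial Omega i v (D i v).
Proof. by move=> [_ /(_ i)[g]]; exact: xgetI. Qed.

Lemma H1_L2 v : H1 v -> L2 v.
Proof. by case. Qed.

Lemma L2_weak_partial i v : H1 v -> L2 (D i v).
Proof. by move=> /(H1_weak_partial i)[]. Qed.

Lemma is_weak_partial_lin i a v w g g' : L2 v -> L2 w ->
  is_weak_partial Omega i v g -> is_weak_partial Omega i w g' ->
  is_weak_partial Omega i (a *: v + w) (a *: g + g').
Proof.
move=> Lv Lw [Lg gP] [Lg' gP']; split; first exact: L2_lin.
move=> phi tphi; have Lphi := L2_test tphi.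
have Ldphi := L2_test (test_function_partial i tphi).
have := inner_lin mOmega a Lv Lw Ldphi; rewrite {1}/inner /Defs.inner => ->.
have := inner_lin mOmega a Lg Lg' Lphi; rewrite {1}/inner /Defs.inner => ->.
by rewrite gP// gP'// opprD mulrN.
Qed.

Lemma H1_lin a v w : H1 v -> H1 w -> H1 (a *: v + w).
Proof.
move=> Hv Hw; have Lv := H1_L2 Hv; have Lw := H1_L2 Hw; split; first exact: L2_lin.
move=> i; exists (a *: D i v + D i w).
by apply: is_weak_partial_lin => //; exact: H1_weak_partial.
Qed.

(** [weak_partial] is a chosen representative, so its linearity is available only almost everywhere,
    through uniqueness of weak derivatives. *)
Lemma weak_partial_lin i a v w : H1 v -> H1 w ->
  {ae mu, forall x, Omega x -> D i (a *: v + w) x = (a *: D i v + D i w) x}.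
Proof.
move=> Hv Hw; apply: weak_partial_unique.
  exact: (H1_weak_partial i (H1_lin a Hv Hw)).
by apply: is_weak_partial_lin; try exact: H1_L2; exact: H1_weak_partial.
Qed.

Lemma is_weak_partial_test i phi : test phi ->
  is_weak_partial Omega i phi (partial i phi).
Proof.
move=> tphi; split; first exact: L2_test (test_function_partial i tphi).
by move=> psi tpsi; exact: integration_by_parts_test.
Qed.

Lemma H1_test phi : test phi -> H1 phi.
Proof.
move=> tphi; split; first exact: L2_test.
by move=> i; exists (partial i phi); exact: is_weak_partial_test.
Qed.

Lemma weak_partial_test i phi : test phi ->
  {ae mu, forall x, Omega x -> D i phi x = partial i phi x}.
Proof.
move=> tphi; apply: weak_partial_unique (is_weak_partial_test i tphi).
exact: H1_weak_partial (H1_test tphi).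
Qed.

Lemma grad_innerE v w : H1 v -> H1 w ->
  grad_inner v w = \sum_i inner (D i v) (D i w).
Proof.
move=> Hv Hw; rewrite /grad_inner /Defs.grad_inner.
rewrite /inner /Defs.inner /Rintegral.
under eq_integral do rewrite -sumEFin.
rewrite integral_sum//; last first.
  by move=> i; apply: L2_integrableM => //; exact: L2_weak_partial.
rewrite -sum_fine// => i _; apply: integrable_fin_num => //.
by apply: L2_integrableM => //; exact: L2_weak_partial.
Qed.

Lemma grad_innerC v w : grad_inner v w = grad_inner w v.
Proof.
by apply: eq_Rintegral => x _; apply: eq_bigr => i _; rewrite mulrC.
Qed.

Lemma grad_inner_lin a v w z : H1 v -> H1 w -> H1 z ->
  grad_inner (a *: v + w) z = a * grad_inner v z + grad_inner w z.
Proof.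
move=> Hv Hw Hz; have Hvw := H1_lin a Hv Hw.
rewrite !grad_innerE// mulr_sumr -big_split; apply: eq_bigr => i _ /=.
have Lv := L2_weak_partial i Hv; have Lw := L2_weak_partial i Hw.
have Lz := L2_weak_partial i Hz; rewrite -inner_lin//.
apply: ae_eq_inner => //; first exact: L2_weak_partial.
  exact: L2_lin.
exact: weak_partial_lin.
Qed.

Lemma grad_inner_sqr a v w : H1 v -> H1 w ->
  grad_inner (a *: v + w) (a *: v + w) =
  a ^+ 2 * grad_inner v v + 2 * a * grad_inner v w + grad_inner w w.
Proof.
move=> Hv Hw; have Hvw := H1_lin a Hv Hw.
rewrite (grad_inner_lin a Hv Hw Hvw) (grad_innerC v (_ + _)) (grad_innerC w (_ + _)).
rewrite (grad_inner_lin a Hv Hw Hv) (grad_inner_lin a Hv Hw Hw) (grad_innerC w v).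
by move: (grad_inner v v) (grad_inner v w) (grad_inner w w) => x y z; ring.
Qed.

Lemma gradnorm_sqr v : H1 v -> gradnorm v ^+ 2 = grad_inner v v.
Proof.
move=> Hv; rewrite /gradnorm /Defs.gradnorm sqr_sqrtr; last first.
  by apply: sumr_ge0 => i _; rewrite sqr_ge0.
rewrite grad_innerE//; apply: eq_bigr => i _; rewrite L2norm_sqr//.
exact: L2_weak_partial.
Qed.

Lemma gradnorm_ge0 v : 0 <= gradnorm v.
Proof. exact: sqrtr_ge0. Qed.

Lemma grad_inner_ge0 v : H1 v -> 0 <= grad_inner v v.
Proof. by move=> Hv; rewrite -gradnorm_sqr// sqr_ge0. Qed.

Lemma grad_inner_CS v w : H1 v -> H1 w ->
  `|grad_inner v w| <= gradnorm v * gradnorm w.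
Proof.
move=> Hv Hw; rewrite -(@ler_sqr _ _ (_ * _)) ?nnegrE ?mulr_ge0 ?gradnorm_ge0//.
rewrite real_normK ?num_real// exprMn (gradnorm_sqr Hv) (gradnorm_sqr Hw).
apply: discriminant_le; rewrite ?grad_inner_ge0// => t.
have Hvw := H1_lin t Hw Hv.
have := grad_inner_ge0 Hvw; rewrite (grad_inner_sqr t Hw Hv) (grad_innerC w v).
by move: (grad_inner v v) (grad_inner v w) (grad_inner w w) => x y z; congr (_ <= _); ring.
Qed.

Lemma H1norm_ge0 v : 0 <= H1norm v.
Proof. exact: sqrtr_ge0. Qed.

Lemma H1norm_sqr v : H1norm v ^+ 2 = L2norm v ^+ 2 + gradnorm v ^+ 2.
Proof. by rewrite sqr_sqrtr// addr_ge0// sqr_ge0. Qed.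

Lemma L2norm_H1norm v : L2norm v <= H1norm v.
Proof.
rewrite -ler_sqr ?nnegrE ?L2norm_ge0 ?H1norm_ge0// H1norm_sqr.
by rewrite lerDl sqr_ge0.
Qed.

Lemma gradnorm_H1norm v : gradnorm v <= H1norm v.
Proof.
rewrite -ler_sqr ?nnegrE ?gradnorm_ge0 ?H1norm_ge0// (H1norm_sqr v).
by rewrite lerDr sqr_ge0.
Qed.

Definition laplacian phi : 'rV[R]_n -> R := \sum_i partial i (partial i phi).

Lemma L2_sum (I : Type) (r : seq I) (F : I -> 'rV[R]_n -> R) :
  (forall j, L2 (F j)) -> L2 (\sum_(i <- r) F i).
Proof.
move=> LF; elim: r => [|i r IHr]; first by rewrite big_nil; exact: L2_0.
by rewrite big_cons; exact: L2D.
Qed.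

Lemma inner_sumr (I : Type) (r : seq I) (F : I -> 'rV[R]_n -> R) v :
  L2 v -> (forall j, L2 (F j)) -> inner v (\sum_(i <- r) F i) = \sum_(i <- r) inner v (F i).
Proof.
move=> Lv LF; elim: r => [|i r IHr].
  by rewrite !big_nil innerC inner0l.
have LS := L2_sum r LF.
by rewrite !big_cons -IHr (innerC _ v) (innerDl mOmega (LF i) LS Lv) (innerC _ v) (innerC _ v).
Qed.

Lemma L2_laplacian phi : test phi -> L2 (laplacian phi).
Proof.
by move=> tphi; apply: L2_sum => i; apply: L2_test; do 2 apply: test_function_partial.
Qed.

(** The right side makes sense for [v] merely in [L2] and is continuous there. This is what replaces
    the gradient of [u_t] at the times when [u_t] may fail to be in [H10]. *)
Lemma grad_inner_test v phi : H1 v -> test phi ->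
  grad_inner v phi = - inner v (laplacian phi).
Proof.
move=> Hv tphi; have Lv := H1_L2 Hv.
rewrite grad_innerE ?inner_sumr//; last 2 first.
- by move=> i; apply: L2_test; do 2 apply: test_function_partial.
- exact: H1_test.
rewrite -sumrN; apply: eq_bigr => i _.
have [LD DP] := H1_weak_partial i Hv.
have tdphi := test_function_partial i tphi.
have DPi : inner v (partial i (partial i phi)) = - inner (D i v) (partial i phi).
  exact: DP.
rewrite DPi opprK (innerC _ (D i v) (D i phi)) (innerC _ (D i v) (partial i phi)).
apply: ae_eq_inner => //; [|exact: L2_test|exact: weak_partial_test].
exact: (L2_weak_partial i (H1_test tphi)).
Qed.

#[local] Opaque Defs.H1norm Defs.gradnorm Defs.grad_inner Defs.L2norm Defs.inner.

Lemma H1norm_lin a v w : H1 v -> H1 w ->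
  H1norm (a *: v + w) <= `|a| * H1norm v + H1norm w.
Proof.
move=> Hv Hw; have Lv := H1_L2 Hv; have Lw := H1_L2 Hw.
have Lvw := L2_lin mOmega a Lv Lw; have Hvw := H1_lin a Hv Hw.
have N0 := H1norm_ge0.
have ev := etrans (H1norm_sqr v) (congr2 +%R (L2norm_sqr Lv) (gradnorm_sqr Hv)).
have ew := etrans (H1norm_sqr w) (congr2 +%R (L2norm_sqr Lw) (gradnorm_sqr Hw)).
(* [B] is the H1 inner product of [v] and [w]; its Cauchy-Schwarz inequality is obtained from the
   expansion [E]. *)
have [B BE] : {B : R | B = inner v w + grad_inner v w} := exist _ _ erefl.
have E (t : R) : H1norm (t *: v + w) ^+ 2 = t ^+ 2 * H1norm v ^+ 2 + 2 * t * B + H1norm w ^+ 2.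
  have Lt := L2_lin mOmega t Lv Lw; have Ht := H1_lin t Hv Hw.
  have e1 := etrans (L2norm_sqr Lt) (inner_sqr mOmega t Lv Lw).
  have e2 := etrans (gradnorm_sqr Ht) (grad_inner_sqr t Hv Hw).
  apply: (etrans (etrans (H1norm_sqr _) (congr2 +%R e1 e2))).
  move: ev ew; rewrite BE; move: (H1norm v) (H1norm w) => X Y.
  move: (grad_inner v v) (grad_inner v w) (grad_inner w w) => x y z.
  by move: (inner v v) (inner v w) (inner w w) => x' y' z' -> ->; ring.
have BN : B ^+ 2 <= H1norm w ^+ 2 * H1norm v ^+ 2.
  apply: discriminant_le; rewrite ?sqr_ge0// => t.
  have : 0 <= t ^+ 2 * H1norm v ^+ 2 + 2 * t * B + H1norm w ^+ 2.
    have sq (x y : R) : x ^+ 2 = y -> 0 <= y by move=> <-; exact: sqr_ge0.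
    exact: (sq _ _ (E t)).
  by move: (H1norm v) (H1norm w) => x y; congr (_ <= _); ring.
have {}BN : `|B| <= H1norm v * H1norm w.
  by rewrite mulrC; exact: normr_le_mul_sqr.
exact: (norm_lin_le (N0 v) (N0 w) (N0 _) erefl erefl BN (E a)).
Qed.

Lemma H1norm_dist v w : H1 v -> H1 w -> `|H1norm v - H1norm w| <= H1norm (v - w).
Proof.
move=> Hv Hw; have Hd := H1_lin (-1) Hw Hv; rewrite scaleN1r addrC in Hd.
have h1 := H1norm_lin 1 Hd Hw; rewrite scale1r subrK normr1 mul1r in h1.
have h2 := H1norm_lin (-1) Hd Hv.
rewrite scaleN1r opprB subrK normrN normr1 mul1r in h2.
exact: ler_dist_triangle h1 h2.
Qed.

Lemma H10_H1 v : H10 v -> H1 v.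
Proof. by case. Qed.

Lemma H10_lin a v w : H10 v -> H10 w -> H10 (a *: v + w).
Proof.
move=> [Hv [pv [tpv pvv]]] [Hw [pw [tpw pww]]]; split; first exact: H1_lin.
exists (fun k => a *: pv k + pw k); split.
  by move=> k; apply: test_functionD => //; exact: test_functionZ.
have Hd u p k : H1 u -> test (p k) -> H1 (p k - u).
  by move=> Hu tp; rewrite addrC -scaleN1r; apply: H1_lin => //; exact: H1_test.
have lim0 : (`|a| * H1norm (pv k - v) + H1norm (pw k - w)) @[k --> \oo] --> (0 : R).
  have c1 : (`|a| * H1norm (pv k - v)) @[k --> \oo] --> `|a| * 0.
    by apply: cvgM; [exact: cvg_cst|exact: pvv].
  by have := cvgD c1 pww; rewrite mulr0 addr0; exact.
apply: (squeeze_cvgr _ (cvg_cst (0:R)) lim0).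
apply: nearW => k; rewrite H1norm_ge0 /=.
have -> : a *: pv k + pw k - (a *: v + w) = a *: (pv k - v) + (pw k - w).
  by rewrite scalerBr opprD addrACA.
by apply: H1norm_lin; exact: Hd.
Qed.

Lemma H10_approx v (e : R) : H10 v -> 0 < e ->
  exists2 phi, test phi & H1norm (phi - v) < e.
Proof.
move=> [Hv [p [tp pv]]] e0.
have /cvgrPdist_lt/(_ e e0)[k _ /(_ k (leqnn k))] := pv.
by rewrite sub0r normrN ger0_norm ?H1norm_ge0//; exists (p k).
Qed.

End H1_theory.

(** * The Sobolev inequality *)

(** Where [k * V] exceeds the threshold [d], write it as its power 1 - r, which is at most that of
    [d], times its power r. The hypothesis bounds all of the latter except one factor [V], left over
    to be integrated. *)
Lemma sobolev_threshold (R : realType) (r M k V d : R) : 1 < r -> 0 < d ->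
  0 <= k -> 0 <= V -> k `^ r * V `^ (r - 1) <= M ->
  k * V <= d + d `^ (1 - r) * M * V.
Proof.
move=> r1 d0 k0 V0 kM.
have M0 : 0 <= M by apply: le_trans kM; rewrite mulr_ge0 ?powR_ge0.
have [kVd|dkV] := leP (k * V) d.
  by rewrite (le_trans kVd)// lerDl !mulr_ge0 ?powR_ge0.
have kV0 : 0 < k * V by exact: lt_trans dkV.
rewrite ler_wpDl ?(ltW d0)//.
have Vp : 0 < V by rewrite lt_neqAle V0 andbT eq_sym; apply: contraTneq kV0 => ->; rewrite mulr0 ltxx.
have -> : k * V = (k * V) `^ (1 - r) * (k * V) `^ r.
  by rewrite -powRD ?subrK ?powRr1 ?ltW// gt_eqF ?implybT.
apply: (@le_trans _ _ (d `^ (1 - r) * (k * V) `^ r)).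
  rewrite ler_wpM2r ?powR_ge0// -opprB !powRN lef_pV2 ?posrE ?powR_gt0//.
  by apply: ge0_ler_powR; rewrite ?nnegrE ?subr_ge0 ?ltW.
rewrite -mulrA ler_wpM2l ?powR_ge0//.
rewrite powRM// -(mulr_powRB1 V0); last lra.
by rewrite mulrCA [leRHS]mulrC ler_wpM2l.
Qed.

Lemma integral_indic01 (R : realType) (d : R) : 0 <= d ->
  (\int[lebesgue_measure]_s (\1_(`[0, 1]%classic) (s : R) * d)%:E = d%:E)%E.
Proof.
move=> d0; under eq_integral do rewrite EFinM.
rewrite ge0_integralZr//; last by apply/measurable_EFinP; exact: measurable_indic.
rewrite integral_indic// setIT [X in (X * _)%E](_ : _ = 1%E) ?mul1e//.
transitivity (lebesgue_measure (`[0, 1]%classic : set R)) => //.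
by rewrite lebesgue_measure_itv/= lte_fin ltr01 oppr0 adde0.
Qed.

Lemma integral_indicDZ (R : realType) (c d : R) (W : R -> \bar R) :
  0 <= d -> 0 <= c -> measurable_fun setT W -> (forall s, (0 <= W s)%E) ->
  (\int[lebesgue_measure]_s ((\1_(`[0, 1]%classic) s * d)%:E + c%:E * W s) =
   d%:E + c%:E * \int[lebesgue_measure]_s W s)%E.
Proof.
move=> d0 c0 mW W0; rewrite ge0_integralD//.
- by rewrite integral_indic01// ge0_integralZl_EFin.
- by move=> s _; rewrite lee_fin mulr_ge0.
- by apply/measurable_EFinP; apply: measurable_funM => //; exact: measurable_indic.
- by move=> s _; rewrite mule_ge0.
- exact: measurable_funeM.
Qed.

(** * From a pointwise bound along curves to an integral bound *)

Section riesz_bound.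
Context {R : realType} {n : nat}.
Local Notation mu := (lebesgue_rV n).
Local Notation lam := (@lebesgue_measure R).
Variables (r K N Yv : R) (m : nat) (Y : set 'rV[R]_n) (phi H : 'rV[R]_n -> R).
Hypotheses (r1 : 1 < r) (K0 : 0 <= K) (m2 : (2 <= m)%N) (mY : measurable Y)
  (Yv0 : 0 < Yv) (muY : mu Y = Yv%:E).
Hypotheses (mH : measurable_fun setT H) (H0 : forall x, 0 <= H x)
  (HN : (\int[mu]_x (H x)%:E = N%:E)%E) (mphi : measurable_fun setT phi).
Hypothesis rmn : m%:R * n%:R * (r - 1) <= (2 * m - 2)%:R * r.
Hypothesis phiH : forall x y, Y y -> ((phi x ^+ 2)%:E <=
  \int[lam]_(s in `[0%R, 1%R]) (K * s ^+ (2 * m - 2) * H (s ^+ m *: y + x))%:E)%E.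

Let T (p : R * 'rV[R]_n * 'rV[R]_n) : R :=
  \1_(`[0, 1]%classic) p.1.1 * \1_Y p.2 * H (p.1.1 ^+ m *: p.2 + p.1.2).

Let T0 p : 0 <= T p.
Proof. by rewrite !mulr_ge0. Qed.

Let mT : measurable_fun setT T.
Proof.
apply: measurable_funM; first apply: measurable_funM.
- apply: measurableT_comp; first exact: measurable_indic.
  exact: measurableT_comp.
- by apply: measurableT_comp => //; exact: measurable_indic.
- apply: measurableT_comp => //; apply: measurable_fun_rVP => i.
  under eq_fun do rewrite !mxE; apply: measurable_funD.
    apply: measurable_funM.
      by apply: measurable_funX; exact: measurableT_comp.
    exact: (measurableT_comp (measurable_rV_coord i) measurable_snd).
  exact: (measurableT_comp (measurable_rV_coord i)
    (measurableT_comp measurable_snd measurable_fst)).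
Qed.

Let V (p : R * 'rV[R]_n) : \bar R := (\int[mu]_y (T (p, y))%:E)%E.

Let V0 p : (0 <= V p)%E.
Proof. by apply: integral_ge0 => y _; rewrite lee_fin. Qed.

Let mV : measurable_fun setT V.
Proof.
apply: (@measurable_fun_fubini_tonelli_F _ _ _ _ R mu (EFin \o T)).
  exact/measurable_EFinP.
by move=> p /=; rewrite lee_fin.
Qed.

Let N0 : 0 <= N.
Proof. by rewrite -lee_fin -HN; apply: integral_ge0 => x _; rewrite lee_fin. Qed.

(** The map sending [y] to [s ^+ m *: y + x] has Jacobian s^(mn), and enlarging [Y] to the whole
    space leaves the full integral of [H]. *)
Let V_le s x : 0 < s -> (V (s, x) <= ((s ^+ m) ^- n * N)%:E)%E.
Proof.
move=> s0; have sm0 : 0 < s ^+ m by rewrite exprn_gt0.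
rewrite EFinM -HN -(ge0_integral_affine x sm0); last 2 first.
- exact/measurable_EFinP.
- by move=> y; rewrite lee_fin.
have maff := measurable_affine (s ^+ m) x.
apply: ge0_le_integral => //.
- by move=> y _; rewrite lee_fin.
- by apply/measurable_EFinP; apply: measurableT_comp => //; exact: pair1_measurable.
- apply/measurable_EFinP; exact: (measurableT_comp mH maff).
- by move=> y _; rewrite lee_fin /T /= ler_piMl// !indicE mulr_ile1// lern1 leq_b1.
Qed.

Let V_out s x : ~ (0 <= s <= 1) -> V (s, x) = 0%E.
Proof.
move=> s01; rewrite /V; under eq_integral => y _.
  rewrite /T /= indicE memNset ?mul0r; last by rewrite /= in_itv.
  over.
by rewrite integral0.
Qed.

Let M := (K / Yv) `^ r * N `^ (r - 1).

(** [M] is the threshold constant for k = K s^(2m - 2) / Yv: by [V_le], the power of [s] remaining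
    in k^r V^(r - 1) is (2m - 2) r - m n (r - 1), nonnegative by [rmn], so it is at most 1 for [s]
    in ]0, 1]. *)
Let kV_le s x d : 0 < d -> ((K * s ^+ (2 * m - 2) / Yv)%:E * V (s, x) <=
  (\1_(`[0, 1]%classic) s * d)%:E + (d `^ (1 - r) * M)%:E * V (s, x))%E.
Proof.
move=> d0; have M0 : 0 <= M by rewrite mulr_ge0 ?powR_ge0.
have [s01|/V_out ->] := pselect (0 <= s <= 1); last first.
  by rewrite !mule0 adde0 lee_fin mulr_ge0// ltW.
have /andP[s0 s1] := s01.
rewrite indicE mem_set ?mul1r; last by rewrite /= in_itv.
have k0 : 0 <= K * s ^+ (2 * m - 2) / Yv by rewrite divr_ge0 ?mulr_ge0 ?exprn_ge0// ltW.
have [->|s_neq0] := eqVneq s 0.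
  have mm : (0 < 2 * m - 2)%N by rewrite subn_gt0 -[ltnLHS]muln1 ltn_pmul2l.
  rewrite expr0n eqn0Ngt mm/=.
  by rewrite mulr0 mul0r mul0e adde_ge0 ?lee_fin ?(ltW d0)// mule_ge0// lee_fin mulr_ge0 ?powR_ge0.
have sp : 0 < s by rewrite lt_neqAle eq_sym s_neq0.
have VN := V_le x sp.
have Vfin : V (s, x) \is a fin_num by rewrite ge0_fin_numE// (le_lt_trans VN)// ltry.
move: VN (V0 (s, x)); rewrite -(fineK Vfin); move: (fine _) => v.
rewrite !lee_fin => vN v0.
apply: sobolev_threshold => //.
have -> : K * s ^+ (2 * m - 2) / Yv = (K / Yv) * s ^+ (2 * m - 2) by rewrite mulrAC.
rewrite powRM ?divr_ge0 ?exprn_ge0// ?(ltW Yv0)//.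
rewrite /M -mulrA ler_wpM2l ?powR_ge0//.
apply: (@le_trans _ _ ((s ^+ (2 * m - 2)) `^ r * ((s ^+ m) ^- n * N) `^ (r - 1))).
  rewrite ler_wpM2l ?powR_ge0// ge0_ler_powR ?nnegrE// ?subr_ge0 ?(ltW r1)//.
  by rewrite mulr_ge0// invr_ge0 !exprn_ge0.
rewrite powRM ?invr_ge0 ?exprn_ge0// mulrA ler_piMl ?powR_ge0//.
rewrite -exprM -(powR_invn _ (ltW sp)) -(powR_mulrn _ (ltW sp)) -!powRrM.
rewrite -powRD ?s_neq0 ?implybT//.
rewrite -[leRHS](powRr0 s); apply: ger_powR; first by rewrite sp.
by rewrite natrM mulNr subr_ge0.
Qed.

(** Averaging [phiH] over [Y] bounds phi(x)^2 by the integral of k V. The threshold d = phi(x)^2 / 2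
    is chosen so that the term [d] is absorbed by half of the left side; multiplying by d^(r - 1)
    then gives the power [r]. *)
Let phi_le x : (((phi x ^+ 2 / 2) `^ r)%:E <= M%:E * \int[lam]_s V (s, x))%E.
Proof.
have M0 : 0 <= M by rewrite mulr_ge0 ?powR_ge0.
pose d := phi x ^+ 2 / 2.
have [p0|p0] := eqVneq (phi x) 0.
  rewrite p0 expr0n/= mul0r powR0 ?gt_eqF// ?(lt_trans ltr01)//.
  by apply: mule_ge0; rewrite ?lee_fin//; exact: integral_ge0.
have d0 : 0 < d by rewrite divr_gt0// lt_neqAle eq_sym sqrf_eq0 p0 sqr_ge0.
have mVx : measurable_fun setT (fun s => V (s, x)).
  by apply: measurableT_comp => //; exact: pair2_measurable.
have step1 : ((phi x ^+ 2)%:E <= \int[lam]_s ((K * s ^+ (2 * m - 2) / Yv)%:E * V (s, x)))%E.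
  pose f (q : 'rV[R]_n * R) : \bar R :=
    (K * q.2 ^+ (2 * m - 2) / Yv * T ((q.2, x), q.1))%:E.
  have f0 q : (0 <= f q)%E.
    rewrite lee_fin /f; have [s01|s01] := pselect (0 <= q.2 <= 1).
      by rewrite mulr_ge0// divr_ge0 ?(ltW Yv0)// mulr_ge0// exprn_ge0//; case/andP: s01.
    by rewrite /T /= indicE memNset ?mul0r ?mulr0// in_itv.
  have mf : measurable_fun setT f.
    apply/measurable_EFinP; apply: measurable_funM.
      apply: measurable_funM => //; apply: measurable_funM => //.
      by apply: measurable_funX; exact: measurable_snd.
    apply: measurableT_comp => //; apply: measurable_fun_pair => //.
    by apply: measurable_fun_pair.
  have -> : (\int[lam]_s ((K * s ^+ (2 * m - 2) / Yv)%:E * V (s, x)) =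
      \int[lam]_s \int[mu]_y f (y, s))%E.
    apply: eq_integral => s _; have [s01|s01] := pselect (0 <= s <= 1).
      have k0 : 0 <= K * s ^+ (2 * m - 2) / Yv.
        by rewrite divr_ge0 ?(ltW Yv0)// mulr_ge0// exprn_ge0//; case/andP: s01.
      have mTs : measurable_fun setT (fun y => (T (s, x, y))%:E).
        by apply/measurable_EFinP; apply: measurableT_comp => //; exact: pair1_measurable.
      have Ts0 y : setT y -> (0 <= (T (s, x, y))%:E)%E by rewrite lee_fin.
      rewrite /V -(@ge0_integralZl_EFin _ _ R mu setT measurableT _ Ts0 mTs _ k0).
      by apply: eq_integral => y _; rewrite /f EFinM.
    rewrite V_out// mule0; under eq_integral => y _.
      rewrite /f /T /= indicE memNset ?mul0r ?mulr0; last by rewrite /= in_itv.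
      over.
    by rewrite integral0.
  rewrite [leRHS](_ : _ = \int[mu]_y \int[lam]_s f (y, s))%E; last first.
    exact: (esym (fubini_tonelli (m1 := mu) (m2 := lam) f mf f0)).
  have mF : measurable_fun setT (fun y => \int[lam]_s f (y, s))%E.
    exact: (measurable_fun_fubini_tonelli_F (m2 := lam) f mf f0).
  apply: (@le_trans _ _ (\int[mu]_(y in Y) \int[lam]_s f (y, s))%E); last first.
    by apply: ge0_subset_integral => // y _; exact: integral_ge0.
  apply: (@le_trans _ _ (\int[mu]_(y in Y) (phi x ^+ 2 / Yv)%:E)%E).
    have -> : (\int[mu]_(y in Y) (phi x ^+ 2 / Yv)%:E = (phi x ^+ 2 / Yv)%:E * Yv%:E)%E.
      by rewrite -muY; exact: integral_cst.
    by rewrite -EFinM divfK// gt_eqF.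
  apply: ge0_le_integral => //.
  - by move=> y _; rewrite lee_fin divr_ge0 ?sqr_ge0 ?ltW.
  - exact: measurable_funTS.
  move=> y Yy; have := phiH x Yy.
  have Yi0 : 0 <= Yv^-1 by rewrite invr_ge0 ltW.
  pose g (s : R) := (K * s ^+ (2 * m - 2) * H (s ^+ m *: y + x))%:E.
  have mg : measurable_fun (`[0, 1]%classic : set R) g.
    apply: measurable_funTS; apply/measurable_EFinP; apply: measurable_funM.
      by apply: measurable_funM => //; exact: measurable_funX.
    apply: measurableT_comp => //; apply: measurable_fun_rVP => i.
    under eq_fun do rewrite !mxE; apply: measurable_funD => //.
    by apply: measurable_funM => //; exact: measurable_funX.
  have g0 s : (`[0, 1]%classic : set R) s -> (0 <= g s)%E.
    rewrite /= in_itv/= => /andP[s0 _].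
    by rewrite lee_fin !mulr_ge0// exprn_ge0.
  have -> : (\int[lam]_s f (y, s) = (Yv^-1)%:E * \int[lam]_(s in `[0%R, 1%R]) g s)%E.
    rewrite -(@ge0_integralZl_EFin _ _ R lam _ _ _ g0 mg _ Yi0)// [RHS]integral_mkcond.
    apply: eq_integral => s _; rewrite patchE /f /T /= !indicE (mem_set Yy).
    case: ifPn => s01; last by rewrite !mul0r mulr0.
    by rewrite !mul1r /g -EFinM; congr EFin; rewrite mulrAC [RHS]mulrC.
  by move=> pg; rewrite mulrC EFinM; apply: lee_wpmul2l => //; rewrite lee_fin.
have step2 : ((phi x ^+ 2)%:E <= d%:E + (d `^ (1 - r) * M)%:E * \int[lam]_s V (s, x))%E.
  apply: (le_trans step1).
  have Mge0 : 0 <= d `^ (1 - r) * M by rewrite mulr_ge0 ?powR_ge0.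
  have m01 : measurable_fun setT (fun s : R => (\1_(`[0, 1]%classic) s * d)%:E).
    by apply/measurable_EFinP; apply: measurable_funM => //; exact: measurable_indic.
  rewrite -(integral_indicDZ (ltW d0) Mge0 mVx (fun s => V0 (s, x))).
  apply: ge0_le_integral => //.
  - move=> s _; have [s01|/V_out ->] := pselect (0 <= s <= 1); last by rewrite mule0.
    rewrite mule_ge0// lee_fin divr_ge0 ?(ltW Yv0)// mulr_ge0// exprn_ge0//.
    by case/andP: s01.
  - apply: emeasurable_funM => //; apply/measurable_EFinP.
    by apply: measurable_funM => //; apply: measurable_funM => //; exact: measurable_funX.
  - by apply: emeasurable_funD => //; exact: measurable_funeM.
  - by move=> s _; exact: kV_le.
have I0 : (0 <= \int[lam]_s V (s, x))%E by exact: integral_ge0.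
(* For an infinite integral the claim is trivial unless [M] is 0, and in that case [step2] would say
   phi(x)^2 <= phi(x)^2 / 2. *)
move: I0 step2; case: (\int[lam]_s V (s, x))%E => [I| |] //; last first.
  move=> _; have [->|M_neq0] := eqVneq M 0; last first.
    by move=> _; rewrite mulry gtr0_sg ?mul1e ?leey// lt_neqAle eq_sym M_neq0.
  by rewrite mulr0 mul0e adde0 lee_fin => h; exfalso; move: d0 h; rewrite /d; lra.
rewrite lee_fin => I0; rewrite -!EFinM -EFinD !lee_fin => h.
have {h} h : d <= d `^ (1 - r) * M * I by move: h; rewrite /d; lra.
rewrite -/d; have : d * d `^ (r - 1) <= d `^ (1 - r) * M * I * d `^ (r - 1).
  by rewrite ler_wpM2r// powR_ge0.
rewrite mulr_powRB1 ?(ltW d0)//; last by rewrite (lt_trans ltr01).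
have dd : d `^ (1 - r) * d `^ (r - 1) = 1.
  by rewrite -powRD; [rewrite subrKA subrr powRr0|rewrite (gt_eqF d0) implybT].
have -> : d `^ (1 - r) * M * I * d `^ (r - 1) = M * I.
  move: (d `^ (1 - r)) (d `^ (r - 1)) dd => u v uv.
  by transitivity (u * v * (M * I)); [ring|rewrite uv mul1r].
exact.
Qed.

(** After [phi_le], Tonelli's theorem lets [x] be integrated first: by translation invariance the
    integral of [H] is [N] for each [s] and [y], and the remaining integrations contribute at most
    the length 1 and the volume of [Y]. *)
Lemma riesz_bound : (\int[mu]_x ((phi x ^+ 2 / 2) `^ r)%:E <= (M * (Yv * N))%:E)%E.
Proof.
have M0 : 0 <= M by rewrite mulr_ge0 ?powR_ge0.
pose f (q : 'rV[R]_n * R) : \bar R := V (q.2, q.1).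
have mf : measurable_fun setT f.
  by apply: measurableT_comp => //; exact: measurable_fun_pair.
have f0 q : (0 <= f q)%E by exact: V0.
have mF : measurable_fun setT (fun x => \int[lam]_s f (x, s))%E.
  exact: (measurable_fun_fubini_tonelli_F (m2 := lam) f mf f0).
apply: (@le_trans _ _ (\int[mu]_x (M%:E * \int[lam]_s f (x, s)))%E).
  apply: ge0_le_integral => //.
  - by move=> x _; rewrite lee_fin powR_ge0.
  - apply/measurable_EFinP; apply: (measurableT_comp (measurable_powR r)).
    by apply: measurable_funM => //; exact: measurable_funX.
  - exact: measurable_funeM.
rewrite ge0_integralZl_EFin//; last by move=> x _; exact: integral_ge0.
rewrite (EFinM M); apply: lee_wpmul2l; first by rewrite lee_fin.
rewrite [leLHS](_ : _ = \int[lam]_s \int[mu]_x f (x, s))%E; last first.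
  exact: (fubini_tonelli (m1 := mu) (m2 := lam) f mf f0).

have -> : ((Yv * N)%:E = \int[lam]_s (\1_(`[0, 1]%classic) s * (Yv * N))%:E)%E.
  by rewrite integral_indic01// mulr_ge0// ltW.
apply: ge0_le_integral => //.
- by move=> s _; exact: integral_ge0.
- exact: (measurable_fun_fubini_tonelli_G (m1 := mu) f mf f0).
- by apply/measurable_EFinP; apply: measurable_funM => //; exact: measurable_indic.
move=> s _; have [s01|s01] := pselect (0 <= s <= 1); last first.
  rewrite /f; under eq_integral do rewrite V_out//.
  by rewrite integral0 lee_fin mulr_ge0// mulr_ge0// ltW.
rewrite indicE mem_set ?mul1r; last by rewrite /= in_itv.
pose h (q : 'rV[R]_n * 'rV[R]_n) : \bar R := (T ((s, q.1), q.2))%:E.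
have mh : measurable_fun setT h.
  apply/measurable_EFinP; apply: measurableT_comp => //.
  by apply: measurable_fun_pair => //; apply: measurable_fun_pair.
have h0 q : (0 <= h q)%E by rewrite lee_fin.
rewrite [leLHS](_ : _ = \int[mu]_x \int[mu]_y h (x, y))%E//.
rewrite [leLHS](_ : _ = \int[mu]_y \int[mu]_x h (x, y))%E; last first.
  exact: (fubini_tonelli (m1 := mu) (m2 := mu) h mh h0).
have -> : ((Yv * N)%:E = \int[mu]_y (\1_Y y * N)%:E)%E.
  under eq_integral do rewrite EFinM.
  rewrite ge0_integralZr//; last first.
  - by apply/measurable_EFinP; exact: measurable_indic.
  rewrite EFinM -muY; congr (_ * _)%E; apply/esym.
  by rewrite integral_indic// setIT.
apply: ge0_le_integral => //.
- by move=> y _; exact: integral_ge0.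
- exact: (measurable_fun_fubini_tonelli_G (m1 := mu) h mh h0).
- by apply/measurable_EFinP; apply: measurable_funM => //; exact: measurable_indic.
move=> y _; pose Hy (x : 'rV[R]_n) := (H (x + s ^+ m *: y))%:E.
have mHy : measurable_fun setT Hy.
  have -> : Hy = EFin \o (H \o (fun x => 1 *: x + s ^+ m *: y)).
    by apply/funext => x; rewrite /Hy /= scale1r.
  apply/measurable_EFinP; apply: measurableT_comp => //; exact: measurable_affine.
have Hy0 x : setT x -> (0 <= Hy x)%E by rewrite lee_fin.
have HyN : (\int[mu]_x Hy x = N%:E)%E.
  have mEH : measurable_fun setT (EFin \o H) by exact/measurable_EFinP.
  have EH0 x : (0 <= (EFin \o H) x)%E by rewrite lee_fin.
  have := ge0_integral_affine (s ^+ m *: y) ltr01 mEH EH0.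
  rewrite /= HN expr1n invr1 mul1e => <-.
  by apply: eq_integral => x _; rewrite /Hy scale1r.
have Y0 : 0 <= (\1_Y y : R) by [].
rewrite EFinM -HyN -(@ge0_integralZl_EFin _ _ R mu setT measurableT _ Hy0 mHy _ Y0).
apply: ge0_le_integral => //.
- exact: (measurableT_comp mh (pair2_measurable y)).
- exact: measurable_funeM.
- move=> x _; rewrite /h /Hy -EFinM lee_fin /T /= [x + _]addrC ler_wpM2r//.
  by rewrite ler_piMl// indicE lern1 leq_b1.
Qed.

End riesz_bound.

Lemma sum_CS (R : realType) (I : finType) (a b : I -> R) :
  (\sum_i a i * b i) ^+ 2 <= (\sum_i a i ^+ 2) * (\sum_i b i ^+ 2).
Proof.
apply: discriminant_le; try by apply: sumr_ge0 => i _; rewrite sqr_ge0.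
move=> t; rewrite !mulr_sumr -!big_split /=; apply: sumr_ge0 => i _.
have -> : a i ^+ 2 + 2 * t * (a i * b i) + t ^+ 2 * b i ^+ 2 = (a i + t * b i) ^+ 2 by ring.
exact: sqr_ge0.
Qed.

Lemma smooth_sum (R : realType) (n : nat) (I : Type) (s : seq I)
  (F : I -> 'rV[R]_n -> R) :
  (forall i, smooth (F i)) -> smooth (fun x => \sum_(i <- s) F i x).
Proof.
move=> sF; elim: s => [|i s IHs].
  by under eq_fun do rewrite big_nil; exact: smooth_cst.
by under eq_fun do rewrite big_cons; exact: smoothD.
Qed.

Section sobolev_test.
Context {R : realType} {n : nat}.
Local Notation mu := (lebesgue_rV n).
Local Notation lam := (@lebesgue_measure R).

Definition grad_sqr (phi : 'rV[R]_n -> R) (x : 'rV[R]_n) : R :=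
  \sum_i partial i phi x ^+ 2.

Lemma is_derive_power_line (f : 'rV[R]_n -> R) (x y : 'rV[R]_n) (m : nat) (s : R) :
  smooth f -> is_derive s 1 (fun t : R => f (t ^+ m *: y + x))
    ((\sum_i y ord0 i * partial i f (s ^+ m *: y + x)) * (m%:R * s ^+ m.-1)).
Proof.
move=> sf.
have dm : is_derive s 1 (fun t : R => t ^+ m) (m%:R * s ^+ m.-1).
  apply: DeriveDef; first exact: exprn_derivable.
  by rewrite exp_derive /GRing.scale /= mulr1 mulr_natl.
exact: (@is_derive1_comp R (fun t => f (t *: y + x)) (fun t => t ^+ m) s _ _ (is_derive_smooth_line x y (s ^+ m) sf) dm).
Qed.

Lemma continuous_power_line (f : 'rV[R]_n -> R) (x y : 'rV[R]_n) (m : nat) :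
  smooth f -> continuous (fun t : R => f (t ^+ m *: y + x)).
Proof.
move=> sf t; apply: differentiable_continuous; apply/derivable1_diffP.
by apply: ex_derive; exact: is_derive_power_line.
Qed.

(** Along the curve, [phi] goes from phi(x) at s = 0 to 0 at s = 1, and the chain rule produces the
    factor m s^(m - 1), whose square is the damping weight. *)
Lemma sqr_le_power_line (phi : 'rV[R]_n -> R) (x y : 'rV[R]_n) (m : nat) (c : R) :
  smooth phi -> phi (y + x) = 0 -> (forall i, `|y ord0 i| <= c) -> (0 < m)%N ->
  ((phi x ^+ 2)%:E <= \int[lam]_(s in `[0%R, 1%R])
     ((m%:R ^+ 2 * (n%:R * c ^+ 2)) * s ^+ (2 * m - 2) * grad_sqr phi (s ^+ m *: y + x))%:E)%E.
Proof.
move=> sphi phi0 yc m0; pose a := - phi x.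
pose Q z := \sum_i y ord0 i * partial i phi z.
have sQ : smooth Q.
  apply: smooth_sum => i; apply: (smoothM (smooth_cst _)); exact: smooth_partial.
have sG : smooth (grad_sqr phi).
  by apply: smooth_sum => i; apply: smoothX; exact: smooth_partial.
pose psi (s : R) := phi (s ^+ m *: y + x).
pose dpsi (s : R) := Q (s ^+ m *: y + x) * (m%:R * s ^+ m.-1).
have dpsiE (s : R) : is_derive s 1 psi (dpsi s) by exact: is_derive_power_line.
(* A substitute for the integral Cauchy-Schwarz inequality: with [a] the total increment of [psi],
   the integral of 2 a psi' - a^2 over [0, 1] is a^2 = phi(x)^2, while the integrand is at most
   psi'^2 because (psi' - a)^2 >= 0. *)
pose f (s : R) : R := 2 * a * dpsi s - a ^+ 2.
pose F (s : R) : R := 2 * a * psi s - a ^+ 2 * s.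
have dF (s : R) : is_derive s 1 F (f s).
  have d1 : is_derive s 1 (fun t => 2 * a * psi t) (2 * a * dpsi s).
    exact: (is_deriveZ (2 * a) (dpsiE s)).
  have d2 : is_derive s 1 (fun t => a ^+ 2 * t) (a ^+ 2).
    by have := is_deriveZ (a ^+ 2) (is_derive_id s (1:R)); rewrite /GRing.scale /= mulr1.
  exact: (is_deriveB d1 d2).
have cX (k : nat) : continuous (fun s : R => s ^+ k).
  by move=> s; exact: exprn_continuous.
have cf : continuous f.
  move=> s; apply: cvgB; last exact: cvg_cst.
  apply: cvgM; first exact: cvg_cst.
  apply: cvgM; first exact: continuous_power_line.
  by apply: cvgM; [exact: cvg_cst|exact: cX].
pose g (s : R) := m%:R ^+ 2 * (n%:R * c ^+ 2) * s ^+ (2 * m - 2) * grad_sqr phi (s ^+ m *: y + x).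
have cg : continuous g.
  move=> s; apply: cvgM; last exact: continuous_power_line.
  by apply: cvgM; [exact: cvg_cst|exact: cX].
have cF : continuous F.
  move=> s; apply: differentiable_continuous; apply/derivable1_diffP.
  by apply: ex_derive; exact: dF.
have FE : F 1 - F 0 = phi x ^+ 2.
  rewrite /F /psi expr1n expr0n gtn_eqF//= scale1r scale0r phi0 add0r.
  by rewrite /a; ring.
have -> : (phi x ^+ 2)%:E = (\int[lam]_(s in `[0%R, 1%R]) (f s)%:E)%E.
  rewrite -FE EFinB; apply/esym; apply: continuous_FTC2 => //.
  - exact: continuous_subspaceT.
  - split; [by move=> s _; apply: ex_derive; exact: dF| |].
      exact: (cvg_at_right_filter (cF 0)).
    exact: (cvg_at_left_filter (cF 1)).
  - by move=> s _; rewrite derive1E; have dFs := dF s; exact: derive_val.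
apply: le_integral => //.
- by apply: continuous_compact_integrable; [exact: segment_compact|exact: continuous_subspaceT].
- by apply: continuous_compact_integrable; [exact: segment_compact|exact: continuous_subspaceT].
move=> s _; rewrite lee_fin.
have fd : f s <= dpsi s ^+ 2.
  by rewrite -subr_ge0 /f (_ : _ - _ = (dpsi s - a) ^+ 2) ?sqr_ge0//; ring.
apply: (le_trans fd); rewrite /dpsi exprMn.
have Q2 : Q (s ^+ m *: y + x) ^+ 2 <= n%:R * c ^+ 2 * grad_sqr phi (s ^+ m *: y + x).
  apply: le_trans (sum_CS _ _) _; apply: ler_wpM2r.
    by apply: sumr_ge0 => i _; rewrite sqr_ge0.
  apply: (@le_trans _ _ (\sum_(i < n) c ^+ 2)); last first.
    by rewrite sumr_const card_ord mulr_natl.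
  apply: ler_sum => i _; rewrite -(real_normK (num_real (y ord0 i))).
  by rewrite lerXn2r// nnegrE (le_trans _ (yc i)).
apply: (le_trans (ler_wpM2r (sqr_ge0 _) Q2)).
rewrite /g exprMn -exprM.
have -> : (m.-1 * 2 = 2 * m - 2)%N by rewrite mulnC -subn1 mulnBr muln1.
by rewrite le_eqVlt; apply/orP; left; apply/eqP; ring.
Qed.

Variable Omega : set 'rV[R]_n.
Hypotheses (oOmega : open Omega) (bOmega : bounded_set Omega).

(** Links the classical gradient, integrated over the whole space as in [riesz_bound], with
    [gradnorm], which is built from weak derivatives on [Omega]. *)
Lemma integral_grad_sqr phi : test_function Omega phi ->
  (\int[mu]_x (grad_sqr phi x)%:E = (gradnorm Omega phi ^+ 2)%:E)%E.
Proof.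
move=> tphi; have mO := open_measurable_rV oOmega.
have Hphi := H1_test oOmega bOmega tphi.
have E : gradnorm Omega phi ^+ 2 =
    \sum_i inner Omega (partial i phi) (partial i phi).
  rewrite (gradnorm_sqr oOmega Hphi) (grad_innerE oOmega Hphi Hphi).
  apply: eq_bigr => i _.
  have LD := L2_weak_partial i Hphi.
  have Lp : L2 Omega (partial i phi) by apply: L2_test => //; exact: test_function_partial.
  have ae := weak_partial_test oOmega bOmega i tphi.
  rewrite (ae_eq_inner mO LD Lp LD ae) innerC.
  exact: (ae_eq_inner mO LD Lp Lp ae).
have ti i : test_function Omega (partial i phi \* partial i phi).
  apply: test_functionM; first exact: test_function_partial.
  by have [] := test_function_partial i tphi.
have sp i : smooth (partial i phi) by have [] := test_function_partial i tphi.
rewrite E -sumEFin.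
under eq_integral do rewrite /grad_sqr -sumEFin.
rewrite ge0_integral_sum//.
- apply: eq_bigr => i _.
  rewrite /inner Rintegral_off; last first.
    by move=> x Ox; rewrite (test_function_out (test_function_partial i tphi) Ox) mulr0.
  rewrite fineK//; exact: integrable_fin_num (test_function_integrable (ti i)).
- move=> i; apply/measurable_EFinP; apply: continuous_measurable_rV.
  by apply: smooth_continuous; apply: smoothX.
- by move=> i x _; rewrite lee_fin sqr_ge0.
Qed.

Lemma sqr_powR (g r : R) : 0 <= g -> g `^ (2 * r) = (g ^+ 2) `^ r.
Proof. by move=> g0; rewrite powRrM powR_mulrn. Qed.

Lemma sobolev_test r : (0 < n)%N -> 1 < r -> n%:R * (r - 1) < 2 * r ->
  exists2 C : R, 0 <= C & forall phi, test_function Omega phi ->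
    (\int[mu]_(x in Omega) (`|phi x| `^ (2 * r))%:E <=
     (C * gradnorm Omega phi `^ (2 * r))%:E)%E.
Proof.
move=> n0 r1 nr; have mO := open_measurable_rV oOmega.
have [D D0 OD] := bounded_subset_box bOmega.
pose de : R := 2 * r - n%:R * (r - 1).
have de0 : 0 < de by rewrite subr_gt0.
(* The condition [rmn] amounts to m de >= 2 r, where [de] is the positive subcriticality gap; adding
   2 to the truncation also secures m >= 2. *)
pose m := (Num.truncn (2 * r / de)).+2.
(* Coordinates of points of [Omega] lie in ]-D, D[, so adding one from ]2D, 4D[ leads outside
   [Omega]. The bound 4D on the coordinates enters [K], the side 2D the volume of [Y]. *)
pose Y : set 'rV[R]_n := box (const_mx (2 * D)) (const_mx (4 * D)).
have mY : measurable Y := measurable_box _ _.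
have muY : mu Y = ((2 * D) ^+ n)%:E.
  rewrite lebesgue_rV_boxE => [|i]; last by rewrite !mxE; lra.
  congr EFin; under eq_bigr do rewrite !mxE.
  by rewrite prodr_const card_ord; congr (_ ^+ _); lra.
have Yv0 : 0 < (2 * D) ^+ n by rewrite exprn_gt0// mulr_gt0.
pose K : R := m%:R ^+ 2 * (n%:R * (4 * D) ^+ 2).
have K0 : 0 <= K by rewrite mulr_ge0 ?sqr_ge0// mulr_ge0 ?sqr_ge0.
exists (2 `^ r * ((K / (2 * D) ^+ n) `^ r * (2 * D) ^+ n)).
  by rewrite !mulr_ge0 ?powR_ge0// ltW.
move=> phi tphi; have [sphi _ _] := tphi.
have sG : smooth (grad_sqr phi).
  by apply: smooth_sum => i; apply: smoothX; exact: smooth_partial.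
have mG : measurable_fun setT (grad_sqr phi).
  by apply: continuous_measurable_rV; exact: smooth_continuous.
have G0 x : 0 <= grad_sqr phi x by apply: sumr_ge0 => i _; rewrite sqr_ge0.
have mphi : measurable_fun setT phi.
  by apply: continuous_measurable_rV; exact: smooth_continuous.
have rmn : m%:R * n%:R * (r - 1) <= (2 * m - 2)%:R * r.
  rewrite natrB ?muln_gt0// natrM mulrBl -subr_ge0.
  have -> : 2%:R * m%:R * r - 2%:R * r - m%:R * n%:R * (r - 1) = m%:R * de - 2 * r.
    by rewrite /de; ring.
  rewrite subr_ge0 -ler_pdivrMr//.
  have r0 : 0 <= 2 * r / de by rewrite divr_ge0 ?ltW// mulr_gt0// (lt_trans ltr01).
  have := truncn_lt_nat (Num.truncn (2 * r / de)).+2 r0.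
  by rewrite /m ltnS leqnSn => /esym/ltW.
have pw x y : Y y -> ((phi x ^+ 2)%:E <= \int[lam]_(s in `[0%R, 1%R])
    (K * s ^+ (2 * m - 2) * grad_sqr phi (s ^+ m *: y + x))%:E)%E.
  move=> Yy; have [phix0|phix0] := eqVneq (phi x) 0.
    rewrite phix0 expr0n/=; apply: integral_ge0 => s /=; rewrite in_itv/= => /andP[s0 _].
    by rewrite lee_fin mulr_ge0// mulr_ge0// exprn_ge0.
  apply: sqr_le_power_line => //.
    apply: (test_function_out tphi) => /OD /(_ (Ordinal n0)).
    have := Yy (Ordinal n0).
    have /OD/(_ (Ordinal n0)) : Omega x.
      by apply: contrapT => /(test_function_out tphi) /eqP; exact/negP.
    rewrite !mxE => /andP[? _] /andP[? _] /andP[_ ?]; lra.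
  move=> i; have := Yy i; rewrite !mxE => /andP[? ?].
  by rewrite ger0_norm; lra.
have key := riesz_bound r1 K0 (isT : (2 <= m)%N) mY Yv0 muY mG G0 (integral_grad_sqr tphi) mphi rmn pw.
have rm := lt_trans ltr01 r1.
apply: (@le_trans _ _ ((2 `^ r)%:E * \int[mu]_x ((phi x ^+ 2 / 2) `^ r)%:E)%E).
  have mF : measurable_fun setT (fun x => ((phi x ^+ 2 / 2) `^ r)%:E).
    apply/measurable_EFinP; apply: (measurableT_comp (measurable_powR r)).
    by apply: measurable_funM => //; exact: measurable_funX.
  rewrite -ge0_integralZl_EFin ?powR_ge0//; last by move=> x _; rewrite lee_fin powR_ge0.
  have FE x : (`|phi x| `^ (2 * r))%:E = ((2 `^ r)%:E * ((phi x ^+ 2 / 2) `^ r)%:E)%E.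
    rewrite sqr_powR ?normr_ge0// real_normK ?num_real//.
    by rewrite -EFinM -powRM ?divr_ge0 ?sqr_ge0//; congr ((_ `^ _)%:E); field.
  under [leLHS]eq_integral do rewrite FE.
  apply: ge0_subset_integral => //.
    exact: measurable_funeM.
  by move=> x _; rewrite -EFinM lee_fin mulr_ge0 ?powR_ge0.
apply: le_trans (lee_wpmul2l _ key) _; first by rewrite lee_fin powR_ge0.
rewrite -EFinM lee_fin sqr_powR ?gradnorm_ge0//.
rewrite -(mulr_powRB1 (sqr_ge0 _) rm).
move: (gradnorm Omega phi ^+ 2) => G; move: (G `^ _) => GG.
by rewrite le_eqVlt; apply/orP; left; apply/eqP; ring.
Qed.

End sobolev_test.

(** Convexity: the graph of the power lies above its tangent at [w]. It is derived from Young's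
    inequality for [a] and the power p - 1 of [w]. *)
Lemma powR_tangent (R : realType) (p a w : R) : 1 < p -> 0 <= a -> 0 <= w ->
  w `^ p <= a `^ p + p * w `^ (p - 1) * (w - a).
Proof.
move=> p1 a0 w0; have p0 := lt_trans ltr01 p1.
have p10 : 0 < p - 1 by rewrite subr_gt0.
have pq : p^-1 + (p / (p - 1))^-1 = 1 by field; rewrite !gt_eqF.
have := conjugate_powR a0 (powR_ge0 w (p - 1)) p0 (divr_gt0 p0 p10) pq.
rewrite -powRrM [_ * (p / _)]mulrC divfK ?gt_eqF//.
have <- := mulr_powRB1 w0 p0.
move: (a `^ p) (w `^ (p - 1)) => A B.
rewrite -(ler_pM2l p0) => h; rewrite -subr_ge0.
move: h; rewrite -subr_ge0; congr (_ <= _); field.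
by rewrite !gt_eqF.
Qed.

Lemma ler_onePpowR (R : realType) (p t : R) : 1 <= p -> 0 <= t -> t <= 1 + t `^ p.
Proof.
move=> p1 t0; have [t1|/ltW t1] := leP t 1; first by rewrite (le_trans t1)// lerDl powR_ge0.
by rewrite (@le_trans _ _ (t `^ p)) ?lerDr// -{1}[t]powRr1// ler_powR.
Qed.

Lemma powR_mul_le (R : realType) (p s t : R) : 1 < p -> 0 <= s -> 0 <= t ->
  s `^ (p - 1) * t <= s `^ p + t `^ p.
Proof.
move=> p1 s0 t0; have p0 := lt_trans ltr01 p1.
have [st|/ltW ts] := leP s t.
  apply: (@le_trans _ _ (t `^ p)); last by rewrite lerDr powR_ge0.
  rewrite -(mulr_powRB1 t0 p0) mulrC ler_wpM2l//; apply: ge0_ler_powR => //.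
  by rewrite subr_ge0 ltW.
apply: (@le_trans _ _ (s `^ p)); last by rewrite lerDl powR_ge0.
by rewrite -(mulr_powRB1 s0 p0) mulrC ler_wpM2r// powR_ge0.
Qed.

(** * Extension to [H10], the Poincare inequality and the nonlinear functional *)

Section sobolev_H10.
Context {R : realType} {n : nat}.
Variable Omega : set 'rV[R]_n.
Hypotheses (oOmega : open Omega) (bOmega : bounded_set Omega).
Implicit Types (v w phi : 'rV[R]_n -> R).
Local Notation mu := (lebesgue_rV n).
Local Notation H1 := (H1 Omega).
Local Notation H10 := (H10 Omega).
Local Notation inner := (inner Omega).
Local Notation grad_inner := (grad_inner Omega).
Local Notation L2norm := (L2norm Omega).
Local Notation gradnorm := (gradnorm Omega).
Local Notation H1norm := (H1norm Omega).
Lemma inner_fineE v w :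
  inner v w = fine (\int[mu]_(x in Omega) (v x * w x)%:E)%E.
Proof. by []. Qed.

#[local] Opaque Defs.H1norm Defs.gradnorm Defs.grad_inner Defs.L2norm Defs.inner.
Let mOmega := open_measurable_rV oOmega.

Lemma gradnorm_lin (a : R) v w : H1 v -> H1 w ->
  gradnorm (a *: v + w) <= `|a| * gradnorm v + gradnorm w.
Proof.
move=> Hv Hw; have Hvw := H1_lin oOmega bOmega a Hv Hw.
have N0 := gradnorm_ge0 Omega.
exact: (norm_lin_le (N0 v) (N0 w) (N0 _) (gradnorm_sqr oOmega Hv)
  (gradnorm_sqr oOmega Hw) (grad_inner_CS oOmega bOmega Hv Hw)
  (etrans (gradnorm_sqr oOmega Hvw) (grad_inner_sqr oOmega bOmega a Hv Hw))).
Qed.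

Lemma gradnorm_dist v w : H1 v -> H1 w ->
  `|gradnorm v - gradnorm w| <= gradnorm (v - w).
Proof.
move=> Hv Hw; have Hd := H1_lin oOmega bOmega (-1) Hw Hv.
rewrite scaleN1r addrC in Hd.
have h1 := gradnorm_lin 1 Hd Hw; rewrite scale1r subrK normr1 mul1r in h1.
have h2 := gradnorm_lin (-1) Hd Hv.
rewrite scaleN1r opprB subrK normrN normr1 mul1r in h2.
exact: ler_dist_triangle h1 h2.
Qed.

Variables (p C : R).
Hypotheses (p1 : 1 < p) (C0 : 0 <= C).
Hypothesis sob : forall phi, test_function Omega phi ->
  (\int[mu]_(x in Omega) (`|phi x| `^ p)%:E <= (C * gradnorm phi `^ p)%:E)%E.

(** Approximation by test functions controls only the L2 distance, whereas [v] is not yet known to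
    have a finite p-th moment. After truncation at [N] the tangent inequality makes the error at
    most p N^(p - 1) times |phi - v|, whose integral is small. *)
Lemma sobolev_trunc v (N e : R) : H10 v -> 0 <= N -> gradnorm v < e ->
  (\int[mu]_(x in Omega) (Num.min `|v x| N `^ p)%:E <= (C * e `^ p)%:E)%E.
Proof.
move=> Hv N0 ve; have p0 := lt_trans ltr01 p1.
have H1v := H10_H1 Hv; have Lv := H1_L2 H1v.
have [mv _] := (L2P mOmega v).1 Lv.
pose c := p * N `^ (p - 1); have c0 : 0 <= c by rewrite mulr_ge0 ?powR_ge0 ?ltW.
have mn (g : 'rV[R]_n -> R) : measurable_fun Omega g -> measurable_fun Omega (fun x => `|g x|).
  by move=> mg; exact: (measurableT_comp _ mg).
have mp (g : 'rV[R]_n -> R) : measurable_fun Omega g -> measurable_fun Omega (fun x => g x `^ p).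
  by move=> mg; exact: (measurableT_comp (measurable_powR p) mg).
have L1 := L2_cst1 oOmega bOmega.
pose c1 := c * L2norm (fun=> 1).
have c10 : 0 <= c1 by rewrite mulr_ge0// L2norm_ge0.
apply/lee_addgt0Pr => d d0.
(* The first bound keeps [gradnorm phi] below [e]; the second keeps the truncation error below
   [d]. *)
pose e1 := Num.min (e - gradnorm v) (d / (c1 + 1)).
have e10 : 0 < e1 by rewrite lt_min subr_gt0 ve divr_gt0// ltr_wpDl.
have [phi tphi phiv] := H10_approx Hv e10.
have H1phi := H1_test oOmega bOmega tphi.
have Lphi := H1_L2 H1phi.
have Lw : L2 Omega (phi - v) := L2B mOmega Lphi Lv.
have [mw _] := (L2P mOmega _).1 Lw.
have [mphi _] := (L2P mOmega _).1 Lphi.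
have gphi : gradnorm phi <= e.
  have -> : phi = 1 *: (phi - v) + v by rewrite scale1r subrK.
  have H1w : H1 (phi - v).
    rewrite addrC -scaleN1r; exact: H1_lin.
  apply: le_trans (gradnorm_lin 1 H1w H1v) _; rewrite normr1 mul1r -lerBrDr.
  apply: le_trans (gradnorm_H1norm _ _) _.
  by apply: le_trans (ltW phiv) _; rewrite ge_min lexx.
have iw : (\int[mu]_(x in Omega) (`|(phi - v) x|)%:E <= (L2norm (fun=> 1) * e1)%:E)%E.
  have La : L2 Omega (fun x => `|(phi - v) x|).
    apply/(L2P mOmega); split; first exact: mn.
    under eq_integral do rewrite real_normK ?num_real//.
    by have [] := (L2P mOmega _).1 Lw.
  have iLa := L2_integrable oOmega bOmega La.
  have -> : (\int[mu]_(x in Omega) (`|(phi - v) x|)%:E)%E = (inner (fun=> 1) (fun x => `|(phi - v) x|))%:E.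
    rewrite inner_fineE fineK; last first.
      under eq_integral do rewrite mul1r; exact: integrable_fin_num iLa.
    by apply: eq_integral => x _; rewrite mul1r.
  rewrite lee_fin (le_trans (ler_norm _))// (le_trans (inner_CS mOmega L1 La))//.
  rewrite ler_wpM2l ?L2norm_ge0// (le_trans _ (ltW phiv))//.
  apply: le_trans (L2norm_H1norm _ _); rewrite (L2normE La) (L2normE Lw).
  suff -> : inner (fun x => `|(phi - v) x|) (fun x => `|(phi - v) x|) = inner (phi - v) (phi - v) by [].
  by rewrite !inner_fineE; congr fine; apply: eq_integral => x _; rewrite -normrM ger0_norm// sqr_ge0.
apply: (@le_trans _ _ (\int[mu]_(x in Omega) ((`|phi x| `^ p)%:E + c%:E * (`|(phi - v) x|)%:E))%E).
  apply: ge0_le_integral => //.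
  - by move=> x _; rewrite lee_fin powR_ge0.
  - apply/measurable_EFinP; apply: mp; apply: measurable_minr => //; exact: mn.
  - apply: emeasurable_funD; first by apply/measurable_EFinP; apply: mp; exact: mn.
    by apply: measurable_funeM; apply/measurable_EFinP; exact: mn.
  - move=> x _; rewrite -EFinM -EFinD lee_fin.
    set w := Num.min _ _.
    have w0 : 0 <= w by rewrite le_min normr_ge0.
    apply: (le_trans (powR_tangent p1 (normr_ge0 (phi x)) w0)); rewrite lerD2l.
    have wv : w - `|phi x| <= `|(phi - v) x|.
      have : w <= `|v x| by rewrite ge_min lexx.
      have := ler_distD 0 (v x) (phi x); rewrite distrC.
      have := lerB_dist (v x) (phi x).
      rewrite distrC -[phi x - v x]/((phi - v) x); lra.
    apply: (@le_trans _ _ (p * w `^ (p - 1) * `|(phi - v) x|)).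
      by rewrite ler_wpM2l// mulr_ge0 ?powR_ge0 ?ltW.
    rewrite ler_wpM2r// ler_wpM2l ?(ltW p0)//; apply: ge0_ler_powR.
    + by rewrite subr_ge0 ltW.
    + by rewrite nnegrE.
    + by rewrite nnegrE.
    + by rewrite ge_min lexx orbT.
rewrite ge0_integralD//.
- rewrite ge0_integralZl_EFin//; last by apply/measurable_EFinP; exact: mn.
  apply: le_trans (leeD (sob tphi) (lee_wpmul2l _ iw)) _; first by rewrite lee_fin.
  rewrite -EFinM -!EFinD lee_fin lerD//.
    rewrite ler_wpM2l//; apply: ge0_ler_powR; rewrite ?nnegrE ?(ltW p0) ?gradnorm_ge0//.
    by rewrite (le_trans _ (ltW ve))// gradnorm_ge0.
  rewrite mulrA -/c1.
  have : c1 * e1 <= (c1 + 1) * (d / (c1 + 1)).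
    apply: ler_pM => //; first exact: ltW.
      by rewrite lerDl.
    by rewrite ge_min lexx orbT.
  by rewrite [(c1 + 1) * _]mulrC divfK// gt_eqF// ltr_wpDl.
- by apply/measurable_EFinP; apply: mp; exact: mn.
- by move=> x _; rewrite -EFinM lee_fin mulr_ge0.
- by apply: measurable_funeM; apply/measurable_EFinP; exact: mn.
Qed.

(** The truncation level tends to infinity by monotone convergence. Dividing by some [e] strictly
    above the gradient norm keeps the normalised form meaningful when that norm is 0. *)
Lemma sobolev_H10 v (e : R) : H10 v -> gradnorm v < e ->
  (\int[mu]_(x in Omega) ((`|v x| / e) `^ p)%:E <= C%:E)%E.
Proof.
move=> Hv ve; have p0 := lt_trans ltr01 p1.
have e0 : 0 < e by rewrite (le_lt_trans _ ve)// gradnorm_ge0.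
have [mv _] := (L2P mOmega v).1 (H1_L2 (H10_H1 Hv)).
have mn : measurable_fun Omega (fun x => `|v x|) by exact: (measurableT_comp _ mv).
have mp (g : 'rV[R]_n -> R) : measurable_fun Omega g -> measurable_fun Omega (fun x => g x `^ p).
  by move=> mg; exact: (measurableT_comp (measurable_powR p) mg).
pose g k x := (Num.min `|v x| k%:R `^ p)%:E.
have mg k : measurable_fun Omega (g k).
  by apply/measurable_EFinP; apply: mp; apply: measurable_minr.
have g0 k x : Omega x -> (0 <= g k x)%E by move=> _; rewrite lee_fin powR_ge0.
have ndg x : Omega x -> {homo g^~ x : k m / (k <= m)%N >-> (k <= m)%E}.
  move=> _ k m km; rewrite lee_fin; apply: ge0_ler_powR; rewrite ?nnegrE ?(ltW p0)//.
  by rewrite le_min !ge_min lexx ler_nat km orbT.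
have limg x : limn (g^~ x) = (`|v x| `^ p)%:E.
  apply: cvg_lim => //; apply: (@cvg_near_cst _ _ _ _ _ eventually_filter).
  exists (Num.truncn `|v x|).+1 => // k /= kx; rewrite /g; congr ((_ `^ _)%:E).
  apply/min_idPl; apply: le_trans (_ : (Num.truncn `|v x|).+1%:R <= _); last by rewrite ler_nat.
  have := truncn_lt_nat (Num.truncn `|v x|).+1 (normr_ge0 (v x)).
  by rewrite leqnn => /esym/ltW.
have key : (\int[mu]_(x in Omega) (`|v x| `^ p)%:E <= (C * e `^ p)%:E)%E.
  have := monotone_convergence mu mOmega mg g0 ndg.
  under eq_integral do rewrite limg.
  move=> ->; apply: lime_le.
    by apply/cvg_ex; eexists; exact: (cvg_monotone_convergence mOmega mg g0 ndg).
  apply: nearW => k; exact: sobolev_trunc.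
have ep0 : 0 < e `^ p by rewrite powR_gt0.
have E x : ((`|v x| / e) `^ p)%:E = ((e `^ p)^-1%:E * (`|v x| `^ p)%:E)%E.
  rewrite -EFinM powRM ?invr_ge0 ?(ltW e0)// mulrC; congr (_ * _)%:E.
  by rewrite -powR_inv1 ?ltW// -powRrM mulN1r powRN.
under eq_integral do rewrite E.
rewrite ge0_integralZl_EFin ?invr_ge0 ?powR_ge0//.
- apply: le_trans (lee_wpmul2l _ key) _; first by rewrite lee_fin invr_ge0 powR_ge0.
  by rewrite -EFinM mulrCA mulVf ?gt_eqF// mulr1.
- by apply/measurable_EFinP; exact: mp.
Qed.

Let Vol := fine (mu Omega).

Let muE : mu Omega = Vol%:E.
Proof.
rewrite /Vol fineK// ge0_fin_numE ?measure_ge0//; exact: bounded_lebesgue_rV_fin.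
Qed.

Let int1 : (\int[mu]_(_ in Omega) 1 = Vol%:E)%E.
Proof.
by apply: etrans muE; rewrite -[RHS]mul1e; exact: integral_cst.
Qed.

Let Vol0 : 0 <= Vol.
Proof. by rewrite fine_ge0 ?measure_ge0. Qed.

Let mpow v (e : R) : H10 v -> measurable_fun Omega (fun x => (`|v x| / e) `^ p).
Proof.
move=> Hv; have [mv _] := (L2P mOmega v).1 (H1_L2 (H10_H1 Hv)).
apply: (measurableT_comp (measurable_powR p)); apply: measurable_funM => //.
exact: (measurableT_comp _ mv).
Qed.

Lemma sobolev_H10_1 v (e : R) : H10 v -> gradnorm v < e ->
  (\int[mu]_(x in Omega) (1 + (`|v x| / e) `^ p)%:E <= (Vol + C)%:E)%E.
Proof.
move=> Hv ve; under eq_integral do rewrite EFinD.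
rewrite ge0_integralD//.
- rewrite int1 EFinD leeD2l//; exact: sobolev_H10.
- by move=> x _; rewrite lee_fin powR_ge0.
- by apply/measurable_EFinP; exact: mpow.
Qed.

(** After division by [e] one has t^2 <= 1 + t^p, integrated over the bounded set [Omega]; then [e]
    decreases to the gradient norm. *)
Lemma poincare v : H10 v -> 2 <= p -> L2norm v ^+ 2 <= (Vol + C) * gradnorm v ^+ 2.
Proof.
move=> Hv p2; have Lv := H1_L2 (H10_H1 Hv).
have [mv _] := (L2P mOmega v).1 Lv.
rewrite (L2norm_sqr Lv).
have key e : gradnorm v < e -> inner v v <= (Vol + C) * e ^+ 2.
  move=> ve; have e0 : 0 < e by rewrite (le_lt_trans _ ve)// gradnorm_ge0.
  have le1 : (\int[mu]_(x in Omega) (v x * v x)%:E <= ((Vol + C) * e ^+ 2)%:E)%E.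
    rewrite mulrC EFinM.
    apply: (@le_trans _ _ (\int[mu]_(x in Omega) ((e ^+ 2)%:E * (1 + (`|v x| / e) `^ p)%:E))%E).
      apply: ge0_le_integral => //.
      - by move=> x _; rewrite lee_fin sqr_ge0.
      - by apply/measurable_EFinP; exact: measurable_funM.
      - apply: measurable_funeM; apply/measurable_EFinP; apply: measurable_funD => //.
        exact: mpow.
      - move=> x _; rewrite -EFinM lee_fin.
        have t0 : 0 <= `|v x| / e by rewrite divr_ge0// ltW.
        have p21 : 1 <= p / 2 by rewrite ler_pdivlMr// mul1r.
        have h := ler_onePpowR p21 (sqr_ge0 (`|v x| / e)).
        rewrite -sqr_powR// [2 * (p / 2)]mulrC divfK// in h.
        apply: le_trans (ler_wpM2l (sqr_ge0 e) h).
        rewrite exprMn real_normK ?num_real// mulrCA -exprMn mulfV ?gt_eqF//.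
        by rewrite expr1n mulr1 -expr2.
    rewrite ge0_integralZl_EFin ?sqr_ge0//.
    - by rewrite lee_wpmul2l ?lee_fin ?sqr_ge0// sobolev_H10_1.
    - by move=> x _; rewrite lee_fin addr_ge0// powR_ge0.
    - apply/measurable_EFinP; apply: measurable_funD => //; exact: mpow.
  rewrite inner_fineE; move: le1; case: (\int[mu]_(x in Omega) _)%E => [r| |]//=.
  by move=> _; rewrite mulr_ge0 ?sqr_ge0// addr_ge0.
have := gradnorm_ge0 Omega v; move: (gradnorm v) (inner v v) (Vol + C) (addr_ge0 Vol0 C0) key.
move=> g A B B0 key g0; apply/ler_addgt0Pr => d d0.
have c0 : 0 < B * (2 * g + 1) + 1 by rewrite ltr_wpDl// mulr_ge0// addr_ge0// mulr_ge0.
pose h := Num.min 1 (d / (B * (2 * g + 1) + 1)).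
have h0 : 0 < h by rewrite lt_min ltr01 divr_gt0.
have h1 : h <= 1 by rewrite ge_min lexx.
have hd : h * (B * (2 * g + 1) + 1) <= d by rewrite -ler_pdivlMr// ge_min lexx orbT.
have := key (g + h); rewrite ltrDl => /(_ h0) /le_trans; apply.
have : B * h * h <= B * h * 1 by rewrite ler_wpM2l// mulr_ge0// ltW.
nra.
Qed.

(** With s = |v| / e and t = |phi| / d, the growth condition reduces the integrand to [t] and s^(p -
    1) t, bounded by 1 + t^p and s^p + t^p. The integrals of these are at most [Vol + C] and
    [2 * C]. The choice e = 1 + |grad v| gives e^(p - 1) >= 1, which lets the constant term of the
    growth share the same factor. *)
Lemma nonlinear_bound (alpha beta : R) (f : R -> R) v phi : continuous f ->
  0 < alpha -> 0 < beta -> growth alpha beta (p - 1) f -> H10 v -> H10 phi ->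
  `|inner (f \o v) phi| <=
    (alpha * (Vol + C) + 2 * beta * C) * (1 + gradnorm v) `^ (p - 1) * gradnorm phi.
Proof.
move=> cf a0 b0 fg Hv Hphi; have p0 := lt_trans ltr01 p1.
have p10 : 0 < p - 1 by rewrite subr_gt0.
pose e := 1 + gradnorm v.
have ve : gradnorm v < e by rewrite ltrDr.
have e1 : 1 <= e by rewrite lerDl gradnorm_ge0.
have e0 : 0 < e by exact: lt_le_trans e1.
have eq1 : 1 <= e `^ (p - 1) by rewrite -[leLHS](powRr0 e) ler_powR// ltW.
rewrite -/e; pose K := alpha * (Vol + C) + 2 * beta * C.
have K0 : 0 <= K by rewrite addr_ge0// mulr_ge0 ?addr_ge0// ?mulr_ge0// ltW.
have [mv _] := (L2P mOmega v).1 (H1_L2 (H10_H1 Hv)).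
have [mphi _] := (L2P mOmega phi).1 (H1_L2 (H10_H1 Hphi)).
have mfv : measurable_fun Omega (f \o v).
  by apply: measurableT_comp mv; exact: continuous_measurable_fun.
have key d : gradnorm phi < d -> `|inner (f \o v) phi| <= K * e `^ (p - 1) * d.
  move=> phid; have d0 : 0 < d by rewrite (le_lt_trans _ phid)// gradnorm_ge0.
  pose s x := `|v x| / e; pose t x := `|phi x| / d.
  have le1 : (\int[mu]_(x in Omega) `|(f (v x) * phi x)%:E| <= (K * e `^ (p - 1) * d)%:E)%E.
    have st0 x : 0 <= s x /\ 0 <= t x by rewrite !divr_ge0// ltW.
    pose B1 x : R := 1 + t x `^ p.
    pose B2 x : R := s x `^ p + t x `^ p.
    have B10 x : 0 <= B1 x by rewrite addr_ge0// powR_ge0.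
    have B20 x : 0 <= B2 x by rewrite addr_ge0// powR_ge0.
    have mB1 : measurable_fun Omega (EFin \o B1).
      by apply/measurable_EFinP; apply: measurable_funD => //; exact: mpow.
    have mB2 : measurable_fun Omega (EFin \o B2).
      by apply/measurable_EFinP; apply: measurable_funD => //; exact: mpow.
    pose c1 := d * alpha; pose c2 := d * beta * e `^ (p - 1).
    have c10 : 0 <= c1 by rewrite mulr_ge0// ltW.
    have c20 : 0 <= c2 by rewrite mulr_ge0 ?powR_ge0// mulr_ge0// ltW.
    apply: (@le_trans _ _ (\int[mu]_(x in Omega) (c1%:E * (EFin \o B1) x + c2%:E * (EFin \o B2) x))%E).
      apply: ge0_le_integral => //.
      - apply/measurable_EFinP; apply: measurableT_comp => //; exact: measurable_funM.
      - by apply: emeasurable_funD; exact: measurable_funeM.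
      - move=> x _; rewrite /= -!EFinM -EFinD lee_fin normrM.
        have [s0 t0] := st0 x.
        have fx := fg (v x); have vE : `|v x| = e * s x by rewrite mulrC divfK ?gt_eqF.
        have -> : `|phi x| = d * t x by rewrite mulrC divfK ?gt_eqF.
        apply: (le_trans (ler_wpM2r (mulr_ge0 (ltW d0) t0) fx)).
        rewrite vE powRM ?(ltW e0)//.
        have h1 : c1 * t x <= c1 * B1 x by rewrite ler_wpM2l// ler_onePpowR// ltW.
        have h2 : c2 * (s x `^ (p - 1) * t x) <= c2 * B2 x by rewrite ler_wpM2l// powR_mul_le.
        apply: le_trans (lerD h1 h2).
        rewrite /c1 /c2; move: (e `^ _) (s x `^ _) => E S.
        by rewrite le_eqVlt; apply/orP; left; apply/eqP; ring.
    rewrite ge0_integralD//; last 4 first.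
    - by move=> x _; rewrite mule_ge0// lee_fin.
    - exact: measurable_funeM.
    - by move=> x _; rewrite mule_ge0// lee_fin.
    - exact: measurable_funeM.
    rewrite !ge0_integralZl_EFin//; last 2 first.
    - by move=> x _; rewrite lee_fin.
    - by move=> x _; rewrite lee_fin.
    have i2 : (\int[mu]_(x in Omega) (EFin \o B2) x <= (C + C)%:E)%E.
      rewrite /B2; under eq_integral do rewrite /= EFinD.
      rewrite ge0_integralD//.
      - by rewrite EFinD leeD//; exact: sobolev_H10.
      - by move=> x _; rewrite lee_fin powR_ge0.
      - apply/measurable_EFinP; exact: mpow.
      - by move=> x _; rewrite lee_fin powR_ge0.
      - apply/measurable_EFinP; exact: mpow.
    have i1 : (\int[mu]_(x in Omega) (EFin \o B1) x <= (Vol + C)%:E)%E.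
      exact: sobolev_H10_1.
    have c10' : (0 <= c1%:E)%E by rewrite lee_fin.
    have c20' : (0 <= c2%:E)%E by rewrite lee_fin.
    apply: le_trans (leeD (lee_wpmul2l c10' i1) (lee_wpmul2l c20' i2)) _.
    rewrite -!EFinM -EFinD lee_fin /c1 /c2 /K.
    have : d * alpha * (Vol + C) * 1 <= d * alpha * (Vol + C) * e `^ (p - 1).
      by rewrite ler_wpM2l// mulr_ge0// addr_ge0.
    move: (e `^ _) => E; lra.
  rewrite inner_fineE.
  have := le_trans (le_abse_integral mu mOmega (_ : measurable_fun Omega (fun x => ((f \o v) x * phi x)%:E))) le1.
  (* For an infinite integral [fine] returns 0, and the bound holds as well. *)
  case: (\int[mu]_(x in Omega) _)%E => [r| |]//= h; first by rewrite -lee_fin h//; apply/measurable_EFinP; exact: measurable_funM.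
    by rewrite normr0 mulr_ge0 ?(ltW d0)// mulr_ge0 ?powR_ge0.
    by rewrite normr0 mulr_ge0 ?(ltW d0)// mulr_ge0 ?powR_ge0.
have := gradnorm_ge0 Omega phi.
have : 0 <= K * e `^ (p - 1).
  by rewrite mulr_ge0 ?powR_ge0.
rewrite -/K; move: (gradnorm phi) `|inner _ _| (K * _) key => g A B key B0 g0.
apply/ler_addgt0Pr => c c0.
have B1 : 0 < B + 1 by rewrite ltr_wpDl.
have := key (g + c / (B + 1)); rewrite ltrDl divr_gt0// => /(_ isT)/le_trans; apply.
rewrite mulrDr lerD2l mulrCA ger_pMr// ler_pdivrMr// mul1r lerDl//.
Qed.

End sobolev_H10.

(** With r = (q + 1) / 2 the Lebesgue exponent 2 r is q + 1, which pairs |v|^q with [phi]; the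
    condition q + 1 < 2* is what [sobolev_test] needs. *)
Lemma subcritical_exponent (R : realType) (n : nat) (q : R) :
  (0 < n)%N -> 0 < q -> (q%:E < critical_exponent n - 1%:E)%E ->
  n%:R * ((q + 1) / 2 - 1) < 2 * ((q + 1) / 2).
Proof.
move=> n0 q0 qn; suff : n%:R * (q - 1) < 2 * (q + 1) by lra.
move: qn; rewrite /critical_exponent; case: ifPn => [n2 _|].
  have : n%:R * q <= 2%:R * q by rewrite ler_wpM2r ?(ltW q0)// ler_nat.
  have : (0 : R) < n%:R by rewrite ltr0n.
  lra.
rewrite -ltnNge => n3; have n3' : (3%:R : R) <= n%:R by rewrite ler_nat.
rewrite -EFinB lte_fin ltrBrDr ltr_pdivlMr; lra.
Qed.

Lemma sobolev_constants (R : realType) (n : nat) (Omega : set 'rV[R]_n)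
  (alpha beta q : R) :
  (0 < n)%N -> open Omega -> bounded_set Omega -> 0 < alpha -> 0 < beta ->
  1 < q -> (q%:E < critical_exponent n - 1%:E)%E ->
  exists P K : R, [/\ 0 <= P, 0 <= K,
    forall v, H10 Omega v -> L2norm Omega v ^+ 2 <= P * gradnorm Omega v ^+ 2 &
    forall (f : R -> R) v phi, continuous f -> growth alpha beta q f ->
      H10 Omega v -> H10 Omega phi ->
      `|inner Omega (f \o v) phi| <=
        K * (1 + gradnorm Omega v) `^ q * gradnorm Omega phi].
Proof.
move=> n0 oO bO a0 b0 q1 qn; have q0 := lt_trans ltr01 q1.
have r1 : 1 < (q + 1) / 2 by lra.
have [C C0] := sobolev_test oO bO n0 r1 (subcritical_exponent n0 q0 qn).
rewrite [2 * _]mulrC divfK// => sob.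
have p1 : 1 < q + 1 by rewrite ltrDr.
have V0 : 0 <= fine (lebesgue_rV n Omega) by rewrite fine_ge0 ?measure_ge0.
exists (fine (lebesgue_rV n Omega) + C).
exists (alpha * (fine (lebesgue_rV n Omega) + C) + 2 * beta * C); split.
- by rewrite addr_ge0.
- by rewrite addr_ge0// mulr_ge0 ?addr_ge0// ?mulr_ge0// ltW.
- by move=> v Hv; apply: (poincare oO bO p1 C0 sob) => //; lra.
- move=> f v phi cf gf Hv Hphi.
  have := nonlinear_bound oO bO p1 C0 sob (f := f) cf a0 b0 _ Hv Hphi.
  by rewrite addrK; apply.
Qed.

(** * Time regularity *)

Lemma dnbhs_interior (R : realType) (T t : R) : t \in `]0, T[ ->
  dnbhs t `=>` within `[0, T]%classic (dnbhs t).
Proof.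
move=> tT P; rewrite /within /= => tP.
have : \forall s \near dnbhs t, s \in `[0, T].
  apply: nbhs_dnbhs; near=> s; apply: subset_itv_oo_cc; near: s.
  exact: near_in_itvoo.
by move: tP; apply: filterS2 => s /[swap] sT; apply.
Unshelve. all: by end_near. Qed.

Lemma nbhs_interior (R : realType) (T t : R) : t \in `]0, T[ ->
  nbhs t `=>` within `[0, T]%classic (nbhs t).
Proof.
move=> tT P; rewrite /within /= => tP.
have : \forall s \near t, s \in `[0, T].
  near=> s; apply: subset_itv_oo_cc; near: s; exact: near_in_itvoo.
by move: tP; apply: filterS2 => s /[swap] sT; apply.
Unshelve. all: by end_near. Qed.

Lemma cvg_dist_le (R : realType) (T : Type) (F : set_system T) {FF : Filter F}
    (G rho : T -> R) (l : R) :
  (\forall s \near F, `|G s - l| <= rho s) -> rho s @[s --> F] --> 0 ->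
  G s @[s --> F] --> l.
Proof.
move=> Gl rho0; apply/cvgrPdist_lt => e e0; near=> s.
rewrite distrC; apply: (@le_lt_trans _ _ (rho s)); first by near: s.
apply: le_lt_trans (ler_norm _) _; rewrite -[rho s]opprK normrN -sub0r.
by near: s; exact: (cvgr_dist_lt _ _ rho0).
Unshelve. all: by end_near. Qed.

Lemma is_derive_dist_le (R : realType) (G rho : R -> R) (t l : R) :
  (\forall s \near t^', `|(s - t)^-1 * (G s - G t) - l| <= rho s) ->
  rho s @[s --> t^'] --> 0 -> is_derive t 1 G l.
Proof.
move=> Gl rho0; apply: cvg_is_derive.
have sh : (h + t) @[h --> (0:R)^'] --> t^'.
  rewrite -{2}[t]add0r; apply: continuous_injective_withinNx.
    by move=> y; apply: cvgD; [exact: cvg_id|exact: cvg_cst].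
  by move=> y /addIr.
apply: cvg_trans (cvg_comp _ _ sh (cvg_dist_le Gl rho0)).
apply: near_eq_cvg; near=> h; rewrite /= addrK.
by rewrite [h *: 1]mulr1.
Unshelve. all: by end_near. Qed.

(** At a point of negativity, continuity would give a whole interval of positive length inside the
    null set. This upgrades the equation, valid almost everywhere in time, to an inequality at every
    time. *)
Lemma ae_ge0_continuous (R : realType) (g : R -> R) (a b : R) :
  (forall t, t \in `]a, b[ -> {for t, continuous g}) ->
  {ae lebesgue_measure, forall t, t \in `]a, b[ -> 0 <= g t} ->
  forall t, t \in `]a, b[ -> 0 <= g t.
Proof.
move=> cg [N [mN N0 gN]] t tab; rewrite leNgt; apply/negP => gt0.
have : \forall s \near t, g s < 0 /\ s \in `]a, b[.
  have ncg := cvgr_lt _ (cg t tab) _ gt0.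
  have nab := near_in_itvoo tab.
  near=> s; split; near: s; [exact: ncg|exact: nab].
move=> /nbhs_ballP[e /= e0 be].
have sub : `]t - e, t + e[%classic `<=` N.
  move=> s /= ; rewrite in_itv/= => se; apply: gN => /= gs.
  have [] := be s.
    by rewrite /ball/= ltr_distlC.
  by move=> gs0 sab; have := gs sab; rewrite leNgt gs0.
have lamE : lebesgue_measure (`]t - e, t + e[%classic : set R) = (2 * e)%:E.
  rewrite lebesgue_measure_itv/= lte_fin (_ : t - e < t + e); last by lra.
  by rewrite -EFinB; congr EFin; ring.
have mI : measurable (`]t - e, t + e[%classic : set R) by exact: measurable_itv.
have le := le_measure lebesgue_measure (mem_set mI) (mem_set mN) sub.
have eq_le (x y : \bar R) : x = y -> (x <= y)%E by move=> ->.
have {}le : ((2 * e)%:E <= 0%:E)%E.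
  exact: le_trans (eq_le _ _ (esym lamE)) (le_trans le (eq_le _ _ N0)).
by move: le; rewrite lee_fin; lra.
Unshelve. all: by end_near. Qed.

Section L2_time_derivative.
Context {R : realType} {n : nat}.
Variable Omega : set 'rV[R]_n.
Hypothesis mOmega : measurable Omega.
Implicit Types (v w phi : 'rV[R]_n -> R) (z : R -> 'rV[R]_n -> R).
Local Notation L2 := (L2 Omega).
Local Notation inner := (inner Omega).
Local Notation L2norm := (L2norm Omega).
#[local] Opaque Defs.L2norm Defs.inner.

Lemma L2norm_lin (a : R) v w : L2 v -> L2 w ->
  L2norm (a *: v + w) <= `|a| * L2norm v + L2norm w.
Proof.
move=> Lv Lw; have Lvw := L2_lin mOmega a Lv Lw.
have N0 := L2norm_ge0 Omega.
exact: (norm_lin_le (N0 v) (N0 w) (N0 _) (L2norm_sqr Lv) (L2norm_sqr Lw)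
  (inner_CS mOmega Lv Lw) (etrans (L2norm_sqr Lvw) (inner_sqr mOmega a Lv Lw))).
Qed.

Lemma L2normD v w : L2 v -> L2 w -> L2norm (v + w) <= L2norm v + L2norm w.
Proof. by move=> Lv Lw; have := L2norm_lin 1 Lv Lw; rewrite scale1r normr1 mul1r. Qed.

Lemma L2normB v w : L2 v -> L2 w -> L2norm (v - w) <= L2norm v + L2norm w.
Proof.
move=> Lv Lw; have := L2norm_lin (-1) Lw Lv.
by rewrite scaleN1r normrN normr1 mul1r addrC [leRHS]addrC.
Qed.

Lemma L2norm_dist v w : L2 v -> L2 w -> `|L2norm v - L2norm w| <= L2norm (v - w).
Proof.
move=> Lv Lw; have Lvw := L2B mOmega Lv Lw.
have h1 := L2normD Lvw Lw; rewrite subrK in h1.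
have h2 := L2norm_lin (-1) Lvw Lv.
rewrite scaleN1r opprB subrK normrN normr1 mul1r in h2.
exact: ler_dist_triangle h1 h2.
Qed.

Definition L2_deriv z v (t : R) :=
  L2norm ((s - t)^-1 *: (z s - z t) - v) @[s --> t^'] --> (0 : R).

Lemma is_derive_inner z v phi (t : R) : (\forall s \near t, L2 (z s)) -> L2 v ->
  L2 phi -> L2_deriv z v t -> is_derive t 1 (fun s => inner (z s) phi) (inner v phi).
Proof.
move=> Lz Lv Lphi dz.
have Lzt := nbhs_singleton Lz.
apply: (@is_derive_dist_le _ _ (fun s =>
   L2norm ((s - t)^-1 *: (z s - z t) - v) * L2norm phi)).
  apply: nbhs_dnbhs; near=> s; have Ls : L2 (z s) by near: s.
  have Lst := L2B mOmega Ls Lzt.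
  have Lq := L2Z mOmega (s - t)^-1 Lst.
  have := inner_CS mOmega (L2B mOmega Lq Lv) Lphi.
  rewrite (innerBl mOmega Lq Lv Lphi) (innerZl mOmega _ Lst Lphi).
  by rewrite (innerBl mOmega Ls Lzt Lphi).
by rewrite -(mul0r (L2norm phi)); apply: cvgM dz _; exact: cvg_cst.
Unshelve. all: by end_near. Qed.

(** With [q] the difference quotient, z(s) = (s - t) q + z(t), so the quotient of the squared norm
    is 2 (q, z(t)) + (s - t) (q, q), and [q] tends to [v]. *)
Lemma is_derive_inner_sqr z v (t : R) : (\forall s \near t, L2 (z s)) -> L2 v ->
  L2_deriv z v t -> is_derive t 1 (fun s => inner (z s) (z s)) (2 * inner v (z t)).
Proof.
move=> Lz Lv dz; have Lzt := nbhs_singleton Lz.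
pose r s := L2norm ((s - t)^-1 *: (z s - z t) - v).
apply: (@is_derive_dist_le _ _ (fun s =>
   2 * (r s * L2norm (z t)) + `|s - t| * (r s + L2norm v) ^+ 2)).
  have : \forall s \near t^', s != t by exact: nbhs_dnbhs_neq.
  have Lz' := nbhs_dnbhs Lz.
  move=> st_; near=> s; have Ls : L2 (z s) by near: s.
  have st : s != t by near: s.
  have st0 : s - t != 0 by rewrite subr_eq0.
  have Lq := L2Z mOmega (s - t)^-1 (L2B mOmega Ls Lzt).
  pose q := (s - t)^-1 *: (z s - z t).
  have -> : z s = (s - t) *: q + z t by rewrite scalerA mulfV// scale1r subrK.
  rewrite (inner_sqr mOmega (s - t) Lq Lzt).
  have Lr := L2B mOmega Lq Lv.
  have h1 := inner_CS mOmega Lr Lzt; rewrite (innerBl mOmega Lq Lv Lzt) in h1.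
  have h2 : L2norm q <= r s + L2norm v by have := L2normD Lr Lv; rewrite subrK.
  have h3 : inner q q <= (r s + L2norm v) ^+ 2.
    rewrite -(L2norm_sqr Lq) ler_sqr ?nnegrE ?addr_ge0 ?L2norm_ge0//.
  have h4 : 0 <= inner q q by exact: inner_ge0.
  rewrite -/q in h1 *; rewrite -/(r s) in h1.
  move: h1 h3 h4; move: (inner q q) (inner q (z t)) (inner v (z t)) (inner (z t) (z t)).
  move=> a b c d h1 h3 h4.
  rewrite (_ : _ - 2 * c = 2 * (b - c) + (s - t) * a); last by field.
  apply: (le_trans (ler_normD _ _)); rewrite !normrM (ger0_norm h4).
  by rewrite lerD ?ler_wpM2l// normr_nat ler_wpM2l.
have e0 : (0 : R) = 2 * (0 * L2norm (z t)) + 0 * (0 + L2norm v) ^+ 2 by ring.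
rewrite [X in _ --> X]e0; apply: cvgD.
  by apply: cvgM; [exact: cvg_cst|apply: cvgM dz _; exact: cvg_cst].
apply: cvgM; last first.
  have rv : r s + L2norm v @[s --> t^'] --> 0 + L2norm v by apply: cvgD dz _; exact: cvg_cst.
  rewrite !expr2; exact: (cvgM rv rv).
rewrite -(normr0 R); apply: cvg_norm; rewrite -(subrr t).
apply: cvgB; last exact: cvg_cst.
exact: cvg_within.
Unshelve. all: by end_near. Qed.

Lemma L2_derivB z w (v : 'rV[R]_n -> R) (x : R -> 'rV[R]_n -> R) (t : R) :
  (\forall s \near t, L2 (z s)) -> (\forall s \near t, L2 (x s)) -> L2 v -> L2 w ->
  L2_deriv z v t -> L2_deriv x w t -> L2_deriv (fun s => z s - x s) (v - w) t.
Proof.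
move=> Lz Lx Lv Lw dz dx; rewrite /L2_deriv.
have Lzt := nbhs_singleton Lz; have Lxt := nbhs_singleton Lx.
apply: (@cvg_dist_le _ _ _ _ _ (fun s => L2norm ((s - t)^-1 *: (z s - z t) - v)
  + L2norm ((s - t)^-1 *: (x s - x t) - w))).
  apply: nbhs_dnbhs; near=> s; have Ls : L2 (z s) by near: s.
  have Lxs : L2 (x s) by near: s.
  rewrite subr0 ger0_norm ?L2norm_ge0//.
  have L1 := L2B mOmega (L2Z mOmega (s - t)^-1 (L2B mOmega Ls Lzt)) Lv.
  have L2 := L2B mOmega (L2Z mOmega (s - t)^-1 (L2B mOmega Lxs Lxt)) Lw.
  apply: le_trans (L2normB L1 L2); rewrite le_eqVlt; apply/orP; left; apply/eqP.
  congr L2norm; move: (_^-1) => c; rewrite !scalerBr !opprB.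
  by apply/funext => y; rewrite !fctE; ring.
by rewrite -(addr0 0); exact: cvgD.
Unshelve. all: by end_near. Qed.

Lemma L2_deriv_shift z v (t h : R) : L2_deriv z v (t + h) ->
  L2_deriv (fun s => z (s + h)) v t.
Proof.
move=> dz; have sh : (s + h) @[s --> t^'] --> (t + h)^'.
  apply: continuous_injective_withinNx.
    by move=> y; apply: cvgD; [exact: cvg_id|exact: cvg_cst].
  by move=> y /addIr.
apply: cvg_trans (cvg_comp _ _ sh dz); apply: near_eq_cvg; near=> s => /=.
by rewrite opprD addrACA subrr addr0.
Unshelve. all: by end_near. Qed.

End L2_time_derivative.

Lemma cvg_mulr0l (R : realType) (T : Type) (F : set_system T) {FF : Filter F}
  (f : T -> R) (c : R) : f s @[s --> F] --> 0 -> f s * c @[s --> F] --> 0.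
Proof. by move=> f0; rewrite -(mul0r c); apply: cvgM f0 _; exact: cvg_cst. Qed.

Section Hm1_theory.
Context {R : realType} {n : nat}.
Variable Omega : set 'rV[R]_n.
Hypotheses (oOmega : open Omega) (bOmega : bounded_set Omega).
Implicit Types (v w phi : 'rV[R]_n -> R) (l : ('rV[R]_n -> R) -> R).
Local Notation H1 := (H1 Omega).
Local Notation H10 := (H10 Omega).
Local Notation Hm1 := (Hm1 Omega).
Local Notation H1norm := (H1norm Omega).
Local Notation Hm1norm := (Hm1norm Omega).
Let mOmega := open_measurable_rV oOmega.
#[local] Opaque Defs.H1norm Defs.gradnorm Defs.grad_inner Defs.L2norm Defs.inner.

Lemma test_function0 : test_function Omega 0.
Proof.
have s0 : closure [set x : 'rV[R]_n | (0 : 'rV[R]_n -> R) x != 0] = set0.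
  rewrite (_ : [set _ | _] = set0) ?closure0//.
  by apply/seteqP; split => // x /=; rewrite eqxx.
split; rewrite ?s0//; [exact: smooth_cst|exact: compact0].
Qed.

Lemma H1norm0 : H1norm 0 = 0.
Proof.
have H0 := H1_test oOmega bOmega test_function0; have L0 := L2_0 mOmega.
apply/eqP; rewrite -sqrf_eq0; apply/eqP; apply: (etrans (H1norm_sqr _ _)).
rewrite (L2norm_sqr L0) (inner0l mOmega L0) (gradnorm_sqr oOmega H0) add0r.
have := grad_inner_lin oOmega bOmega (-1) H0 H0 H0.
by rewrite scaler0 addr0 mulN1r addNr.
Qed.

Lemma H10_test phi : test_function Omega phi -> H10 phi.
Proof.
move=> tphi; split; first exact: (H1_test oOmega bOmega).
exists (fun=> phi); split=> //; rewrite subrr H1norm0; exact: cvg_cst.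
Qed.

Lemma H10Z (a : R) v : H10 v -> H10 (a *: v).
Proof.
move=> Hv; have := H10_lin oOmega bOmega a Hv (H10_test test_function0).
by rewrite addr0.
Qed.

Lemma H10B v w : H10 v -> H10 w -> H10 (v - w).
Proof. by move=> Hv Hw; have := H10_lin oOmega bOmega (-1) Hw Hv; rewrite scaleN1r addrC. Qed.

Lemma H10D v w : H10 v -> H10 w -> H10 (v + w).
Proof. by move=> Hv Hw; have := H10_lin oOmega bOmega 1 Hv Hw; rewrite scale1r. Qed.

Lemma Hm1norm_bound l v : Hm1 l -> H10 v -> `|l v| <= Hm1norm l * H1norm v.
Proof.
move=> [lin [c lc]] Hv; have N0 := H1norm_ge0 Omega.
(* [H1norm v] may vanish without [v] being the zero function, and then [v] cannot be rescaled to the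
   unit ball; boundedness of [l] gives [l v = 0] directly. *)
have [v0|v0] := eqVneq (H1norm v) 0.
  by rewrite v0 mulr0; have := lc _ Hv; rewrite v0 mulr0.
have vp : 0 < H1norm v by rewrite lt_neqAle eq_sym v0 N0.
have H00 := H10_test test_function0.
have l0 : l 0 = 0.
  have := lin 1 0 0 H00 H00; rewrite scaler0 addr0 mul1r => /eqP.
  by rewrite -subr_eq0 opprD addrA subrr add0r oppr_eq0 => /eqP.
have lZ a : l (a *: v) = a * l v by have := lin a v 0 Hv H00; rewrite !addr0 l0 addr0.
have le1 : `|l ((H1norm v)^-1 *: v)| <= Hm1norm l.
  apply: ub_le_sup.
    exists `|c| => _ /= [w [Hw w1] <-]; apply: (le_trans (lc _ Hw)).
    apply: (le_trans (ler_wpM2r (N0 w) (ler_norm c))).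
    by rewrite ler_piMr.
  have Hw := H10Z (H1norm v)^-1 Hv.
  have w1 : H1norm ((H1norm v)^-1 *: v) <= 1.
    have := H1norm_lin oOmega bOmega (H1norm v)^-1 (H10_H1 Hv) (H10_H1 H00).
    by rewrite addr0 H1norm0 addr0 ger0_norm ?invr_ge0// mulVf.
  exact: (ex_intro2 _ _ ((H1norm v)^-1 *: v) (conj Hw w1) erefl).
move: le1; rewrite lZ normrM ger0_norm ?invr_ge0// => le1.
by rewrite -ler_pdivrMr// mulrC.
Qed.

Lemma Hm1_lin (a : R) l l' : Hm1 l -> Hm1 l' -> Hm1 (a *: l + l').
Proof.
move=> [lin [c lc]] [lin' [c' lc']]; split.
  move=> b v w Hv Hw; rewrite !fctE lin// lin'//.
  by rewrite /GRing.scale/=; ring.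
exists (`|a| * c + c') => v Hv; rewrite !fctE mulrDl.
apply: (le_trans (ler_normD _ _)); rewrite lerD ?lc'//.
by rewrite normrM -mulrA ler_wpM2l// lc.
Qed.

End Hm1_theory.

Section weak_solution_regularity.
Context {R : realType} {n : nat}.
Variable Omega : set 'rV[R]_n.
Hypotheses (oOmega : open Omega) (bOmega : bounded_set Omega).
Implicit Types (v w phi psi : 'rV[R]_n -> R).
Local Notation H1 := (H1 Omega).
Local Notation H10 := (H10 Omega).
Local Notation L2 := (L2 Omega).
Local Notation Hm1 := (Hm1 Omega).
Local Notation inner := (inner Omega).
Local Notation grad_inner := (grad_inner Omega).
Local Notation H1norm := (H1norm Omega).
Local Notation L2norm := (L2norm Omega).
Local Notation gradnorm := (gradnorm Omega).
Local Notation Hm1norm := (Hm1norm Omega).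
Let mOmega := open_measurable_rV oOmega.
#[local] Opaque Defs.H1norm Defs.gradnorm Defs.grad_inner Defs.L2norm Defs.inner.
Variables (T : R) (u ut : R -> 'rV[R]_n -> R) (utt : R -> ('rV[R]_n -> R) -> R).
Hypotheses (uC : C0_time H10 H1norm T u) (uC1 : C1_time L2 L2norm T u ut)
  (uC2 : C2_time Hm1 Hm1norm T (fun t => inner (u t)) (fun t => inner (ut t)) utt).

Let near_T t : t \in `]0, T[ -> \forall s \near t, s \in `[0, T].
Proof.
move=> tT; near=> s; apply: subset_itv_oo_cc; near: s; exact: near_in_itvoo.
Unshelve. all: by end_near. Qed.

Lemma u_H10 t : t \in `[0, T] -> H10 (u t).
Proof. by move=> /uC[]. Qed.

Lemma u_L2 t : t \in `[0, T] -> L2 (u t).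
Proof. by move=> /u_H10/H10_H1/H1_L2. Qed.

Lemma ut_L2 t : t \in `[0, T] -> L2 (ut t).
Proof. by case: uC1 => _ h _ /h[]. Qed.

Lemma near_u_L2 t : t \in `]0, T[ -> \forall s \near t, L2 (u s).
Proof. by move=> /near_T; apply: filterS => s; exact: u_L2. Qed.

Lemma L2_deriv_u t : t \in `]0, T[ -> L2_deriv Omega u (ut t) t.
Proof.
move=> tT; case: uC1 => _ _ /(_ t (subset_itv_oo_cc tT)) h.
exact: cvg_trans (cvg_app _ (dnbhs_interior tT)) h.
Qed.

Lemma cvg_u t : t \in `]0, T[ -> H1norm (u s - u t) @[s --> t] --> 0.
Proof.
move=> tT; have [_ h] := uC (subset_itv_oo_cc tT).
exact: cvg_trans (cvg_app _ (nbhs_interior tT)) h.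
Qed.

Lemma cvg_ut t : t \in `]0, T[ -> L2norm (ut s - ut t) @[s --> t] --> 0.
Proof.
move=> tT; case: uC1 => _ /(_ t (subset_itv_oo_cc tT))[_ h] _.
exact: cvg_trans (cvg_app _ (nbhs_interior tT)) h.
Qed.

Lemma continuous_gradnorm_u t : t \in `]0, T[ -> {for t, continuous (gradnorm \o u)}.
Proof.
move=> tT; apply: (@cvg_dist_le _ _ _ _ _ (fun s => H1norm (u s - u t))); last exact: cvg_u.
near=> s; have sT : s \in `[0, T] by near: s; exact: near_T.
have Hs := H10_H1 (u_H10 sT); have Ht := H10_H1 (u_H10 (subset_itv_oo_cc tT)).
exact: le_trans (gradnorm_dist oOmega bOmega Hs Ht) (gradnorm_H1norm _ _).
Unshelve. all: by end_near. Qed.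

Lemma continuous_grad_inner_u t psi : t \in `]0, T[ -> H10 psi ->
  {for t, continuous (fun s => grad_inner (u s) psi)}.
Proof.
move=> tT Hpsi; apply: (@cvg_dist_le _ _ _ _ _ (fun s => H1norm (u s - u t) * gradnorm psi)).
  near=> s; have sT : s \in `[0, T] by near: s; exact: near_T.
  have tT' := subset_itv_oo_cc tT.
  have Hst := H10_H1 (H10B oOmega bOmega (u_H10 sT) (u_H10 tT')).
  have H1psi := H10_H1 Hpsi.
  have := grad_inner_lin oOmega bOmega (-1) (H10_H1 (u_H10 tT')) (H10_H1 (u_H10 sT)) H1psi.
  rewrite scaleN1r [- _ + _]addrC mulN1r [- _ + _]addrC => <-.
  apply: (le_trans (grad_inner_CS oOmega bOmega Hst H1psi)).
  by rewrite ler_wpM2r ?gradnorm_ge0// gradnorm_H1norm.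
by apply: cvg_mulr0l; exact: cvg_u.
Unshelve. all: by end_near. Qed.

Lemma continuous_inner_ut t v : t \in `]0, T[ -> L2 v ->
  {for t, continuous (fun s => inner (ut s) v)}.
Proof.
move=> tT Lv; apply: (@cvg_dist_le _ _ _ _ _ (fun s => L2norm (ut s - ut t) * L2norm v)).
  near=> s; have sT : s \in `[0, T] by near: s; exact: near_T.
  have Ls := ut_L2 sT; have Lt := ut_L2 (subset_itv_oo_cc tT).
  rewrite -(innerBl mOmega Ls Lt Lv).
  exact: (inner_CS mOmega (L2B mOmega Ls Lt) Lv).
by apply: cvg_mulr0l; exact: cvg_ut.
Unshelve. all: by end_near. Qed.

Lemma utt_Hm1 t : t \in `[0, T] -> Hm1 (utt t).
Proof. by case: uC2 => _ [_ h _] /h[]. Qed.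

Lemma inner_ut_Hm1 t : t \in `[0, T] -> Hm1 (inner (ut t)).
Proof. by case: uC2 => _ [h _ _] /h[]. Qed.

Lemma continuous_utt t psi : t \in `]0, T[ -> H10 psi ->
  {for t, continuous (fun s => utt s psi)}.
Proof.
move=> tT Hpsi; apply: (@cvg_dist_le _ _ _ _ _ (fun s => Hm1norm (utt s - utt t) * H1norm psi)).
  near=> s; have sT : s \in `[0, T] by near: s; exact: near_T.
  have := Hm1norm_bound oOmega bOmega (_ : Hm1 (utt s - utt t)) Hpsi; apply.
  have := Hm1_lin (-1) (utt_Hm1 (subset_itv_oo_cc tT)) (utt_Hm1 sT).
  by rewrite scaleN1r addrC.
apply: cvg_mulr0l.
case: uC2 => _ [_ /(_ t (subset_itv_oo_cc tT))[_ h] _].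
exact: cvg_trans (cvg_app _ (nbhs_interior tT)) h.
Unshelve. all: by end_near. Qed.

Lemma is_derive_inner_ut t psi : t \in `]0, T[ -> H10 psi ->
  is_derive t 1 (fun s => inner (ut s) psi) (utt t psi).
Proof.
move=> tT Hpsi; apply: (@is_derive_dist_le _ _ (fun s =>
  Hm1norm ((s - t)^-1 *: (inner (ut s) - inner (ut t)) - utt t) * H1norm psi)).
  apply: nbhs_dnbhs; near=> s; have sT : s \in `[0, T] by near: s; exact: near_T.
  have tT' := subset_itv_oo_cc tT.
  have H1 : Hm1 (inner (ut s) - inner (ut t)).
    have := Hm1_lin (-1) (inner_ut_Hm1 tT') (inner_ut_Hm1 sT).
    by rewrite scaleN1r addrC.
  have H2 : Hm1 ((s - t)^-1 *: (inner (ut s) - inner (ut t)) - utt t).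
    have H0 : Hm1 (- utt t).
      have := Hm1_lin (-2) (utt_Hm1 tT') (utt_Hm1 tT').
      by rewrite -{2}[utt t]scale1r -scalerDl (_ : -2 + 1 = -1) ?scaleN1r//; ring.
    exact: (Hm1_lin _ H1 H0).
  exact: (Hm1norm_bound oOmega bOmega H2 Hpsi).
apply: cvg_mulr0l.
case: uC2 => _ [_ _ /(_ t (subset_itv_oo_cc tT)) h].
exact: cvg_trans (cvg_app _ (dnbhs_interior tT)) h.
Unshelve. all: by end_near. Qed.

End weak_solution_regularity.

(** * The energy inequality *)

Lemma perturbed_linear_bound (R : realFieldType)
  (h N P Q K e l1 l2 l3 l4 y1 y2 y3 y4 z1 z2 z3 z4 : R) : 0 <= h ->
  (l1 + l2 + l3 + h * l4 + K + 1) * N <= e -> P <= Q + K * N ->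
  `|z1| <= l1 * N -> `|z2| <= l3 * N -> `|z3| <= l2 * N -> `|z4| <= l4 * N ->
  0 <= N ->
  z1 + y1 + (z3 + y3) + (z2 + y2) + h * (z4 + y4) <= P ->
  y1 + y3 + y2 + h * y4 <= Q + e.
Proof.
move=> h0 He PQ; rewrite !ler_norml => /andP[a1 _] /andP[a2 _] /andP[a3 _] /andP[a4 _] N0.
have := ler_wpM2l h0 a4; lra.
Qed.

Section energy_increment.
Context {R : realType} {n : nat}.
Variable Omega : set 'rV[R]_n.
Hypotheses (oOmega : open Omega) (bOmega : bounded_set Omega).
Implicit Types (v w phi psi : 'rV[R]_n -> R).
Local Notation H1 := (H1 Omega).
Local Notation H10 := (H10 Omega).
Local Notation L2 := (L2 Omega).
Local Notation Hm1 := (Hm1 Omega).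
Local Notation inner := (inner Omega).
Local Notation grad_inner := (grad_inner Omega).
Local Notation H1norm := (H1norm Omega).
Local Notation L2norm := (L2norm Omega).
Local Notation gradnorm := (gradnorm Omega).
Local Notation Hm1norm := (Hm1norm Omega).
Let mOmega := open_measurable_rV oOmega.
#[local] Opaque Defs.H1norm Defs.gradnorm Defs.grad_inner Defs.L2norm Defs.inner.
Variables (T : R) (u ut : R -> 'rV[R]_n -> R) (utt : R -> ('rV[R]_n -> R) -> R).
Hypotheses (uC : C0_time H10 H1norm T u) (uC1 : C1_time L2 L2norm T u ut)
  (uC2 : C2_time Hm1 Hm1norm T (fun t => inner (u t)) (fun t => inner (ut t)) utt)
  (utH : {ae lebesgue_measure, forall t, t \in `]0, T[ -> H10 (ut t)}).
Variable r : R -> ('rV[R]_n -> R) -> R.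
Hypothesis eqn : forall phi, H10 phi ->
  {ae lebesgue_measure, forall t, t \in `[0, T] ->
     utt t phi + grad_inner (u t) phi + grad_inner (ut t) phi + inner (ut t) phi
     = r t phi}.
Variables (a b S : R).
Hypotheses (a0 : 0 < a) (ab : a < b) (bT : b < T).
Hypothesis rS : forall t phi, t \in `[a, b] -> H10 phi -> r t phi <= S * gradnorm phi.

Let abT t : t \in `[a, b] -> t \in `]0, T[.
Proof. by rewrite !in_itv/= => /andP[ta tb]; rewrite (lt_le_trans a0)// (le_lt_trans tb). Qed.

(** With the Laplacian on [psi], each term on the left is continuous in time, so the relation
    extends from almost every to every [t]. An inequality is kept because [r] is not assumed
    continuous in time. *)
Lemma weak_ineq_test psi t : test_function Omega psi -> t \in `]a, b[ ->
  utt t psi + grad_inner (u t) psi - inner (ut t) (laplacian psi) + inner (ut t) psi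
  <= S * gradnorm psi.
Proof.
move=> tpsi; have Hpsi := H10_test oOmega bOmega tpsi.
have Lpsi := H1_L2 (H10_H1 Hpsi); have LD := L2_laplacian oOmega bOmega tpsi.
move=> tab; rewrite -subr_ge0; move: t tab.
apply: (@ae_ge0_continuous R (fun t => S * gradnorm psi -
  (utt t psi + grad_inner (u t) psi - inner (ut t) (laplacian psi) + inner (ut t) psi))).
  move=> t /subset_itv_oo_cc /abT tT.
  have c1 := continuous_utt oOmega bOmega uC2 tT Hpsi.
  have c2 := continuous_grad_inner_u oOmega bOmega uC tT Hpsi.
  have c3 := continuous_inner_ut oOmega uC1 tT LD.
  have c4 := continuous_inner_ut oOmega uC1 tT Lpsi.
  exact: (cvgB (cvg_cst _) (cvgD (cvgB (cvgD c1 c2) c3) c4)).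
have := eqn Hpsi; move: utH.
apply: (@filterS2 _ _ (ae_filter_ringOfSetsType (@lebesgue_measure R))) => t Ht e tab; have tab' := subset_itv_oo_cc tab; have tT := abT tab'.
rewrite subr_ge0; apply: le_trans (rS tab' Hpsi); rewrite -e; last exact: subset_itv_oo_cc.
by rewrite (grad_inner_test oOmega bOmega (H10_H1 (Ht tT)) tpsi).
Qed.

Let ubar := 2^-1 *: (u a + u b).
Variable om : R.
Hypothesis uom : forall t, t \in `[a, b] -> gradnorm (u t - ubar) <= om.

Let aab : a \in `[a, b].
Proof. by rewrite in_itv/= lexx ltW. Qed.

Let bab : b \in `[a, b].
Proof. by rewrite in_itv/= lexx ltW. Qed.

Let HT t : t \in `[a, b] -> t \in `[0, T].
Proof. by move=> /abT; exact: subset_itv_oo_cc. Qed.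

Let Hu t : t \in `[a, b] -> H10 (u t).
Proof. by move=> tab; exact: (u_H10 uC (HT tab)). Qed.

Let Hubar : H10 ubar.
Proof. exact: (H10Z oOmega bOmega _ (H10D oOmega bOmega (Hu aab) (Hu bab))). Qed.

Let Hw : H10 (u b - u a).
Proof. exact: (H10B oOmega bOmega (Hu bab) (Hu aab)). Qed.

Let Lut t : t \in `[a, b] -> L2 (ut t).
Proof. by move=> tab; exact: (ut_L2 uC1 (HT tab)). Qed.

(** The mean value theorem is applied to [G], whose derivative consists of the left side of
    [weak_ineq_test] without the term in [u]. At the intermediate time, replacing [u] by [ubar] in
    that term costs [om * gradnorm psi]. *)
Lemma increment_ineq_test psi : test_function Omega psi ->
  inner (ut b - ut a) psi + grad_inner (u b - u a) psi + inner (u b - u a) psi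
    + (b - a) * grad_inner ubar psi <= (b - a) * (S + om) * gradnorm psi.
Proof.
move=> tpsi; have Hpsi := H10_test oOmega bOmega tpsi; have H1psi := H10_H1 Hpsi.
have Lpsi := H1_L2 H1psi; have LD := L2_laplacian oOmega bOmega tpsi.
pose G t : R := inner (ut t) psi + (inner (u t) psi - inner (u t) (laplacian psi)).
pose dG t : R := utt t psi + (inner (ut t) psi - inner (ut t) (laplacian psi)).
have dGE (t : R) : t \in `[a, b] -> is_derive t 1 G (dG t).
  move=> tab; have tT := abT tab; have Lt := Lut tab.
  have nu := near_u_L2 uC tT; have du := L2_deriv_u uC1 tT.
  have d1 := is_derive_inner_ut oOmega bOmega uC2 tT Hpsi.
  have d2 := is_derive_inner mOmega nu Lt Lpsi du.
  have d3 := is_derive_inner mOmega nu Lt LD du.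
  exact: (is_deriveD d1 (is_deriveB d2 d3)).
have cG : {within `[a, b], continuous G}.
  apply: derivable_within_continuous => t tab; have := dGE t tab => dGt.
  exact: ex_derive.
have [c cab GE] := MVT ab (fun t tab => dGE t (subset_itv_oo_cc tab)) cG.
have cab' := subset_itv_oo_cc cab.
have wi := weak_ineq_test tpsi cab.
have Lu t : t \in `[a, b] -> L2 (u t) by move=> /Hu/H10_H1/H1_L2.
have gub : - grad_inner (u c) psi <= om * gradnorm psi - grad_inner ubar psi.
  have Hcb := H10B oOmega bOmega (Hu cab') Hubar.
  have E := grad_inner_lin oOmega bOmega 1 (H10_H1 Hcb) (H10_H1 Hubar) H1psi.
  rewrite scale1r subrK mul1r in E; rewrite E opprD lerD2r.
  apply: le_trans (_ : `|grad_inner (u c - ubar) psi| <= _).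
    by rewrite -normrN ler_norm.
  apply: (le_trans (grad_inner_CS oOmega bOmega (H10_H1 Hcb) H1psi)).
  by rewrite ler_wpM2r ?gradnorm_ge0// uom.
have e1 := innerBl mOmega (Lut bab) (Lut aab) Lpsi.
have e2 := innerBl mOmega (Lu b bab) (Lu a aab) Lpsi.
have e3 := innerBl mOmega (Lu b bab) (Lu a aab) LD.
have e4 := grad_inner_test oOmega bOmega (H10_H1 Hw) tpsi.
rewrite e1 e2 e4 e3.
have ba0 : 0 < b - a by rewrite subr_gt0.
have key : dG c <= (S + om) * gradnorm psi - grad_inner ubar psi.
  move: wi gub; rewrite /dG.
  move: (grad_inner (u c) psi) (grad_inner ubar psi) (gradnorm psi) (utt c psi) => x1 x2 x3 x4.
  move: (inner (ut c) psi) (inner (ut c) (laplacian psi)) => x5 x6 h1 h2; lra.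
have {}key := ler_wpM2r (ltW ba0) key.
rewrite -GE /G in key; move: key.
move: (inner (ut b) psi) (inner (ut a) psi) (inner (u b) psi) (inner (u a) psi) => x1 x2 x3 x4.
move: (inner (u b) (laplacian psi)) (inner (u a) (laplacian psi)) => x5 x6.
move: (grad_inner ubar psi) (gradnorm psi) => x7 x8 h.
clear wi gub e1 e2 e3 e4 GE; lra.
Qed.

(** Both sides are continuous in the test function for the H1 norm, and test functions are dense in
    [H10]. Only fixed increments in time remain, so no regularity of [u_t] beyond [L2] is
    required. *)
Lemma increment_ineq w : H10 w ->
  inner (ut b - ut a) w + grad_inner (u b - u a) w + inner (u b - u a) w
    + (b - a) * grad_inner ubar w <= (b - a) * (S + om) * gradnorm w.
Proof.
move=> H10w; have H1w := H10_H1 H10w; have Lw := H1_L2 H1w.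
have ba0 : 0 < b - a by rewrite subr_gt0.
have Ldut := L2B mOmega (Lut bab) (Lut aab).
have Ldu := H1_L2 (H10_H1 Hw).
pose c := L2norm (ut b - ut a) + gradnorm (u b - u a) + L2norm (u b - u a)
  + (b - a) * gradnorm ubar.
pose k := (b - a) * (S + om).
have c0 : 0 <= c by rewrite !addr_ge0 ?mulr_ge0 ?L2norm_ge0 ?gradnorm_ge0 ?ltW.
apply/ler_addgt0Pr => e e0.
have e10 : 0 < e / (c + `|k| + 1) by rewrite divr_gt0// ltr_wpDl// addr_ge0.
have [psi tpsi psiw] := H10_approx H10w e10.
have ineq := increment_ineq_test tpsi.
have Hpsi := H10_test oOmega bOmega tpsi; have H1psi := H10_H1 Hpsi.
have Lpsi := H1_L2 H1psi.
have Hd := H10_H1 (H10B oOmega bOmega Hpsi H10w); have Ld := H1_L2 Hd.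
have ld := L2norm_H1norm Omega (psi - w); have gd := gradnorm_H1norm Omega (psi - w).
have ge := grad_inner_CS oOmega bOmega.
have i1 : inner (ut b - ut a) psi = inner (ut b - ut a) (psi - w) + inner (ut b - ut a) w.
  have h := innerDl mOmega Ld Lw Ldut; rewrite subrK in h.
  by rewrite innerC h; congr (_ + _); exact: innerC.
have i2 : inner (u b - u a) psi = inner (u b - u a) (psi - w) + inner (u b - u a) w.
  have h := innerDl mOmega Ld Lw Ldu; rewrite subrK in h.
  by rewrite innerC h; congr (_ + _); exact: innerC.
have i3 z : H1 z -> grad_inner z psi = grad_inner z (psi - w) + grad_inner z w.
  move=> Hz; have h := grad_inner_lin oOmega bOmega 1 Hd H1w Hz.
  rewrite scale1r subrK mul1r in h.
  exact: etrans (grad_innerC Omega z psi)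
    (etrans h (congr2 +%R (grad_innerC Omega (psi - w) z) (grad_innerC Omega w z))).
have i4 : gradnorm psi <= gradnorm (psi - w) + gradnorm w.
  have h := gradnorm_lin oOmega bOmega 1 Hd H1w.
  by rewrite scale1r subrK normr1 mul1r in h.
have b1 := le_trans (inner_CS mOmega Ldut Ld) (ler_wpM2l (L2norm_ge0 _ _) ld).
have b2 := le_trans (inner_CS mOmega Ldu Ld) (ler_wpM2l (L2norm_ge0 _ _) ld).
have b3 := le_trans (ge _ _ (H10_H1 Hw) Hd) (ler_wpM2l (gradnorm_ge0 _ _) gd).
have b4 := le_trans (ge _ _ (H10_H1 Hubar) Hd) (ler_wpM2l (gradnorm_ge0 _ _) gd).
rewrite i1 i2 (i3 _ (H10_H1 Hw)) (i3 _ (H10_H1 Hubar)) in ineq.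
have g0 := gradnorm_ge0 Omega psi.
have gp : `|gradnorm psi - gradnorm w| <= H1norm (psi - w).
  exact: le_trans (gradnorm_dist oOmega bOmega H1psi H1w) gd.
have kk : k * gradnorm psi <= k * gradnorm w + `|k| * H1norm (psi - w).
  rewrite -lerBlDl -mulrBr; apply: (le_trans (ler_norm _)); rewrite normrM.
  exact: ler_wpM2l.
have He : (c + `|k| + 1) * H1norm (psi - w) <= e.
  by rewrite mulrC -ler_pdivlMr ?ltW// ltr_wpDl// addr_ge0.
have N0 := H1norm_ge0 Omega (psi - w).
rewrite -/k in ineq *; rewrite /c in He.
exact: (perturbed_linear_bound (ltW ba0) He kk b1 b2 b3 b4 N0 ineq).
Qed.

(** The increment u(b) - u(a) itself is the test function. The weak damping contributes a
    nonnegative square, and the strong damping the square of its gradient norm, which absorbs the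
    linear term on the right. *)
Lemma energy_increment : 
  inner (ut b - ut a) (u b - u a)
    + (b - a) / 2 * (gradnorm (u b) ^+ 2 - gradnorm (u a) ^+ 2)
  <= (b - a) ^+ 2 * ((S + om) ^+ 2 / 4).
Proof.
have := increment_ineq Hw; have H1w := H10_H1 Hw; have Lw := H1_L2 H1w.
have Ha := H10_H1 (Hu aab); have Hb := H10_H1 (Hu bab).
have e1 := gradnorm_sqr oOmega H1w.
have e2 : grad_inner ubar (u b - u a) =
    (gradnorm (u b) ^+ 2 - gradnorm (u a) ^+ 2) / 2.
  have f1 := grad_inner_lin oOmega bOmega 1 Ha Hb H1w.
  have Hab := H10_H1 (H10D oOmega bOmega (Hu aab) (Hu bab)).
  have H0 := H10_H1 (H10_test oOmega bOmega (@test_function0 R n Omega)).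
  have f2 := grad_inner_lin oOmega bOmega 2^-1 Hab H0 H1w.
  have f0 := grad_inner_lin oOmega bOmega (-1) H0 H0 H1w.
  rewrite scaler0 addr0 mulN1r addNr in f0.
  rewrite scale1r mul1r in f1; rewrite addr0 -/ubar in f2.
  have g z : H1 z -> grad_inner z (u b - u a) = grad_inner (u b) z - grad_inner (u a) z.
    move=> Hz; have h := grad_inner_lin oOmega bOmega (-1) Ha Hb Hz.
    rewrite scaleN1r mulN1r ![- _ + _]addrC in h.
    exact: etrans (grad_innerC _ _ _) h.
  have ga := g _ Ha; have gb := g _ Hb.
  have sa := gradnorm_sqr oOmega Ha; have sb := gradnorm_sqr oOmega Hb.
  have sym := grad_innerC Omega (u a) (u b).
  move: f1 f2 f0 ga gb sa sb sym.
  move: (grad_inner ubar (u b - u a)) (grad_inner (u a + u b) (u b - u a)) (grad_inner 0 (u b - u a)).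
  move: (grad_inner (u a) (u b - u a)) (grad_inner (u b) (u b - u a)) (gradnorm (u a)) (gradnorm (u b)).
  move: (grad_inner (u a) (u b)) (grad_inner (u b) (u a)) (grad_inner (u a) (u a)) (grad_inner (u b) (u b)).
  move=> x1 x2 x3 x4 x5 x6 x7 x8 x9 x10 x11; lra.
rewrite e2; have := inner_ge0 Omega (u b - u a).
move: (gradnorm (u b) ^+ 2 - gradnorm (u a) ^+ 2) => D.
move: e1; move: (grad_inner (u b - u a) (u b - u a)) (gradnorm (u b - u a)) => gw g.
move: (inner (ut b - ut a) (u b - u a)) (inner (u b - u a) (u b - u a)) => x y <- y0 h.
(* Completing the square: h k g - g^2 <= h^2 k^2 / 4 with h = b - a and k = S + om. *)
have := sqr_ge0 (g - (b - a) * (S + om) / 2); lra.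
Qed.

End energy_increment.

Lemma antiderivative (R : realType) (f : R -> R) (a b : R) :
  (forall t, t \in `[a, b] -> {for t, continuous f}) ->
  exists P : R -> R, forall t, t \in `]a, b[ -> is_derive t (1 : R) P (f t).
Proof.
move=> cf; exists (fun x => \int[lebesgue_measure]_(t in `[a, x]) f t) => t tab.
have /andP[at_ tb] : a < t < b by rewrite in_itv/= in tab.
have itf : lebesgue_measure.-integrable [set` Interval (BLeft a) (BRight b)] (EFin \o f).
  apply: continuous_compact_integrable; first exact: segment_compact.
  apply/continuous_in_subspaceT => x; rewrite inE/=; exact: cf.
have [dF FE] := continuous_FTC1 tb itf (at_ : (BLeft a < BRight t)%E) (cf t (subset_itv_oo_cc tab)).
exact: (DeriveDef dF (etrans (esym (derive1E _ _)) FE)).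
Qed.

Section energy_dini.
Context {R : realType} {n : nat}.
Variable Omega : set 'rV[R]_n.
Hypotheses (oOmega : open Omega) (bOmega : bounded_set Omega).
Implicit Types (v w phi psi : 'rV[R]_n -> R).
Local Notation H1 := (H1 Omega).
Local Notation H10 := (H10 Omega).
Local Notation L2 := (L2 Omega).
Local Notation Hm1 := (Hm1 Omega).
Local Notation inner := (inner Omega).
Local Notation grad_inner := (grad_inner Omega).
Local Notation H1norm := (H1norm Omega).
Local Notation L2norm := (L2norm Omega).
Local Notation gradnorm := (gradnorm Omega).
Local Notation Hm1norm := (Hm1norm Omega).
Let mOmega := open_measurable_rV oOmega.
#[local] Opaque Defs.H1norm Defs.gradnorm Defs.grad_inner Defs.L2norm Defs.inner.
Variables (T : R) (u ut : R -> 'rV[R]_n -> R) (utt : R -> ('rV[R]_n -> R) -> R).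
Hypotheses (uC : C0_time H10 H1norm T u) (uC1 : C1_time L2 L2norm T u ut)
  (uC2 : C2_time Hm1 Hm1norm T (fun t => inner (u t)) (fun t => inner (ut t)) utt)
  (utH : {ae lebesgue_measure, forall t, t \in `]0, T[ -> H10 (ut t)}).
Variable r : R -> ('rV[R]_n -> R) -> R.
Hypothesis eqn : forall phi, H10 phi ->
  {ae lebesgue_measure, forall t, t \in `[0, T] ->
     utt t phi + grad_inner (u t) phi + grad_inner (ut t) phi + inner (ut t) phi
     = r t phi}.
Variables (t1 t2 c S om : R).
Hypotheses (t10 : 0 < t1) (t12 : t1 < t2) (t2c : t2 < c) (cT : c < T).
Hypothesis rS : forall t phi, t \in `[t1, c] -> H10 phi -> r t phi <= S * gradnorm phi.
Hypothesis osc : forall t s, t \in `[t1, c] -> s \in `[t1, c] -> gradnorm (u t - u s) <= om.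

Let cT' t : t \in `[t1, c] -> t \in `]0, T[.
Proof. by rewrite !in_itv/= => /andP[ta tb]; rewrite (lt_le_trans t10)// (le_lt_trans tb). Qed.

Let HT t : t \in `[t1, c] -> t \in `[0, T].
Proof. by move=> tc; exact: (subset_itv_oo_cc (cT' tc)). Qed.

Let gu t := gradnorm (u t) ^+ 2.

(* As [h --> 0] this tends to [|u_t|^2 + |grad u|^2] when [P] is an
   antiderivative of [|grad u|^2]. *)
Let difference_energy (P : R -> R) (h t : R) : R :=
  h ^- 2 * inner (u (t + h) - u t) (u (t + h) - u t) + h^-1 * (P (t + h) - P t).

(** The time derivative of [difference_energy] is 2 / h^2 times the left side of [energy_increment]
    on [t, t + h], so the powers of [h] cancel and the bound is uniform in [h]. *)
Lemma energy_difference_quotient (P : R -> R) (h : R) :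
  (forall t : R, t \in `[t1, c] -> is_derive t (1 : R) P (gu t)) -> 0 < h -> t2 + h <= c ->
  difference_energy P h t2 - difference_energy P h t1 <= (S + om) ^+ 2 / 2 * (t2 - t1).
Proof.
move=> dP h0 hc; set N := difference_energy P h.
pose dN t := h ^- 2 * (2 * inner (ut (t + h) - ut t) (u (t + h) - u t))
   + h^-1 * (gu (t + h) - gu t).
have sh (t : R) : t \in `[t1, t2] -> t \in `[t1, c] /\ t + h \in `[t1, c].
  by rewrite !in_itv/= => /andP[ta tb]; split; apply/andP; split; lra.
have dNE (t : R) : t \in `[t1, t2] -> is_derive t 1 N (dN t).
  move=> /sh[tc thc].
  have Lt := ut_L2 uC1 (HT tc); have Lth := ut_L2 uC1 (HT thc).
  have n1 := near_u_L2 uC (cT' tc); have n2 := near_u_L2 uC (cT' thc).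
  have shc : (s + h) @[s --> t] --> t + h by apply: cvgD; [exact: cvg_id|exact: cvg_cst].
  have n2' : \forall s \near t, L2 (u (s + h)) by exact: (shc _ n2).
  have d1 := L2_deriv_shift (L2_deriv_u uC1 (cT' thc)).
  have d2 := L2_derivB mOmega n2' n1 Lth Lt d1 (L2_deriv_u uC1 (cT' tc)).
  have n3 : \forall s \near t, L2 (u (s + h) - u s).
    by move: n2' n1; apply: filterS2 => s; exact: (L2B mOmega).
  have d3 := is_derive_inner_sqr mOmega n3 (L2B mOmega Lth Lt) d2.
  have dsh : is_derive t 1 (fun s : R => s + h) (1 : R).
    have := is_deriveD (is_derive_id t (1 : R)) (is_derive_cst h t (1 : R)).
    by rewrite addr0.
  have d4 := @is_derive1_comp R P (fun s => s + h) t _ _ (dP _ thc) dsh; rewrite mulr1 in d4.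
  have d5 := is_deriveB d4 (dP _ tc).
  exact: (is_deriveD (is_deriveZ (h ^- 2) d3) (is_deriveZ h^-1 d5)).
have cN : {within `[t1, t2], continuous N}.
  apply: derivable_within_continuous => t tab; have := dNE t tab => dNt.
  exact: ex_derive.
have [x xab ->] := MVT t12 (fun t tab => dNE t (subset_itv_oo_cc tab)) cN.
rewrite ler_wpM2r ?subr_ge0 ?(ltW t12)//.
have [xc xhc] := sh x (subset_itv_oo_cc xab).
have x1 : t1 < x by move: xab; rewrite in_itv/= => /andP[].
have xh : x < x + h by rewrite ltrDl.
have xhT : x + h < T by move: (cT' xhc); rewrite in_itv/= => /andP[].
have sub s : s \in `[x, x + h] -> s \in `[t1, c].
  move: xhc; rewrite !in_itv/= => /andP[_ xhc] /andP[xs sx].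
  by rewrite (le_trans (ltW x1))// (le_trans sx).
have rS' s phi : s \in `[x, x + h] -> H10 phi -> r s phi <= S * gradnorm phi.
  by move=> /sub; exact: rS.
(* The difference from the average is the mean of the differences from the two end values. *)
have osc' s : s \in `[x, x + h] -> gradnorm (u s - 2^-1 *: (u x + u (x + h))) <= om.
  have aux (y1 y2 y3 y4 : R) : y3 <= 2^-1 * y2 + y4 -> y4 <= 0 -> y1 <= om ->
    y2 <= om -> 2^-1 * y1 + y3 <= om by move=> *; lra.
  move=> /sub sc; have Hs := u_H10 uC (HT sc); have Hx := u_H10 uC (HT xc).
  have Hxh := u_H10 uC (HT xhc).
  have H1a := H10_H1 (H10B oOmega bOmega Hs Hx).
  have Hb := H10B oOmega bOmega Hs Hxh; have H1b := H10_H1 Hb.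
  have H0 := H10_H1 (H10_test oOmega bOmega (@test_function0 R n Omega)).
  have H1b' := H10_H1 (H10Z oOmega bOmega 2^-1 Hb).
  have -> : u s - 2^-1 *: (u x + u (x + h)) = 2^-1 *: (u s - u x) + 2^-1 *: (u s - u (x + h)).
    rewrite !scalerDr !scalerN addrACA -scalerDl -opprD.
    by rewrite (_ : 2^-1 + 2^-1 = 1) ?scale1r//; field.
  apply: (le_trans (gradnorm_lin oOmega bOmega 2^-1 H1a H1b')).
  have h1 := gradnorm_lin oOmega bOmega 2^-1 H1b H0.
  have g0 : gradnorm 0 <= 0.
    by have := gradnorm_H1norm Omega 0; rewrite (H1norm0 oOmega bOmega).
  rewrite addr0 in h1.
  have o1 := osc sc xc; have o2 := osc sc xhc.
  rewrite ger0_norm in h1 *; last by rewrite invr_ge0.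
  exact: aux h1 g0 o1 o2.
have ei := energy_increment oOmega bOmega uC uC1 uC2 utH eqn (lt_trans t10 x1) xh xhT rS' osc'.
have xhx : x + h - x = h by rewrite addrAC subrr add0r.
rewrite xhx -/(gu x) -/(gu (x + h)) in ei; rewrite /dN.
move: ei; move: (gu (x + h) - gu x) (inner _ _) (S + om) => D I s ei.
have hh : 0 < h ^+ 2 by rewrite exprn_gt0.
have -> : h ^- 2 * (2 * I) + h^-1 * D = (I + h / 2 * D) * (2 / h ^+ 2).
  by field; rewrite gt_eqF.
rewrite (_ : s ^+ 2 / 2 = h ^+ 2 * (s ^+ 2 / 4) * (2 / h ^+ 2)); last first.
  by field; rewrite gt_eqF.
by rewrite ler_wpM2r// divr_ge0// ltW.
Qed.

Lemma energy_dini :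
  (L2norm (ut t2) ^+ 2 + gu t2) - (L2norm (ut t1) ^+ 2 + gu t1)
    <= (S + om) ^+ 2 / 2 * (t2 - t1).
Proof.
have [t1p t12p t2cp cTp] := And4 t10 t12 t2c cT.
(* A slightly larger interval, still interior to [0, T], so that [P] is differentiable also at the
   end points of [t1, c]. *)
pose a := t1 / 2; pose b := (c + T) / 2.
have ab t : t \in `[t1, c] -> t \in `]a, b[.
  by rewrite !in_itv/= /a /b => /andP[ta tb]; apply/andP; split; lra.
have abT t : t \in `[a, b] -> t \in `]0, T[.
  by rewrite !in_itv/= /a /b => /andP[ta tb]; apply/andP; split; lra.
have cgu t : t \in `[a, b] -> {for t, continuous gu}.
  move=> /abT tT; have cg := continuous_gradnorm_u oOmega bOmega uC tT.
  exact: (cvgM cg cg).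
have [P dP] := antiderivative cgu.
have dP' (t : R) : t \in `[t1, c] -> is_derive t (1 : R) P (gu t) by move=> /ab; exact: dP.
pose N := difference_energy P.
have limN (t : R) : t \in `[t1, t2] -> N h t @[h --> 0^'+] --> L2norm (ut t) ^+ 2 + gu t.
  move=> tt; have tc : t \in `[t1, c].
    by move: tt; rewrite !in_itv/= => /andP[-> h]; rewrite (le_trans h)// ltW.
  have sh : (h + t) @[h --> (0:R)^'] --> t^'.
    rewrite -{2}[t]add0r; apply: continuous_injective_withinNx.
      by move=> y; apply: cvgD; [exact: cvg_id|exact: cvg_cst].
    by move=> y /addIr.
  have shc : (h + t) @[h --> (0:R)] --> t.
    by rewrite -{2}[t]add0r; apply: cvgD; [exact: cvg_id|exact: cvg_cst].
  apply: cvg_dnbhs_at_right; apply: cvgD; last first.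
    have := is_derive_cvg (dP' t tc); apply: cvg_trans; apply: near_eq_cvg; near=> h.
    by rewrite [h *: 1]mulr1 [t + h]addrC.
  have Lt := ut_L2 uC1 (HT tc); have Lut := u_L2 uC (HT tc).
  have n1 := near_u_L2 uC (cT' tc).
  have n2 : \forall h \near (0:R)^', L2 (u (h + t)) by apply: nbhs_dnbhs; exact: (shc _ n1).
  have nz : \forall h \near (0:R)^', L2 (h^-1 *: (u (h + t) - u t)).
    move: n2; apply: filterS => h Lh; exact: (L2Z mOmega _ (L2B mOmega Lh Lut)).
  have dq := cvg_comp _ _ sh (L2_deriv_u uC1 (cT' tc)).
  have q : L2norm (h^-1 *: (u (h + t) - u t)) @[h --> (0:R)^'] --> L2norm (ut t).
    apply: (cvg_dist_le _ dq); move: nz; apply: filterS => h Lh.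
    rewrite /= addrK; exact: (L2norm_dist mOmega Lh Lt).
  apply: cvg_trans (cvgM q q); apply: near_eq_cvg.
  move: nz n2; apply: filterS2 => h Lh Lth /=.
  have Lz := L2B mOmega Lth Lut.
  have e1 := L2norm_sqr Lh.
  have e2 := innerZl mOmega h^-1 Lz Lh.
  have e3 := innerZl mOmega h^-1 Lz Lz.
  rewrite -expr2 e1 e2 innerC e3 mulrA -expr2 exprVn.
  by rewrite [t + h]addrC.
have i1 : t1 \in `[t1, t2] by rewrite in_itv/= lexx ltW.
have i2 : t2 \in `[t1, t2] by rewrite in_itv/= lexx ltW.
have lim := cvgB (limN t2 i2) (limN t1 i1).
have FF : ProperFilter ((0:R)^'+) := at_right_proper_filter (0 : R).
have lc : (fun _ : R => (S + om) ^+ 2 / 2 * (t2 - t1)) x @[x --> (0:R)^'+] -->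
  (S + om) ^+ 2 / 2 * (t2 - t1) by exact: cvg_cst.
have := ler_cvg_to (lim _) lc; apply.
have h0 : \forall h \near (0:R)^'+, 0 < h by exact: nbhs_right_gt.
have hc : \forall h \near (0:R)^'+, h < c - t2 by apply: nbhs_right_lt; rewrite subr_gt0.
near=> h; have hp : 0 < h by near: h.
have hl : h < c - t2 by near: h.
apply: (energy_difference_quotient dP' hp).
by rewrite addrC -lerBrDr ltW.
Unshelve. all: by end_near. Qed.

End energy_dini.

(** * Comparison with the scalar equation *)

(** A minimum point left of [y] would be followed by a smaller value, so the minimum is at [y]. Only
    behaviour to the right of each point is used, in the manner of Dini derivatives. *)
Lemma le_of_right_decreasing (R : realType) (D : R -> R) (x y : R) : x <= y ->
  {within `[x, y], continuous D} ->
  (forall t, x <= t < y -> exists2 s, t < s <= y & D s < D t) -> D y <= D x.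
Proof.
move=> xy cD dec; have [c] := EVT_min xy cD; rewrite in_itv/= => /andP[xc cy] cmin.
have [cy'|yc] := ltP c y; last first.
  have -> : y = c by apply/le_anti; rewrite cy yc.
  by apply: cmin; rewrite in_itv/= lexx.
have [|s /andP[cs sy]] := dec c; first by rewrite xc.
by rewrite ltNge cmin// in_itv/= sy (le_trans xc)// ltW.
Qed.

Section growth_primitive.
Context {R : realType}.
Variables (C4 C5 q : R).
Hypotheses (C40 : 0 < C4) (C50 : 0 < C5) (q0 : 0 < q).
Local Notation lam := (@lebesgue_measure R).

Definition rate (s : R) : R := (C4 + C5 * s `^ q)^-1.

Definition rate_primitive (m : R) : R := \int[lam]_(s in `[0, m]) rate s.

Let den_gt0 s : 0 < C4 + C5 * s `^ q.
Proof. by rewrite ltr_pwDl// mulr_ge0 ?powR_ge0// ltW. Qed.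

Lemma rate_gt0 s : 0 < rate s.
Proof. by rewrite invr_gt0. Qed.

Lemma rate_decr s t : 0 <= s -> s <= t -> rate t <= rate s.
Proof.
move=> s0 st; rewrite lef_pV2 ?posrE//.
rewrite lerD2l ler_wpM2l ?(ltW C50)//; apply: ge0_ler_powR => //; first exact: ltW.
by rewrite nnegrE (le_trans s0).
Qed.

Lemma rate_le s : rate s <= C4^-1.
Proof.
by rewrite lef_pV2 ?posrE// lerDl mulr_ge0 ?powR_ge0// ltW.
Qed.

Lemma measurable_rate : measurable_fun setT rate.
Proof.
have -> : rate = (fun x => x `^ (-1)) \o (fun s => C4 + C5 * s `^ q).
  apply/funext => s; rewrite /= powR_inv1// addr_ge0 ?(ltW C40)//.
  by rewrite mulr_ge0 ?powR_ge0// ltW.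
apply: measurableT_comp; first exact: measurable_powR.
apply: measurable_funD => //; apply: measurable_funM => //; exact: measurable_powR.
Qed.

Lemma integrable_rate (i : interval R) : (lam [set` i] < +oo)%E ->
  lam.-integrable [set` i] (EFin \o rate).
Proof.
move=> ioo; apply: measurable_bounded_integrable => //.
  exact: measurable_funTS measurable_rate.
exists C4^-1; split; first by rewrite num_real.
move=> y Cy x _ /=; rewrite ger0_norm ?(ltW (rate_gt0 _))//.
exact: le_trans (rate_le x) (ltW Cy).
Qed.

Let lam_itv (b1 b2 : bool) (x y : R) : x <= y ->
  (lam [set` Interval (BSide b1 x) (BSide b2 y)] = (y - x)%:E)%E.
Proof.
rewrite le_eqVlt => /predU1P[<-|xy]; rewrite lebesgue_measure_itv/= lte_fin.
  by rewrite ltxx subrr.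
by rewrite xy EFinB.
Qed.

Lemma rate_primitiveB (x y : R) : 0 <= x -> x <= y ->
  rate_primitive y - rate_primitive x = \int[lam]_(s in `]x, y]) rate s.
Proof.
move=> x0 xy; apply: Rintegral_itvB.
- by apply: integrable_rate; rewrite lam_itv ?ltry// (le_trans x0).
- by rewrite bnd_simp.
- by rewrite bnd_simp.
Qed.

(** The rate is nonincreasing, so the left end point bounds the integrand. The bound thus involves
    the rate at the current energy, where the growth of the energy is known. *)
Lemma rate_primitive_le (x y : R) : 0 <= x -> x <= y ->
  rate_primitive y - rate_primitive x <= rate x * (y - x).
Proof.
move=> x0 xy; rewrite rate_primitiveB//.
have foo : (lam `]x, y] < +oo)%E by rewrite lam_itv ?ltry.
apply: (@le_trans _ _ (\int[lam]_(s in `]x, y]) (rate x))).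
  apply: le_Rintegral => //; first exact: integrable_rate.
    apply: measurable_bounded_integrable => //.
    exists (rate x); split; first by rewrite num_real.
    by move=> z rz s _ /=; rewrite ger0_norm ?(ltW (rate_gt0 _))// ltW.
  by move=> s /=; rewrite in_itv/= => /andP[xs _]; rewrite rate_decr// ltW.
by rewrite Rintegral_cst//= lam_itv.
Qed.

Lemma rate_primitive_mono (x y : R) : 0 <= x -> x <= y ->
  rate_primitive x <= rate_primitive y.
Proof.
move=> x0 xy; rewrite -subr_ge0 rate_primitiveB//; apply: Rintegral_ge0 => s _.
exact: ltW (rate_gt0 s).
Qed.

Lemma rate_primitive_lipschitz (x y : R) : 0 <= x -> 0 <= y ->
  `|rate_primitive y - rate_primitive x| <= C4^-1 * `|y - x|.
Proof.
move=> x0 y0; wlog xy : x y x0 y0 / x <= y.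
  by move=> h; have [/h|/ltW/h] := leP x y; [exact|rewrite distrC [`|y - x|]distrC; exact].
rewrite !ger0_norm ?subr_ge0// ?rate_primitive_mono//.
apply: (le_trans (rate_primitive_le x0 xy)).
by rewrite ler_wpM2r ?subr_ge0// rate_le.
Qed.

Lemma integral_rate_le (m c : R) : 0 <= m ->
  (forall x, m <= x -> rate_primitive x - rate_primitive m <= c) ->
  (\int[lam]_(s in `[m, +oo[) (rate s)%:E <= c%:E)%E.
Proof.
move=> m0 Jc; pose F (i : nat) : set R := [set` `[m, m + i%:R]].
have FU : \bigcup_i F i = [set` `[m, +oo[].
  apply/seteqP; split => x; rewrite /F /= in_itv/= ?andbT.
    by move=> [i _]; rewrite /= in_itv/= => /andP[].
  move=> mx; exists (Num.truncn (x - m)).+1 => //=; rewrite in_itv/= mx/=.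
  have xm : 0 <= x - m by rewrite subr_ge0.
  have := truncn_lt_nat (Num.truncn (x - m)).+1 xm.
  by rewrite leqnn => /esym; lra.
have Fnd : {homo F : i j / (i <= j)%N >-> (i <= j)%O}.
  move=> i j ij; apply/subsetPset => x; rewrite /F /= !in_itv/= => /andP[-> xi].
  by rewrite (le_trans xi)// lerD2l ler_nat.
have mF i : measurable_fun (F i) (EFin \o rate).
  by apply/measurable_EFinP; exact: measurable_funTS measurable_rate.
have F0 i x : F i x -> (0 <= (EFin \o rate) x)%E by rewrite lee_fin ltW// rate_gt0.
have mI i : measurable (F i) by exact: measurable_itv.
have cv := ge0_nondecreasing_set_cvg_integral (mu := lebesgue_measure) Fnd mI mF F0.
rewrite FU in cv; rewrite -(cvg_lim _ cv)//; apply: lime_le.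
  by apply/cvg_ex; eexists; exact: cv.
apply: nearW => i.
have mi : m <= m + i%:R by rewrite lerDl.
have oo : (lam (F i) < +oo)%E by rewrite lam_itv ?ltry.
have -> : (\int[lam]_(x in F i) (EFin \o rate) x = (\int[lam]_(x in F i) rate x)%:E)%E.
  by rewrite /Rintegral fineK//; exact: integrable_fin_num (integrable_rate oo).
rewrite lee_fin -Rintegral_itv_obnd_cbnd; last by apply: integrable_rate; rewrite lam_itv ?ltry.
by rewrite -rate_primitiveB// Jc.
Qed.

End growth_primitive.

(** (1 + a)^2 is at most 4 or at most 4 a^2 according as a <= 1 or a >= 1. It converts a power of
    the gradient norm into a power of its square, which the energy dominates. *)
Lemma sqr_powR_growth (R : realType) (a q : R) : 0 <= a -> 0 <= q ->
  ((1 + a) `^ q) ^+ 2 <= 4 `^ q * (1 + (a ^+ 2) `^ q).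
Proof.
move=> a0 q0.
have -> : ((1 + a) `^ q) ^+ 2 = ((1 + a) ^+ 2) `^ q.
  have a10 : 0 <= 1 + a by rewrite addr_ge0.
  by rewrite -(powR_mulrn 2 (powR_ge0 _ _)) powRAC (powR_mulrn 2 a10).
have [a1|/ltW a1] := leP a 1.
  apply: (@le_trans _ _ (4 `^ q)); last by rewrite ler_peMr ?powR_ge0// lerDl powR_ge0.
  apply: ge0_ler_powR; rewrite ?nnegrE ?sqr_ge0//; nra.
apply: (@le_trans _ _ ((4 * a ^+ 2) `^ q)).
  apply: ge0_ler_powR; rewrite ?nnegrE ?sqr_ge0// ?mulr_ge0 ?sqr_ge0//; nra.
by rewrite powRM ?sqr_ge0// ler_wpM2l ?powR_ge0// lerDr.
Qed.

Lemma cvg_dist0 (R : realType) (T : Type) (F : set_system T) {FF : Filter F}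
  (M : T -> R) (m : R) : M y @[y --> F] --> m -> `|M y - m| @[y --> F] --> 0.
Proof.
move=> Mm; rewrite -(normr0 R) -(subrr m); apply: cvg_norm.
by apply: cvgB Mm _; exact: cvg_cst.
Qed.

Section energy_comparison.
Context {R : realType} {n : nat}.
Variable Omega : set 'rV[R]_n.
Hypotheses (oOmega : open Omega) (bOmega : bounded_set Omega).
Implicit Types (v w phi psi : 'rV[R]_n -> R).
Local Notation H10 := (H10 Omega).
Local Notation L2 := (L2 Omega).
Local Notation Hm1 := (Hm1 Omega).
Local Notation inner := (inner Omega).
Local Notation grad_inner := (grad_inner Omega).
Local Notation H1norm := (H1norm Omega).
Local Notation L2norm := (L2norm Omega).
Local Notation gradnorm := (gradnorm Omega).
Local Notation Hm1norm := (Hm1norm Omega).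
Let mOmega := open_measurable_rV oOmega.
#[local] Opaque Defs.H1norm Defs.gradnorm Defs.grad_inner Defs.L2norm Defs.inner.
Variables (T : R) (u ut : R -> 'rV[R]_n -> R) (utt : R -> ('rV[R]_n -> R) -> R).
Hypotheses (uC : C0_time H10 H1norm T u) (uC1 : C1_time L2 L2norm T u ut)
  (uC2 : C2_time Hm1 Hm1norm T (fun t => inner (u t)) (fun t => inner (ut t)) utt)
  (utH : {ae lebesgue_measure, forall t, t \in `]0, T[ -> H10 (ut t)}).
Variables (f : R -> R) (K q : R).
Hypothesis eqn : forall phi, H10 phi ->
  {ae lebesgue_measure, forall t, t \in `[0, T] ->
     utt t phi + grad_inner (u t) phi + grad_inner (ut t) phi + inner (ut t) phi
     = inner (f \o u t) phi}.
Hypotheses (K0 : 0 <= K) (q1 : 1 < q).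
Hypothesis nonlin : forall v phi, H10 v -> H10 phi ->
  `|inner (f \o v) phi| <= K * (1 + gradnorm v) `^ q * gradnorm phi.

Let B (t : R) : R := K * (1 + gradnorm (u t)) `^ q.
Let M (t : R) : R := L2norm (ut t) ^+ 2 + gradnorm (u t) ^+ 2.

Let B0 t : 0 <= B t.
Proof. by rewrite mulr_ge0 ?powR_ge0. Qed.

Let M0 t : 0 <= M t.
Proof. by rewrite addr_ge0 ?sqr_ge0. Qed.

(** Continuity of [u] in H1 makes both the bound [B] and the oscillation of the gradient nearly
    constant on a short interval to the right of [t1]. *)
Lemma local_energy_growth t1 (e : R) : t1 \in `]0, T[ -> 0 < e ->
  exists2 c, t1 < c < T & forall t2, t1 < t2 < c ->
    M t2 - M t1 <= (B t1 + e) ^+ 2 / 2 * (t2 - t1).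
Proof.
move=> t1T e0; have /andP[t10 t1T'] : 0 < t1 < T by rewrite in_itv/= in t1T.
have cB : {for t1, continuous B}.
  have cg := continuous_gradnorm_u oOmega bOmega uC t1T.
  have g1 : 0 < 1 + gradnorm (u t1) by rewrite ltr_pwDl// gradnorm_ge0.
  have d := is_derive1_powR q g1.
  have cp : {for 1 + gradnorm (u t1), continuous (fun x : R => x `^ q)}.
    by apply: differentiable_continuous; apply/derivable1_diffP; exact: ex_derive.
  have c1 : {for t1, continuous (fun t => 1 + gradnorm (u t))}.
    exact: (cvgD (cvg_cst _) cg).
  have c2 := continuous_comp c1 cp.
  exact: (cvgM (cvg_cst K) c2).
have e2 : 0 < e / 2 by lra.
have e4 : 0 < e / 4 by lra.
have n1 := cvgr_lt _ cB _ (_ : B t1 < B t1 + e / 2).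
have {}n1 : \forall s \near t1, B s < B t1 + e / 2 by apply: n1; rewrite ltrDl.
have n2 : \forall s \near t1, H1norm (u s - u t1) < e / 4.
  exact: (cvgr_lt _ (cvg_u uC t1T) _ e4).
have n3 := near_in_itvoo t1T.
have : \forall s \near t1, [/\ B s < B t1 + e / 2, H1norm (u s - u t1) < e / 4 & s \in `]0, T[].
  by near=> s; split; near: s.
move=> /nbhs_ballP[d /= d0 bd].
have {}bd s : t1 <= s -> s <= t1 + d / 2 ->
    [/\ B s < B t1 + e / 2, H1norm (u s - u t1) < e / 4 & s \in `]0, T[].
  move=> ts sd; apply: bd; rewrite /ball/= ltr_distlC; apply/andP; split; lra.
have td : t1 <= t1 + d / 2 by lra.
pose c := t1 + d / 2.
have cT : c < T by have [_ _] := bd c td (lexx _); rewrite in_itv/= => /andP[].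
exists c; first by rewrite cT andbT /c; lra.
move=> t2 /andP[t12 t2c].
(* One half of [e] pays for the variation of [B], that is for [S]; the other for the oscillation
   [om], itself a sum of two distances e / 4 to [u t1]. *)
have -> : B t1 + e = B t1 + e / 2 + e / 2 by rewrite -addrA -splitr.
apply: (energy_dini oOmega bOmega uC uC1 uC2 utH eqn t10 t12 t2c cT).
  move=> t phi; rewrite in_itv/= => /andP[t1t tc] Hphi.
  have [Bt _ tT] := bd t t1t tc.
  have Hut := u_H10 uC (subset_itv_oo_cc tT).
  apply: le_trans (le_trans (ler_norm _) (nonlin Hut Hphi)) _.
  by rewrite ler_wpM2r ?gradnorm_ge0// ltW.
move=> t s; rewrite !in_itv/= => /andP[t1t tc] /andP[t1s sc].
have [_ nt tT] := bd t t1t tc; have [_ ns sT] := bd s t1s sc.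
have Ht := u_H10 uC (subset_itv_oo_cc tT); have Hs := u_H10 uC (subset_itv_oo_cc sT).
have Ht1 := u_H10 uC (subset_itv_oo_cc t1T).
have a1 := H10_H1 (H10B oOmega bOmega Ht Ht1).
have a2 := H10_H1 (H10B oOmega bOmega Hs Ht1).
have h := gradnorm_lin oOmega bOmega (-1) a2 a1.
have eq : -1 *: (u s - u t1) + (u t - u t1) = u t - u s.
  by rewrite scaleN1r opprB addrC addrA subrK.
rewrite eq normrN normr1 mul1r in h; apply: (le_trans h).
have g1 := le_lt_trans (gradnorm_H1norm _ _) nt.
have g2 := le_lt_trans (gradnorm_H1norm _ _) ns.
rewrite (_ : e / 2 = e / 4 + e / 4); last by field.
exact: lerD (ltW g2) (ltW g1).
Unshelve. all: by end_near. Qed.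

(** The first summand dominates the coefficient in B^2 / 2 given by [sqr_powR_growth]; the summand 1
    is the margin that makes the growth strictly slower than the scalar equation. *)
Let C : R := K ^+ 2 * 4 `^ q / 2 + 1.
Let C0 : 0 < C.
Proof. by rewrite ltr_wpDl// mulr_ge0// mulr_ge0 ?sqr_ge0 ?powR_ge0. Qed.
Let q0 : 0 < q := lt_trans ltr01 q1.
Local Notation J := (rate_primitive C C q).

(** The error terms B e + e^2 / 2 must stay below the margin 1 in [C]; the chosen [e] satisfies (B +
    1) e = 1/2 and is at most 1/2, so they do. *)
Lemma energy_growth_rate t : exists2 e, 0 < e & (B t + e) ^+ 2 / 2 * rate C C q (M t) < 1.
Proof.
have b0 := B0 t.
have e0 : 0 < (2 * B t + 2)^-1 by rewrite invr_gt0; lra.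
exists (2 * B t + 2)^-1 => //.
have E : (2 * B t + 2) * (2 * B t + 2)^-1 = 1 by rewrite mulfV//; apply/eqP; lra.
have Ble : B t ^+ 2 <= K ^+ 2 * 4 `^ q * (1 + M t `^ q).
  rewrite /B exprMn -mulrA ler_wpM2l ?sqr_ge0//.
  apply: (le_trans (sqr_powR_growth (gradnorm_ge0 _ _) (ltW q0))).
  rewrite ler_wpM2l ?powR_ge0// lerD2l; apply: ge0_ler_powR; rewrite ?nnegrE ?sqr_ge0//.
    exact: ltW.
  by rewrite lerDr sqr_ge0.
have p0 := powR_ge0 (M t) q.
have d0 : 0 < C + C * M t `^ q by rewrite ltr_pwDl// mulr_ge0// ltW.
rewrite /rate ltr_pdivrMr// mul1r /C.
move: E e0 b0 Ble p0; move: (2 * B t + 2)^-1 => e.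
move: (B t) (M t `^ q) (K ^+ 2 * 4 `^ q) => b m k E e0 b0 Ble p0.
have be : 0 <= b * e := mulr_ge0 b0 (ltW e0).
have e12 : e <= 2^-1 by lra.
have : e ^+ 2 <= 2^-1 * e by rewrite expr2 ler_wpM2r// ltW.
lra.
Qed.

Lemma continuous_M t : t \in `]0, T[ -> {for t, continuous M}.
Proof.
move=> tT; have cg := continuous_gradnorm_u oOmega bOmega uC tT.
have cut : {for t, continuous (fun s => L2norm (ut s))}.
  apply: (cvg_dist_le _ (cvg_ut uC1 tT)).
  have : \forall s \near t, s \in `]0, T[ by exact: near_in_itvoo.
  apply: filterS => s sT.
  exact: (L2norm_dist mOmega (ut_L2 uC1 (subset_itv_oo_cc sT)) (ut_L2 uC1 (subset_itv_oo_cc tT))).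
exact: (cvgD (cvgM cut cut) (cvgM cg cg)).
Qed.

(** [J] linearises the scalar equation: along its solutions J grows at unit speed. Since the energy
    grows strictly slower, the continuous function J(M(x)) - x decreases to the right of each
    point. *)
Lemma energy_comparison_pos s t : 0 < s -> s <= t -> t < T ->
  J (M t) - t <= J (M s) - s.
Proof.
move=> s0 st tT; pose D x := J (M x) - x.
have inT x : s <= x -> x <= t -> x \in `]0, T[.
  by move=> sx xt; rewrite in_itv/= (lt_le_trans s0)// (le_lt_trans xt).
apply: (@le_of_right_decreasing R D s t st).
  apply: continuous_in_subspaceT => x; rewrite inE/= in_itv/= => /andP[sx xt].
  have cM := continuous_M (inT x sx xt).
  apply: cvgB; last exact: cvg_id.
  apply: (@cvg_dist_le _ _ _ _ _ (fun y => `|M y - M x| * C^-1)).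
    by apply: nearW => y; rewrite mulrC; exact: rate_primitive_lipschitz.
  exact: (cvg_mulr0l C^-1 (cvg_dist0 cM)).
move=> x /andP[sx xt]; have xT := inT x sx (ltW xt).
have [e e0 eM] := energy_growth_rate x.
have [c /andP[xc cT] cM] := local_energy_growth xT e0.
pose y := x + (Num.min c t - x) / 2.
have mx : x < Num.min c t by rewrite lt_min xc.
have xy : x < y by rewrite ltrDl divr_gt0// subr_gt0.
have ym : y < Num.min c t by rewrite /y; lra.
have /andP[yc yt] : (y < c) && (y < t) by rewrite -lt_min.
exists y; first by rewrite xy ltW.
have dM := cM y; rewrite xy yc in dM; have {}dM := dM isT.
rewrite /D ltrBlDr addrAC -addrA -ltrBlDl.
have yx : 0 < y - x by rewrite subr_gt0.
(* If the energy does not increase, monotonicity of [J] suffices; the estimate by the rate at [M x]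
   concerns only an increase. *)
have [Mle|Mlt] := leP (M y) (M x).
  by apply: le_lt_trans yx; rewrite subr_le0; exact: (rate_primitive_mono q C0 C0 (M0 y) Mle).
have h1 := rate_primitive_le C0 C0 q0 (M0 x) (ltW Mlt).
apply: (le_lt_trans h1).
have r0 := rate_gt0 q C0 C0 (M x).
apply: (le_lt_trans (ler_wpM2l (ltW r0) dM)).
by rewrite mulrA [rate _ _ _ _ * _]mulrC gtr_pMl.
Qed.

(** The local estimates concern interior times, so the initial time is reached as the limit of [s]
    from the right, using the one-sided continuity of both norms at 0. *)
Lemma energy_comparison t : 0 < t -> t < T -> J (M t) - J (M 0) <= t.
Proof.
move=> t0 tT; have T0 := lt_trans t0 tT.
have oT : 0 \in `[0, T] by rewrite in_itv/= lexx ltW.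
have rT : \forall s \near (0:R)^'+, s \in `[0, T].
  by near=> s; rewrite in_itv/=; apply/andP; split; [|near: s; exact: nbhs_right_le].
have sub : (0:R)^'+ `=>` within `[0, T]%classic (nbhs (0:R)).
  move=> P; rewrite /within /= => tP.
  have {}tP : \forall s \near (0:R)^'+, s \in `[0, T] -> P s := @cvg_within R (nbhs (0:R)) _ _ _ tP.
  change (\forall s \near (0:R)^'+, P s); near=> s.
  have sT : s \in `[0, T] by near: s; exact: rT.
  by move: sT; near: s; exact: tP.
have cu : H1norm (u s - u 0) @[s --> (0:R)^'+] --> 0.
  have [_ h] := uC oT; exact: cvg_trans (cvg_app _ sub) h.
have cut : L2norm (ut s - ut 0) @[s --> (0:R)^'+] --> 0.
  case: uC1 => _ /(_ 0 oT)[_ h] _; exact: cvg_trans (cvg_app _ sub) h.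
have lu : gradnorm (u s) @[s --> (0:R)^'+] --> gradnorm (u 0).
  apply: (cvg_dist_le _ cu); move: rT; apply: filterS => s sT.
  have Hs := u_H10 uC sT; have Ho := u_H10 uC oT.
  exact: le_trans (gradnorm_dist oOmega bOmega (H10_H1 Hs) (H10_H1 Ho)) (gradnorm_H1norm _ _).
have lut : L2norm (ut s) @[s --> (0:R)^'+] --> L2norm (ut 0).
  apply: (cvg_dist_le _ cut); move: rT; apply: filterS => s sT.
  exact: (L2norm_dist mOmega (ut_L2 uC1 sT) (ut_L2 uC1 oT)).
have FF : ProperFilter ((0:R)^'+) := at_right_proper_filter (0 : R).
have lM : M s @[s --> (0:R)^'+] --> M 0 by exact: (cvgD (cvgM lut lut) (cvgM lu lu)).
have lJ : J (M s) @[s --> (0:R)^'+] --> J (M 0).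
  apply: (@cvg_dist_le _ _ _ _ _ (fun y => `|M y - M 0| * C^-1)).
    by apply: nearW => y; rewrite mulrC; exact: rate_primitive_lipschitz.
  exact: (cvg_mulr0l C^-1 (cvg_dist0 lM)).
rewrite lerBlDr addrC -lerBlDr.
have lc : (fun _ : R => J (M t) - t) x @[x --> (0:R)^'+] --> J (M t) - t by exact: cvg_cst.
have := ler_cvg_to lc lJ; apply.
near=> s; have s0 : 0 < s by near: s; exact: nbhs_right_gt.
have st : s <= t by near: s; exact: nbhs_right_le.
apply: (le_trans (energy_comparison_pos s0 st tT)).
by rewrite gerBl ltW.
Unshelve. all: by end_near. Qed.

End energy_comparison.

(** * Boundedness of the energy excludes blow-up *)

Section blow_up.
Context {R : realType} {n : nat}.
Variable Omega : set 'rV[R]_n.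
Hypotheses (oOmega : open Omega) (bOmega : bounded_set Omega).
Implicit Types (v w phi : 'rV[R]_n -> R).
Local Notation H1norm := (H1norm Omega).
Local Notation L2norm := (L2norm Omega).
Local Notation gradnorm := (gradnorm Omega).
Local Notation mu := (lebesgue_rV n).
Let mOmega := open_measurable_rV oOmega.

(** The defining condition of a weak derivative depends on the function only through integrals over
    [Omega]. Both functions therefore have the same set of weak derivatives, and the choice operator
    selects the same one. *)
Lemma ae_eq_gradnorm v v' : L2 Omega v -> L2 Omega v' ->
  {ae mu, forall x, Omega x -> v x = v' x} -> gradnorm v = gradnorm v'.
Proof.
move=> Lv Lv' vv'; rewrite /Defs.gradnorm; congr Num.sqrt; apply: eq_bigr => i _.
suff -> : weak_partial Omega i v = weak_partial Omega i v' by [].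
rewrite /weak_partial; congr xget; apply/funext => g; apply/propext.
have E phi : test_function Omega phi ->
    inner Omega v (partial i phi) = inner Omega v' (partial i phi).
  move=> tphi; have Lp := L2_test oOmega bOmega (test_function_partial i tphi).
  exact: (ae_eq_inner mOmega Lv Lv' Lp vv').
by split=> -[Lg wg]; split=> // phi tphi; [rewrite -(wg _ tphi)|rewrite -(wg _ tphi)];
  [exact: esym (E _ tphi)|exact: E].
Qed.

#[local] Opaque Defs.H1norm Defs.gradnorm Defs.grad_inner Defs.L2norm Defs.inner.

Lemma ae_eq_L2norm v v' : L2 Omega v -> L2 Omega v' ->
  {ae mu, forall x, Omega x -> v x = v' x} -> L2norm v = L2norm v'.
Proof.
move=> Lv Lv' vv'; rewrite (L2normE Lv) (L2normE Lv'); congr Num.sqrt.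
apply: (etrans (ae_eq_inner mOmega Lv Lv' Lv vv')).
apply: (etrans (innerC _ _ _)); exact: (ae_eq_inner mOmega Lv Lv' Lv' vv').
Qed.

(** The energy appears as an existential [M] because the velocity is hidden inside [weak_solution]
    and may be a different witness for each [T]. *)
Lemma weak_solution_energy (K q : R) (f : R -> R) u0 u1 (T : R) u (t : R) :
  0 <= K -> 1 < q -> H10 Omega u0 -> L2 Omega u1 ->
  (forall v phi, H10 Omega v -> H10 Omega phi -> `|inner Omega (f \o v) phi| <=
     K * (1 + gradnorm v) `^ q * gradnorm phi) ->
  weak_solution Omega f u0 u1 T u -> 0 < t < T ->
  exists2 M, gradnorm (u t) ^+ 2 <= M &
    rate_primitive (K ^+ 2 * 4 `^ q / 2 + 1) (K ^+ 2 * 4 `^ q / 2 + 1) q M -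
    rate_primitive (K ^+ 2 * 4 `^ q / 2 + 1) (K ^+ 2 * 4 `^ q / 2 + 1) q
      (L2norm u1 ^+ 2 + gradnorm u0 ^+ 2) <= t.
Proof.
move=> K0 q1 Hu0 Lu1 NL [ut [utt [[uC uC1 uC2 [utH _ _]] eu0 eu1 eqn]]] /andP[t0 tT].
have T0 := lt_trans t0 tT.
have oT : 0 \in `[0, T] by rewrite in_itv/= lexx ltW.
exists (L2norm (ut t) ^+ 2 + gradnorm (u t) ^+ 2); first by rewrite lerDr sqr_ge0.
have := energy_comparison oOmega bOmega uC uC1 uC2 utH eqn K0 q1 NL t0 tT.
have -> : L2norm (ut 0) = L2norm u1 := ae_eq_L2norm (ut_L2 uC1 oT) Lu1 eu1.
have -> // : gradnorm (u 0) = gradnorm u0.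
exact: (ae_eq_gradnorm (u_L2 uC oT) (H1_L2 (H10_H1 Hu0)) eu0).
Qed.

Lemma continuous_H1norm (f : R -> R) u0 u1 (T : R) u :
  weak_solution Omega f u0 u1 T u ->
  {within `[0, T], continuous (fun t => H1norm (u t) ^+ 2)}.
Proof.
move=> [ut [utt [[uC _ _ _] _ _ _]]].
apply/subspace_continuousP => t tT; have [Ht cu] := uC t tT.
have cN : H1norm (u s) @[s --> within `[0, T]%classic (nbhs t)] --> H1norm (u t).
  apply: (cvg_dist_le _ cu); rewrite near_withinE; apply: nearW => s sT.
  have [Hs _] := uC s sT; exact: (H1norm_dist oOmega bOmega (H10_H1 Hs) (H10_H1 Ht)).
exact: (cvgM cN cN).
Qed.

(** The Poincare inequality turns the bound [x] on the squared gradient norm into [P * x] for the L2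
    part and [(P + 1) * x] for the squared H1 norm. *)
Lemma blow_up_quantity_le (P x : R) (f : R -> R) u0 u1 (T : R) u (t : R) :
  0 <= P -> (forall v, H10 Omega v -> L2norm v ^+ 2 <= P * gradnorm v ^+ 2) ->
  weak_solution Omega f u0 u1 T u -> 0 < t < T ->
  (forall s, 0 < s <= t -> gradnorm (u s) ^+ 2 <= x) ->
  \int[lebesgue_measure]_(s in `[0, t]) H1norm (u s) ^+ 2 + L2norm (u t) ^+ 2
    <= (P + 1) * x * t + P * x.
Proof.
move=> P0 PP ws /andP[t0 tT] gx.
have cN := continuous_H1norm ws.
have [ut [utt [[uC _ _ _] _ _ _]]] := ws.
have HT s : 0 < s <= t -> H10 Omega (u s).
  move=> /andP[s0 st]; apply: (u_H10 uC).
  by rewrite in_itv/= (ltW s0) (le_trans st)// ltW.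
have L2x s : 0 < s <= t -> L2norm (u s) ^+ 2 <= P * x.
  by move=> st; apply: (le_trans (PP _ (HT s st))); rewrite ler_wpM2l// gx.
rewrite lerD//; last by apply: L2x; rewrite t0 lexx.
have sub : `[0, t]%classic `<=` `[0, T]%classic.
  move=> s; rewrite /= !in_itv/= => /andP[-> st]; exact: le_trans st (ltW tT).
have it : lebesgue_measure.-integrable `[0, t]%classic (EFin \o (fun s => H1norm (u s) ^+ 2)).
  apply: continuous_compact_integrable; first exact: segment_compact.
  exact: continuous_subspaceW cN.
(* The end point 0 is removed from the interval, since the gradient bound is given for positive
   times only. *)
rewrite -Rintegral_itv_obnd_cbnd; last first.
  apply: integrableS it => //; exact: subset_itv_oc_cc.
have lamE : (lebesgue_measure (`]0%R, t]%classic : set R) = t%:E).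
  by rewrite lebesgue_measure_itv/= lte_fin t0 sube0.
have -> : (P + 1) * x * t = \int[lebesgue_measure]_(s in `]0%R, t]) ((P + 1) * x).
  by rewrite Rintegral_cst//= lamE.
apply: le_Rintegral => //.
- apply: integrableS it => //; exact: subset_itv_oc_cc.
- apply: measurable_bounded_integrable => //.
    by rewrite [X in (X < _)%E]lamE ltry.
  exists `|(P + 1) * x|; split; first by rewrite num_real.
  by move=> z rz s _ /=; exact: ltW.
move=> s /=; rewrite in_itv/= => st.
apply: (@le_trans _ _ (P * x + x)); last by lra.
apply: le_trans (_ : L2norm (u s) ^+ 2 + gradnorm (u s) ^+ 2 <= _).
  by rewrite (H1norm_sqr Omega (u s)).
by rewrite lerD ?L2x ?gx.
Qed.

End blow_up.

Theorem theorem4p1 (R : realType) (n : nat) (Omega : set 'rV[R]_n)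
    (alpha beta q : R) :
  (1 <= n)%N -> smooth_bounded_domain Omega ->
  0 < alpha -> 0 < beta ->
  1 < q -> (q%:E < critical_exponent n - 1%:E)%E ->
  exists C4 C5 : R, [/\ 0 < C4, 0 < C5 &
    forall (f : R -> R) (u0 u1 : 'rV[R]_n -> R) (u : R -> 'rV[R]_n -> R)
        (Tmax : R),
      C1_fun f -> superlinear f -> growth alpha beta q f ->
      derivative_growth n f ->
      H10 Omega u0 -> L2 Omega u1 ->
      (exists2 T, 0 < T & weak_solution Omega f u0 u1 T u) ->
      blows_up_at Omega f u0 u1 Tmax u ->
      (\int[lebesgue_measure]_(s in
           `[(L2norm Omega u1 ^+ 2 + gradnorm Omega u0 ^+ 2)%R, +oo[)
         ((C4 + C5 * s `^ q)^-1)%:E <= Tmax%:E)%E].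
Proof.
move=> n0 [oO _ _ bO _] a0 b0 q1 qn.
have [P [K [P0 K0 PP NL]]] := sobolev_constants n0 oO bO a0 b0 q1 qn.
have C0 : 0 < K ^+ 2 * 4 `^ q / 2 + 1.
  by rewrite ltr_wpDl// mulr_ge0// mulr_ge0 ?sqr_ge0 ?powR_ge0.
exists (K ^+ 2 * 4 `^ q / 2 + 1), (K ^+ 2 * 4 `^ q / 2 + 1); split=> //.
move=> f u0 u1 u Tmax [df _] _ gf _ Hu0 Lu1 [T1 T10 ws1] [maxE blow].
have cf : continuous f.
  by move=> s; apply: differentiable_continuous; apply/derivable1_diffP; exact: df.
have {}NL v phi := NL f v phi cf gf.
have Tmax0 : 0 < Tmax.
  rewrite -lte_fin -maxE (@lt_le_trans _ _ T1%:E) ?lte_fin//.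
  by apply: ereal_sup_ubound; exists T1.
set m0 := L2norm Omega u1 ^+ 2 + gradnorm Omega u0 ^+ 2.
have m00 : 0 <= m0 by rewrite addr_ge0 ?sqr_ge0.
(* The improper integral is the supremum of its finite pieces, so each upper limit [x] can be
   treated separately; exceeding [Tmax] will contradict blow-up. *)
suff Jm (x : R) : m0 <= x -> rate_primitive (K ^+ 2 * 4 `^ q / 2 + 1)
    (K ^+ 2 * 4 `^ q / 2 + 1) q x - rate_primitive (K ^+ 2 * 4 `^ q / 2 + 1)
    (K ^+ 2 * 4 `^ q / 2 + 1) q m0 <= Tmax.
  exact: (integral_rate_le C0 C0 m00 Jm).
move=> m0x; rewrite leNgt; apply/negP => xT.
have x0 : 0 <= x by exact: le_trans m0x.
(* The maximal time is a supremum, so each earlier time is interior to some interval of existence,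
   although none need reach [Tmax]. *)
have sol t : 0 < t < Tmax -> exists2 T, weak_solution Omega f u0 u1 T u & t < T.
  move=> /andP[t0 tT]; have : (t%:E < max_time Omega f u0 u1 u)%E by rewrite maxE lte_fin.
  by move=> /ereal_sup_gt[_ [T [_ wT] <-]]; rewrite lte_fin; exists T.
have gx s : 0 < s < Tmax -> gradnorm Omega (u s) ^+ 2 <= x.
  move=> /[dup] /sol[T wT sT] /andP[s0 sTmax].
  have := weak_solution_energy oO bO K0 q1 Hu0 Lu1 NL wT; rewrite -/m0.
  move=> /(_ s); rewrite s0 sT => /(_ isT)[M gM JM].
  (* An energy of at least [x] at time [s] would require J(x) - J(m0) <= s < Tmax, against the
     assumption [xT]. *)
  apply: (le_trans gM); rewrite leNgt; apply/negP => /ltW xM.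
  have := rate_primitive_mono q C0 C0 x0 xM; lra.
have near_T : \forall t \near Tmax^'-, 0 < t < Tmax.
  near=> t; apply/andP; split; near: t; [exact: nbhs_left_gt|exact: nbhs_left_lt].
have FF : ProperFilter Tmax^'- by exact: at_left_proper_filter.
(* The level is the bound of [blow_up_quantity_le] with [t] replaced by [Tmax], hence an upper bound
   valid for all earlier times, which divergence nevertheless surpasses. *)
have large : \forall t \near Tmax^'-, (P + 1) * x * Tmax + P * x <
    \int[lebesgue_measure]_(tau in `[0, t]) H1norm Omega (u tau) ^+ 2
      + L2norm Omega (u t) ^+ 2.
  by move/cvgryPgt : blow; exact.
have [t [/andP[t0 tTmax]]] := filter_ex (filterI near_T large).
apply/negP; rewrite -leNgt.
have [|T wT tT] := sol t; first by rewrite t0.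
have t0T : 0 < t < T by rewrite t0.
have gxt r : 0 < r <= t -> gradnorm Omega (u r) ^+ 2 <= x.
  by move=> /andP[r0 rt]; apply: gx; rewrite r0 (le_lt_trans rt).
apply: (le_trans (blow_up_quantity_le oO bO P0 PP wT t0T gxt)).
by rewrite lerD2r ler_wpM2l ?(ltW tTmax)// mulr_ge0// addr_ge0.
Unshelve. all: by end_near. Qed.
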